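(* Let $0<r_0<r_1<\infty$, $\mathcal{M}=(r_0,r_1)\times S^2$, and let $p_0,E_1,s_1$ be constants satisfying $$p_0>\Big(\frac{2}{\gamma}\cdot\frac{\gamma-1}{\gamma+1}\Big)^{\frac{\gamma}{\gamma-1}}E_1^{\frac{\gamma}{\gamma-1}}A(s_1)^{-\frac{1}{\gamma-1}},\qquad E_1-\frac{\gamma p_0}{(\gamma-1)\rho_0}>0,\quad \rho_0:=(p_0/A(s_1))^{1/\gamma}.$$ Consider Problem (S1): solve the steady Euler system $$\mathrm{div}(\rho u\otimes u)+\mathrm{grad}\,p=0,\quad \mathrm{div}(\rho u)=0,\quad \mathrm{div}(\rho Eu)=0\quad\text{in }\mathcal{M},$$ with $p=p_0$ on $M_0=\{r_0\}\times S^2$ and $E=E_1$, $s=s_1$, $u'=0$ on $M_1=\{r_1\}\times S^2$. Then the only solution of Problem (S1) of class $C^2(\mathcal{M})\cap C^1(\overline{\mathcal{M}})$ satisfying $\rho u^0>0$ in $\overline{\mathcal{M}}$ is the special spherically symmetric subsonic solution $\underline{U}$.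
   Context: $\mathcal{M}$ is identified with the spherical shell $\{r_0<|x|<r_1\}\subset\mathbb{R}^3$ with the Euclidean metric $G=dx^0\otimes dx^0+(x^0)^2g$, $x^0=r=|x|$, $g$ the standard metric of $S^2$. Velocity is written $u=u^0\partial_0+u'$, with $u^0$ the normal (radial) component and $u'$ the tangential velocity (tangent to spheres). $p>0$ is pressure, $\rho>0$ density, $s$ entropy, $p=A(s)\rho^\gamma$ with $\gamma>1$, $A(s)=k_0\exp(s/c_\nu)$, $k_0,c_\nu>0$ constants; $c=\sqrt{\gamma p/\rho}$ is the sonic speed; $E=\frac12|u|^2+\frac{c^2}{\gamma-1}$. A flow is subsonic if $|u|<c$. $\underline{U}$ denotes the unique solution of Problem (S1) that depends only on $r$, has $u'\equiv0$, is subsonic and has $u^0(r_0)>0$; writing $u=u^0(r)$, it is the solution on $[r_0,r_1]$ of $$\frac{du}{dr}=\frac{2c^2u}{r(u^2-c^2)},\quad \frac{d\rho}{dr}=-\frac{2\rho u^2}{r(u^2-c^2)},\quad \frac{dp}{dr}=-\frac{2\rho c^2u^2}{r(u^2-c^2)}$$ with $p(r_0)=p_0$, $\rho(r_0)=\rho_0$, $u(r_0)=\sqrt{2\big(E_1-\frac{\gamma p_0}{(\gamma-1)\rho_0}\big)}>0$. *)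

(* Defs.v *)
From HB Require Import structures.
From mathcomp Require Export all_boot all_order all_algebra.
From mathcomp Require Export all_classical all_reals all_analysis.

Set Implicit Arguments.
Unset Strict Implicit.
Unset Printing Implicit Defensive.

Import Order.TTheory GRing.Theory Num.Theory.
Import numFieldNormedType.Exports.

Local Open Scope classical_set_scope.
Local Open Scope ring_scope.

Section Euclidean.
Variable R : realType.
Implicit Types (x v w : 'rV[R]_3) (r : R) (A : set 'rV[R]_3).

Definition dot v w : R := \sum_(i < 3) v 0 i * w 0 i.

(* The library norm `|v| on row vectors is the sup norm; it induces the same
   topology, but lengths must be measured with the Euclidean norm. *)
Definition enorm v : R := Num.sqrt (dot v v).

Definition basis (i : 'I_3) : 'rV[R]_3 := delta_mx 0 i.

Definition partial (i : 'I_3) (f : 'rV[R]_3 -> R) : 'rV[R]_3 -> R :=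
  'D_(basis i) f.

Definition divergence (F : 'rV[R]_3 -> 'rV[R]_3) x : R :=
  \sum_(j < 3) partial j (fun y => F y 0 j) x.

Definition sphere r : set 'rV[R]_3 := [set x | enorm x = r].

Definition shell (r0 r1 : R) : set 'rV[R]_3 :=
  [set x | r0 < enorm x < r1].

Definition closed_shell (r0 r1 : R) : set 'rV[R]_3 :=
  [set x | r0 <= enorm x <= r1].

(* For open A: class C^1 and C^2 in A. *)
Definition C1_on A (f : 'rV[R]_3 -> R) : Prop :=
  {within A, continuous f} /\
  forall i, (forall x, A x -> derivable f x (basis i)) /\
            {within A, continuous (partial i f)}.

Definition C2_on A (f : 'rV[R]_3 -> R) : Prop :=
  C1_on A f /\ forall i, C1_on A (partial i f).

(* C^1 up to the boundary: f is continuous on the closure cA of the open set A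
   and its first derivatives in A extend continuously to cA. *)
Definition C1_upto A (cA : set 'rV[R]_3) (f : 'rV[R]_3 -> R) : Prop :=
  [/\ C1_on A f,
      {within cA, continuous f} &
      forall i, exists2 g : 'rV[R]_3 -> R,
        {within cA, continuous g} & {in A, partial i f =1 g}].

End Euclidean.

Record flow (R : realType) := Flow {
  velocity : 'rV[R]_3 -> 'rV[R]_3;
  pressure : 'rV[R]_3 -> R;
  density  : 'rV[R]_3 -> R;
  entropy  : 'rV[R]_3 -> R }.

Section Gas.
Variable R : realType.
Implicit Types (gamma : R) (U : flow R) (x : 'rV[R]_3).

Definition Afun (k0 cnu s : R) : R := k0 * expR (s / cnu).

Definition sound_speed gamma (p rho : R) : R := Num.sqrt (gamma * p / rho).

Definition bernoulli gamma U x : R :=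
  enorm (velocity U x) ^+ 2 / 2 +
  sound_speed gamma (pressure U x) (density U x) ^+ 2 / (gamma - 1).

Definition normal_velocity U x : R := dot (velocity U x) x / enorm x.

Definition tangential_velocity U x : 'rV[R]_3 :=
  velocity U x - (normal_velocity U x / enorm x) *: x.

Definition gas_state gamma (k0 cnu : R) U x : Prop :=
  [/\ 0 < pressure U x, 0 < density U x &
      pressure U x = Afun k0 cnu (entropy U x) * density U x `^ gamma].

(* In Cartesian coordinates the i-th component of div (rho u (x) u) is
   div (rho u_i u). *)
Definition euler gamma U x : Prop :=
  [/\ forall i, divergence (fun y => (density U y * velocity U y 0 i)
                                       *: velocity U y) x
                + partial i (pressure U) x = 0,
      divergence (fun y => density U y *: velocity U y) x = 0 &
      divergence (fun y => (density U y * bernoulli gamma U y)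
                             *: velocity U y) x = 0].

Definition regular (r0 r1 : R) U : Prop :=
  let C f := C2_on (shell r0 r1) f /\
             C1_upto (shell r0 r1) (closed_shell r0 r1) f in
  [/\ forall i, C (fun x => velocity U x 0 i),
      C (pressure U), C (density U) & C (entropy U)].

Definition problem_S1 gamma (k0 cnu r0 r1 p0 E1 s1 : R) U : Prop :=
  [/\ {in closed_shell r0 r1, forall x, gas_state gamma k0 cnu U x},
      {in shell r0 r1, forall x, euler gamma U x},
      {in sphere r0, forall x, pressure U x = p0} &
      {in sphere r1, forall x, [/\ bernoulli gamma U x = E1,
                                   entropy U x = s1 &
                                   tangential_velocity U x = 0]}].

Definition admissible_solution gamma (k0 cnu r0 r1 p0 E1 s1 : R) U : Prop :=
  [/\ problem_S1 gamma k0 cnu r0 r1 p0 E1 s1 U,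
      regular r0 r1 U &
      {in closed_shell r0 r1,
        forall x, 0 < density U x * normal_velocity U x}].

Definition inlet_density gamma (k0 cnu p0 s1 : R) : R :=
  (p0 / Afun k0 cnu s1) `^ gamma^-1.

(* Continuity on [r0, r1] and the equations in the open interval give the
   equations at r0 and r1 with one-sided derivatives, the right-hand sides
   being continuous there by subsonicity. *)
Definition subsonic_profile gamma (k0 cnu r0 r1 p0 E1 s1 : R)
    (u rho p : R -> R) : Prop :=
  let rho0 := inlet_density gamma k0 cnu p0 s1 in
  let c r := sound_speed gamma (p r) (rho r) in
  [/\ [/\ {within `[r0, r1], continuous u},
          {within `[r0, r1], continuous rho} &
          {within `[r0, r1], continuous p}],
      {in `[r0, r1], forall r : R, [/\ 0 < p r, 0 < rho r & `|u r| < c r]},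
      {in `]r0, r1[, forall r : R,
        [/\ is_derive r (1 : R) u
              (2 * c r ^+ 2 * u r / (r * (u r ^+ 2 - c r ^+ 2))),
            is_derive r (1 : R) rho
              (- (2 * rho r * u r ^+ 2 / (r * (u r ^+ 2 - c r ^+ 2)))) &
            is_derive r (1 : R) p
              (- (2 * rho r * c r ^+ 2 * u r ^+ 2
                  / (r * (u r ^+ 2 - c r ^+ 2))))]} &
      [/\ p r0 = p0, rho r0 = rho0, 0 < u r0 &
          u r0 = Num.sqrt (2 * (E1 - gamma * p0 / ((gamma - 1) * rho0)))]].

Definition special_solution gamma (k0 cnu r0 r1 p0 E1 s1 : R) U : Prop :=
  exists u rho p : R -> R,
    subsonic_profile gamma k0 cnu r0 r1 p0 E1 s1 u rho p /\
    {in closed_shell r0 r1, forall x,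
      [/\ velocity U x = (u (enorm x) / enorm x) *: x,
          density U x = rho (enorm x),
          pressure U x = p (enorm x) &
          gas_state gamma k0 cnu U x]}.

Definition flow_eq_on (A : set 'rV[R]_3) (U V : flow R) : Prop :=
  {in A, forall x, [/\ velocity U x = velocity V x,
                       pressure U x = pressure V x,
                       density U x = density V x &
                       entropy U x = entropy V x]}.

End Gas.

(* Main.v *)
From HB Require Import structures.
Require Import Defs.
From mathcomp Require Import ring lra.

(** Let V be an admissible solution.

    Its velocity points outwards, so a continuous function that is constant along
    the velocity and constant on the outer sphere is constant ([transport]).  This
    applies first to the energy and to the entropy.  With both constant, Crocco's
    theorem says that the vorticity is parallel to the velocity; dividing it by
    the mass flux gives a scalar that is again constant along the flow, since
    vorticity and mass flux are both divergence free ([mu_transport]).  On the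
    outer sphere the velocity is normal, which makes the normal vorticity vanish
    ([normal_vorticity0]), and so V is irrotational ([irrotational]).

    The velocity is then the gradient of a potential that vanishes on the outer
    sphere, namely the work along radial segments ([potential_gradient]).  The
    potential satisfies the quasilinear sonic equation, with prescribed speed on
    the inner sphere.  V is not assumed to be subsonic, so this equation has no
    type in advance.  It is compared with radial barriers: at an interior extremum
    of the difference the two gradients coincide, so V is subsonic at that very
    point and the equation is elliptic there ([no_interior_max]).  Strict barriers
    come from the subsonic profile by a small dilation of the radius, which also
    moves the inlet speed to the right side of the prescribed one
    ([barrier_comparison]).  Letting the dilation tend to the identity shows that
    the potential is radial ([potential_unique]), and then so are the velocity, and
    through energy and entropy the pressure and the density.

    The profile itself is the inverse function of the explicit relation given by
    conservation of mass on the subsonic branch ([profile_exists]); the condition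
    on the inlet pressure says that the inlet state lies on this branch
    ([inlet_subsonic]).  Any profile solving the differential equations is this
    one, by its first integrals ([special_radial]), and conversely its flow
    satisfies all equations and regularity conditions ([radial_admissible]). *)

Set Implicit Arguments.
Unset Strict Implicit.
Unset Printing Implicit Defensive.

Import Order.TTheory GRing.Theory Num.Theory.
Import numFieldNormedType.Exports.

Local Open Scope classical_set_scope.
Local Open Scope ring_scope.

(** * Rules of continuity in pointwise form *)

Section PointwiseContinuity.
Context {R : realType} {T : topologicalType}.
Implicit Types (f g : T -> R) (x : T).

Lemma ctC (c : R) x : {for x, continuous (fun=> c : R)}.
Proof. exact: cst_continuous. Qed.

Lemma ctD f g x : {for x, continuous f} -> {for x, continuous g} ->
  {for x, continuous (fun y => f y + g y)}.
Proof. by move=> cf cg; apply: continuousD. Qed.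

Lemma ctB f g x : {for x, continuous f} -> {for x, continuous g} ->
  {for x, continuous (fun y => f y - g y)}.
Proof. by move=> cf cg; apply: continuousB. Qed.

Lemma ctN f x : {for x, continuous f} -> {for x, continuous (fun y => - f y)}.
Proof. by move=> cf; apply: continuousN. Qed.

Lemma ctM f g x : {for x, continuous f} -> {for x, continuous g} ->
  {for x, continuous (fun y => f y * g y)}.
Proof. by move=> cf cg; apply: continuousM. Qed.

Lemma ctX f x : {for x, continuous f} -> {for x, continuous (fun y => f y ^+ 2)}.
Proof. by move=> cf; apply: ctM. Qed.

Lemma ctV f x : f x != 0 -> {for x, continuous f} ->
  {for x, continuous (fun y => (f y)^-1)}.
Proof. by move=> fx cf; apply: continuousV. Qed.

Lemma ctF f g x : g x != 0 -> {for x, continuous f} -> {for x, continuous g} ->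
  {for x, continuous (fun y => f y / g y)}.
Proof. by move=> gx cf cg; apply: ctM cf (ctV gx cg). Qed.

Lemma ct_comp (S U : topologicalType) (f : T -> S) (h : S -> U) x :
  {for f x, continuous h} -> {for x, continuous f} -> {for x, continuous (h \o f)}.
Proof. by move=> ch cf; apply: continuous_comp. Qed.

Implicit Types A : set T.

Lemma wcC A (c : R) : {within A, continuous (fun=> c : R)}.
Proof. by move=> x; exact: cst_continuous. Qed.

Lemma wcD A f g : {within A, continuous f} -> {within A, continuous g} ->
  {within A, continuous (fun y => f y + g y)}.
Proof. by move=> cf cg x; apply: continuousD; [exact: cf|exact: cg]. Qed.

Lemma wcB A f g : {within A, continuous f} -> {within A, continuous g} ->
  {within A, continuous (fun y => f y - g y)}.
Proof. by move=> cf cg x; apply: continuousB; [exact: cf|exact: cg]. Qed.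

Lemma wcN A f : {within A, continuous f} -> {within A, continuous (fun y => - f y)}.
Proof. by move=> cf x; apply: continuousN; exact: cf. Qed.

Lemma wcM A f g : {within A, continuous f} -> {within A, continuous g} ->
  {within A, continuous (fun y => f y * g y)}.
Proof. by move=> cf cg x; apply: continuousM; [exact: cf|exact: cg]. Qed.

Lemma wcV A f : (forall x, A x -> f x != 0) -> {within A, continuous f} ->
  {within A, continuous (fun y => (f y)^-1)}.
Proof.
move=> f0 /subspace_continuousP cf; apply/subspace_continuousP => x Ax.
by apply: cvgV; [exact: f0|exact: cf].
Qed.

Lemma wcF A f g : (forall x, A x -> g x != 0) ->
  {within A, continuous f} -> {within A, continuous g} ->
  {within A, continuous (fun y => f y / g y)}.
Proof. by move=> g0 cf cg; apply: wcM cf (wcV g0 cg). Qed.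

Lemma wc_comp (U W : topologicalType) A (B : set U) (f : T -> U) (h : U -> W) :
  {within B, continuous h} -> {within A, continuous f} -> (forall x, A x -> B (f x)) ->
  {within A, continuous (h \o f)}.
Proof.
move=> /subspace_continuousP ch /subspace_continuousP cf AB.
apply/subspace_continuousP => x Ax.
apply: cvg_comp (ch _ (AB _ Ax)) => P /(cf x Ax).
rewrite /within /= !nbhs_simpl /= => /= H.
by near do [move=> Ay; apply: (near H) => //; exact: AB].
Unshelve. all: by end_near. Qed.

Lemma eq_within A f g : {within A, continuous f} -> (forall x, A x -> f x = g x) ->
  {within A, continuous g}.
Proof.
move=> cf fg; apply: subspace_eq_continuous cf => x /set_mem Ax; exact: fg.
Qed.

End PointwiseContinuity.

(** * Rules of differentiation in pointwise form *)

Section PointwiseRules.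
Context {R : realType} {V : normedModType R}.
Implicit Types (f g : V -> R) (x d : V).

Lemma is_derive_line f x d (t l : R) :
  is_derive (x + t *: d) d f l -> is_derive t (1 : R) (fun s => f (x + s *: d)) l.
Proof.
move=> [df <-].
have E : (fun h : R => h^-1 *: (((fun s => f (x + s *: d)) \o shift t) (h *: (1 : R))
                          - f (x + t *: d))) =
         (fun h : R => h^-1 *: ((f \o shift (x + t *: d)) (h *: d) - f (x + t *: d))).
  apply/funext => h /=; congr (_ *: (f _ - _)).
  by rewrite [h *: 1]mulr1 scalerDl addrCA addrA.
by split; rewrite ?/derivable ?/derive /= E.
Qed.

Lemma derD f g x d (df dg : R) : is_derive x d f df -> is_derive x d g dg ->
  is_derive x d (fun y => f y + g y) (df + dg).
Proof. exact: is_deriveD. Qed.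

Lemma derN f x d (df : R) : is_derive x d f df -> is_derive x d (fun y => - f y) (- df).
Proof. exact: is_deriveN. Qed.

Lemma derB f g x d (df dg : R) : is_derive x d f df -> is_derive x d g dg ->
  is_derive x d (fun y => f y - g y) (df - dg).
Proof. exact: is_deriveB. Qed.

Lemma derM f g x d (df dg : R) : is_derive x d f df -> is_derive x d g dg ->
  is_derive x d (fun y => f y * g y) (df * g x + f x * dg).
Proof.
move=> Df Dg; have := is_deriveM Df Dg.
by rewrite /GRing.scale /= addrC [g x * _]mulrC.
Qed.

Lemma derC (c : R) x d : is_derive x d (fun=> c) 0.
Proof. exact: is_derive_cst. Qed.

Lemma derV f x d (df : R) : f x != 0 -> is_derive x d f df ->
  is_derive x d (fun y => (f y)^-1) (- df / f x ^+ 2).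
Proof.
move=> fx [Df <-]; apply: DeriveDef; first exact: derivableV.
by rewrite deriveV // /GRing.scale /= mulrC mulrN mulNr.
Qed.

Lemma derF f g x d (df dg : R) : g x != 0 ->
  is_derive x d f df -> is_derive x d g dg ->
  is_derive x d (fun y => f y / g y) ((df * g x - f x * dg) / g x ^+ 2).
Proof.
move=> gx Df Dg; apply: is_derive_eq; first exact: derM Df (derV gx Dg).
by move=> /=; field.
Qed.

Lemma derX f x d (df : R) : is_derive x d f df ->
  is_derive x d (fun y => f y ^+ 2) (2 * f x * df).
Proof.
move=> Df; rewrite (_ : (fun y => f y ^+ 2) = fun y => f y * f y); last first.
  by apply/funext => y; rewrite expr2.
by apply: (is_derive_eq (derM Df Df)); ring.
Qed.

Lemma is_derive_of_line f x d (l : R) :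
  is_derive (0 : R) (1 : R) (fun s => f (x + s *: d)) l -> is_derive x d f l.
Proof.
move=> [D0 D0v].
have E : (fun t : R => t^-1 *: (((fun s => f (x + s *: d)) \o shift 0) (t *: (1 : R))
                          - f (x + 0 *: d))) =
         (fun t : R => t^-1 *: ((f \o shift x) (t *: d) - f x)).
  apply/funext => t /=; rewrite scale0r !addr0 [t *: 1]mulr1.
  by rewrite [t *: d + x]addrC.
by split; move: D0 D0v; rewrite /derivable /derive /= E.
Qed.

Lemma der_comp (h : R -> R) f x d (df dh : R) :
  is_derive (f x) (1 : R) h dh -> is_derive x d f df ->
  is_derive x d (fun y => h (f y)) (dh * df).
Proof.
move=> Dh Df; apply: is_derive_of_line.
have Df0 : is_derive (0 : R) (1 : R) (fun s => f (x + s *: d)) df.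
  by apply: is_derive_line; rewrite scale0r addr0.
have Dh0 : is_derive ((fun s : R => f (x + s *: d)) 0) (1 : R) h dh.
  by rewrite /= scale0r addr0.
exact: (@is_derive1_comp R h (fun s : R => f (x + s *: d)) 0 _ _ Dh0 Df0).
Qed.

End PointwiseRules.

(** * Total differentiability of C^1 functions *)

Section Lines.
Context {R : realType} {V : normedModType R}.
Implicit Types (f : V -> R) (x d : V).

Lemma line_MVT f x d (a : R) :
  (forall s : R, 0 <= s <= 1 -> derivable f (x + (s * a) *: d) d) ->
  exists2 s : R, 0 <= s <= 1 & f (x + a *: d) - f x = a * 'D_d f (x + (s * a) *: d).
Proof.
move=> df.
pose g s := f (x + (s * a) *: d).
have dg (s : R) : 0 <= s <= 1 -> is_derive s (1 : R) g (a * 'D_d f (x + (s * a) *: d)).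
  move=> /df /derivableP /is_derive_line dfs.
  have := @is_derive1_comp R (fun s : R => f (x + s *: d)) (fun s : R => s * a) s _ a dfs.
  rewrite mulrC; apply; apply: (is_derive_eq (derM (is_derive_id _ _) (derC a _ _))).
  by rewrite mul1r mulr0 addr0.
have dg1 (s : R) : s \in `]0, 1[%R -> is_derive s (1 : R) g (a * 'D_d f (x + (s * a) *: d)).
  by rewrite in_itv /= => /andP[/ltW s0 /ltW s1]; apply: dg; rewrite s0 s1.
have cg : {within `[0, 1], continuous g}.
  apply: derivable_within_continuous => s; rewrite in_itv /= => /dg ds.
  exact: ex_derive.
have [s] := MVT_segment ler01 dg1 cg.
rewrite in_itv /= => s01; rewrite /g mul1r mul0r scale0r addr0 subr0 mulr1 => ->.
by exists s.
Qed.

End Lines.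

Section Coordinates.
Context {R : realType}.
Implicit Types (x d h : 'rV[R]_3) (A : set 'rV[R]_3) (f g : 'rV[R]_3 -> R).

Lemma sum3 (V : nmodType) (F : 'I_3 -> V) :
  \sum_(i < 3) F i = F 0 + F 1 + F 2.
Proof.
rewrite !big_ord_recl big_ord0 addr0 addrA.
by congr (F _ + F _ + F _); apply/val_inj.
Qed.

Lemma dotE x d : dot x d = x 0 0 * d 0 0 + x 0 1 * d 0 1 + x 0 2 * d 0 2.
Proof. exact: sum3. Qed.

Lemma ord3P (P : 'I_3 -> Prop) : P 0 -> P 1 -> P 2 -> forall i, P i.
Proof.
move=> P0 P1 P2 [[|[|[|//]]] i3].
- by rewrite (_ : Ordinal i3 = 0) //; apply/val_inj.
- by rewrite (_ : Ordinal i3 = 1) //; apply/val_inj.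
- by rewrite (_ : Ordinal i3 = 2) //; apply/val_inj.
Qed.

Lemma rowP3 x d : x 0 0 = d 0 0 -> x 0 1 = d 0 1 -> x 0 2 = d 0 2 -> x = d.
Proof. by move=> e0 e1 e2; apply/rowP; apply: ord3P. Qed.

Lemma coord_le_norm x i : `|x 0 i| <= `|x|.
Proof.
rewrite [leRHS]/Num.Def.normr/= mx_normrE.
exact: (le_bigmax _ (fun ij : 'I_1 * 'I_3 => `|x ij.1 ij.2|) (0, i)).
Qed.

Lemma norm_le_coord x (e : R) : 0 <= e -> (forall i, `|x 0 i| <= e) -> `|x| <= e.
Proof.
move=> e0 xe; rewrite [leLHS]/Num.Def.normr/= mx_normrE.
by apply: bigmax_le => // -[i j] _ /=; rewrite ord1.
Qed.

Definition grad f x : 'rV[R]_3 := \row_i partial i f x.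

Lemma basisE i j : basis R i 0 j = (j == i)%:R.
Proof. by rewrite /basis mxE eqxx. Qed.

Definition dotr c x : R := dot x c.

Fact dot_is_linear c : linear (dotr c : 'rV[R]_3 -> R).
Proof.
move=> a u v; rewrite /dotr !dotE !mxE /GRing.scale /=; ring.
Qed.
HB.instance Definition _ c :=
  GRing.isLinear.Build R 'rV[R]_3 R _ (dotr c) (dot_is_linear c).

Lemma continuous_dotl c : continuous (dotr c : 'rV[R]_3 -> R).
Proof.
move=> x.
suff H : {for x, continuous (fun x => x 0 0 * c 0 0 + x 0 1 * c 0 1 + x 0 2 * c 0 2)}.
  rewrite (_ : dotr c = fun x => x 0 0 * c 0 0 + x 0 1 * c 0 1 + x 0 2 * c 0 2) //.
  by apply/funext => v; rewrite /dotr dotE.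
by apply: ctD; [apply: ctD|]; apply: ctM; (exact: coord_continuous || exact: ctC).
Qed.

(** Go from x to x + h along the three coordinate directions and apply the mean
    value theorem to each leg. *)
Lemma partials_is_diff A f x : open A ->
  (forall i, (forall y, A y -> derivable f y (basis R i)) /\
             {within A, continuous (partial i f)}) -> A x ->
  is_diff x f (dotr (grad f x)).
Proof.
have tri (F0 F1 F2 F3 d0 d1 d2 c : R) : `|F1 - F0 - d0| <= c ->
    `|F2 - F1 - d1| <= c -> `|F3 - F2 - d2| <= c ->
    `|F3 - (F0 + (d0 + d1 + d2))| <= c + c + c.
  by rewrite !ler_norml; lra.
move=> oA pf Ax.
suff E : (f : 'rV[R]_3 -> R^o) \o shift x = cst (f x) + (dotr (grad f x) : 'rV[R]_3 -> R^o) +o_ (0 : 'rV[R]_3) id.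
  have dE := diff_unique (@continuous_dotl (grad f x)) E.
  apply: DiffDef => //; apply/diff_locallyP; rewrite dE; split => //.
  exact: continuous_dotl.
apply/eqaddoP => _/posnumP[e].
have e3 : 0 < e%:num / 3 by [].
have near_part : \forall y \near x, A y /\ forall i, `|partial i f x - partial i f y| <= e%:num / 3.
  have pi i : \forall y \near x, `|partial i f x - partial i f y| <= e%:num / 3.
    have [_] := pf i; rewrite continuous_open_subspace// => /(_ x (mem_set Ax)).
    by move/cvgrPdist_le => /(_ _ e3).
  have Ay : \forall y \near x, A y by exact: open_nbhs_nbhs.
  apply: filterS (filterI (filterI Ay (pi 0)) (filterI (pi 1) (pi 2))).
  by move=> y [[Ay' y0] [y1 y2]]; split; [exact: Ay'|apply: ord3P; [exact: y0|exact: y1|exact: y2]].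
have /nbhs_ballP[r /= r0 rP] := near_part.
near=> h.
have hr : `|h| < r.
  near: h; apply/nbhs_ballP; exists r => //= h; rewrite -ball_normE /= sub0r normrN //.
have inball (y : 'rV[R]_3) : (forall i, `|y 0 i| <= `|h 0 i|) -> A (x + y) /\
    forall i, `|partial i f x - partial i f (x + y)| <= e%:num / 3.
  move=> yh; apply: rP; rewrite -ball_normE /= opprD addNKr normrN.
  apply: le_lt_trans hr; apply: norm_le_coord => // i.
  by apply: le_trans (yh i) (coord_le_norm _ _).
pose p0 : 'rV[R]_3 := h 0 0 *: basis R 0.
pose p1 := p0 + h 0 1 *: basis R 1.
have leg (p : 'rV[R]_3) i : (forall s : R, 0 <= s <= 1 ->
      forall j, `|(p + (s * h 0 i) *: basis R i) 0 j| <= `|h 0 j|) ->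
    `|f (x + p + h 0 i *: basis R i) - f (x + p) - h 0 i * partial i f x| <=
      e%:num / 3 * `|h|.
  move=> ph.
  have [|s s01 ->] := @line_MVT R _ f (x + p) (basis R i) (h 0 i).
    move=> s /ph /inball[Ay _]; rewrite -addrA; exact: (pf i).1.
  rewrite -mulrBr normrM mulrC ler_pM //; last exact: coord_le_norm.
  by rewrite distrC -addrA; have [_] := inball _ (ph _ s01); exact.
have le_sc (s : R) (i : 'I_3) : 0 <= s <= 1 -> `|s * h 0 i| <= `|h 0 i|.
  move=> /andP[s0 s1]; rewrite normrM (ger0_norm s0).
  by rewrite -[leRHS]mul1r ler_wpM2r.
have l0 := leg 0 0; have l1 := leg p0 1; have l2 := leg p1 2.
rewrite !fctE /= [h + x]addrC.
have -> : x + h = x + p1 + h 0 2 *: basis R 2.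
  by apply: rowP3; rewrite !mxE !eqxx /=; ring.
have Ed : dotr (grad f x) h = h 0 0 * partial 0 f x + h 0 1 * partial 1 f x + h 0 2 * partial 2 f x.
  by rewrite /dotr dotE !mxE.
rewrite Ed.
have {}l0 : `|f (x + p0) - f x - h 0 0 * partial 0 f x| <= e%:num / 3 * `|h|.
  rewrite addr0 in l0; apply: l0 => s s01; apply: ord3P;
  by rewrite !mxE !eqxx /= ?mulr0 ?addr0 ?add0r ?normr0 // mulr1; exact: le_sc.
have {}l1 : `|f (x + p1) - f (x + p0) - h 0 1 * partial 1 f x| <= e%:num / 3 * `|h|.
  rewrite /p1 addrA; apply: l1 => s s01; apply: ord3P;
  by rewrite !mxE !eqxx /= ?mulr0 ?addr0 ?add0r ?normr0 // mulr1 //; exact: le_sc.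
have {}l2 : `|f (x + p1 + h 0 2 *: basis R 2) - f (x + p1) - h 0 2 * partial 2 f x| <= e%:num / 3 * `|h|.
  apply: l2 => s s01; apply: ord3P;
  by rewrite !mxE !eqxx /= ?mulr0 ?addr0 ?add0r ?normr0 // mulr1 //; exact: le_sc.
rewrite (_ : e%:num * `|h| = e%:num / 3 * `|h| + e%:num / 3 * `|h| + e%:num / 3 * `|h|);
  last by field.
exact: tri l0 l1 l2.
Unshelve. all: by end_near. Qed.

Lemma C1_is_diff A f x : open A -> C1_on A f -> A x ->
  is_diff x f (dotr (grad f x)).
Proof. by move=> oA [_ pf]; exact: partials_is_diff. Qed.

Lemma C1_is_derive A f x d : open A -> C1_on A f -> A x ->
  is_derive x d f (dot d (grad f x)).
Proof.
move=> oA Cf Ax; have D := C1_is_diff oA Cf Ax.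
apply: DeriveDef; first exact/diff_derivable/ex_diff.
by rewrite deriveE ?diff_val//; exact: ex_diff.
Qed.

End Coordinates.

Section EpsilonDelta.
Context {R : realType}.
Implicit Types (x d : 'rV[R]_3) (A : set 'rV[R]_3) (f g : 'rV[R]_3 -> R).

Lemma within_cont_ball A f x (e : R) : {within A, continuous f} -> A x -> 0 < e ->
  exists2 r : R, 0 < r & forall y, A y -> `|y - x| < r -> `|f y - f x| < e.
Proof.
move=> /subspace_continuousP /(_ x) cf Ax e0.
have /cvgrPdist_lt /(_ _ e0) := cf Ax.
rewrite near_withinE => /nbhs_ballP[r /= r0 rP]; exists r => // y Ay yr.
by rewrite distrC; apply: rP => //; rewrite -ball_normE /= distrC.
Qed.

Lemma open_ball A x : open A -> A x ->
  exists2 r : R, 0 < r & forall y, `|y - x| < r -> A y.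
Proof.
move=> oA Ax; have /nbhs_ballP[r /= r0 rP] := open_nbhs_nbhs (conj oA Ax).
by exists r => // y yr; apply: rP; rewrite -ball_normE /= distrC.
Qed.

Lemma line_in_open A x d : open A -> A x ->
  exists2 e : R, 0 < e & forall t : R, `|t| < e -> A (x + t *: d).
Proof.
move=> oA /(open_ball oA)[r r0 rP]; exists (r / (`|d| + 1)).
  by rewrite divr_gt0 // ltr_pwDr.
move=> t tr; apply: rP; rewrite addrC addKr normrZ.
have d1 : 0 < `|d| + 1 by rewrite ltr_pwDr.
rewrite (@le_lt_trans _ _ (`|t| * (`|d| + 1))) //.
  by rewrite ler_wpM2l // lerDl.
by rewrite -ltr_pdivlMr.
Qed.

Lemma C1_partial A f x i : C1_on A f -> A x ->
  is_derive x (basis R i) f (partial i f x).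
Proof. by move=> [_ /(_ i)[df _]] Ax; apply: DeriveDef => //; exact: df. Qed.

Lemma is_derive_partial f x i (l : R) : is_derive x (basis R i) f l -> partial i f x = l.
Proof. by move=> D; rewrite /partial derive_val. Qed.

Lemma is_derive_translate f x v d (l : R) : is_derive (x + v) d f l ->
  is_derive x d (fun y => f (y + v)) l.
Proof.
move=> [df <-].
have E : (fun h : R => h^-1 *: (((fun y => f (y + v)) \o shift x) (h *: d) - f (x + v))) =
         (fun h : R => h^-1 *: ((f \o shift (x + v)) (h *: d) - f (x + v))).
  by apply/funext => h /=; congr (_ *: (f _ - _)); rewrite addrA.
by split; rewrite ?/derivable ?/derive /= E.
Qed.

End EpsilonDelta.

(** * Symmetry of second derivatives *)

Section Schwarz.
Context {R : realType}.
Implicit Types (x d h : 'rV[R]_3) (A : set 'rV[R]_3) (f g : 'rV[R]_3 -> R).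

Lemma norm_basis (i : 'I_3) : `|basis R i| <= 1.
Proof.
apply: norm_le_coord => // j; rewrite basisE.
by case: (j == i); rewrite ?normr1 ?normr0.
Qed.

(** Mean value theorem in direction [i], then in direction [j].  The left-hand
    side is symmetric in [i] and [j], which is what makes [partialC] work. *)
Lemma second_difference A f x (i j : 'I_3) (h : R) : C2_on A f -> 0 < h ->
  (forall y, `|y - x| <= h + h -> A y) ->
  exists2 y, `|y - x| <= h + h &
    f (x + h *: basis R i + h *: basis R j) - f (x + h *: basis R i)
    - (f (x + h *: basis R j) - f x) = h * (h * partial j (partial i f) y).
Proof.
move=> [Cf Cpf] h0 hA.
have short (s : R) k : 0 <= s <= 1 -> `|(s * h) *: basis R k| <= h.
  move=> /andP[s0 s1]; have hge := ltW h0.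
  rewrite normrZ (ger0_norm (mulr_ge0 s0 hge)).
  apply: (@le_trans _ _ (h * 1)); last by rewrite mulr1.
  apply: ler_pM; [by rewrite mulr_ge0 // ltW|exact: normr_ge0| |exact: norm_basis].
  by rewrite ler_piMl // ltW.
have short1 k : `|h *: basis R k| <= h.
  by rewrite -[X in X *: _]mul1r; apply: short; rewrite ler01 lexx.
have sub2 (u v w : 'rV[R]_3) : u + v + w - u = v + w.
  by rewrite -[u + v + w]addrA [LHS]addrC addKr.
have Dg (s : R) : 0 <= s <= 1 ->
    is_derive (x + (s * h) *: basis R i) (basis R i)
      (fun y => f (y + h *: basis R j) - f y)
      (partial i f (x + (s * h) *: basis R i + h *: basis R j)
       - partial i f (x + (s * h) *: basis R i)).
  move=> s01; apply: derB; first apply: is_derive_translate.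
  - apply: C1_partial Cf _; apply: hA.
    by rewrite sub2; apply: le_trans (ler_normD _ _) _; apply: lerD; [exact: short|exact: short1].
  - apply: C1_partial Cf _; apply: hA; rewrite addrC addKr.
    by rewrite (le_trans (short _ _ s01)) // lerDl ltW.
have [|s s01] := @line_MVT R _ (fun y => f (y + h *: basis R j) - f y) x (basis R i) h.
  by move=> s /Dg D; exact: ex_derive.
rewrite (@derive_val _ _ _ _ _ _ _ (Dg _ s01)) => ->.
have [|t t01] := @line_MVT R _ (partial i f) (x + (s * h) *: basis R i) (basis R j) h.
  move=> t t01; have [df _] := (Cpf i).2 j; apply: df; apply: hA.
  by rewrite sub2; apply: le_trans (ler_normD _ _) _; apply: lerD; exact: short.
move=> ->.
exists (x + (s * h) *: basis R i + (t * h) *: basis R j) => //.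
by rewrite sub2; apply: le_trans (ler_normD _ _) _; apply: lerD; exact: short.
Qed.

Lemma same_quotient (p q r s k u v : R) : 0 < k ->
  p - q - (r - s) = k * (k * u) -> p - r - (q - s) = k * (k * v) -> u = v.
Proof.
move=> k0 E1 E2; have : k * (k * u) = k * (k * v) by rewrite -E1 -E2; ring.
by move=> /(mulfI (lt0r_neq0 k0)) /(mulfI (lt0r_neq0 k0)).
Qed.

Lemma not_half_close (p q c : R) : p - q != 0 ->
  `|c - p| < `|p - q| / 2 -> `|c - q| < `|p - q| / 2 -> False.
Proof.
rewrite -normr_gt0 => pq H1 H2; have : `|p - q| < `|p - q|.
  rewrite [ltRHS]splitr; apply: le_lt_trans (ltrD H1 H2); rewrite [`|c - p|]distrC.
  by rewrite (_ : p - q = (p - c) + (c - q)) ?ler_normD //; ring.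
by rewrite ltxx.
Qed.

(** If the mixed derivatives differed at [x], one small second difference would
    be close to both of them. *)
Lemma partialC A f x (i j : 'I_3) : open A -> C2_on A f -> A x ->
  partial i (partial j f) x = partial j (partial i f) x.
Proof.
move=> oA Cf Ax; apply/eqP; rewrite -subr_eq0; apply/negPn/negP => ne0.
set a := partial i (partial j f) x in ne0 *; set b := partial j (partial i f) x in ne0 *.
have e0 : 0 < `|a - b| / 2 by rewrite divr_gt0 // normr_gt0.
have C k l : {within A, continuous (partial l (partial k f))} by exact: ((Cf.2 k).2 l).2.
have [r1 r10 r1P] := within_cont_ball (C j i) Ax e0.
have [r2 r20 r2P] := within_cont_ball (C i j) Ax e0.
have [r3 r30 r3P] := open_ball oA Ax.
pose h := Num.min r1 (Num.min r2 r3) / 4.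
have h0 : 0 < h by rewrite divr_gt0 // !lt_min r10 r20.
have hr : h + h < Num.min r1 (Num.min r2 r3) by rewrite /h; move: h0; rewrite /h; lra.
move: hr; rewrite !lt_min => /and3P[hr1 hr2 hr3].
have hA y : `|y - x| <= h + h -> A y by move=> yh; apply: r3P; apply: le_lt_trans yh hr3.
have [y yx Ey] := @second_difference A f x i j h Cf h0 hA.
have [z zx Ez] := @second_difference A f x j i h Cf h0 hA.
have yz : partial j (partial i f) y = partial i (partial j f) z.
  have Ez' := @eq_ind _ _ (fun p => f p - f (x + h *: basis R j)
    - (f (x + h *: basis R i) - f x) = h * (h * partial i (partial j f) z)) Ez _
    (addrAC x (h *: basis R j) (h *: basis R i)).
  exact: same_quotient h0 Ey Ez'.
have H1 := r1P z (hA _ zx) (le_lt_trans zx hr1).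
have H2 := r2P y (hA _ yx) (le_lt_trans yx hr2).
rewrite yz in H2; exact: not_half_close ne0 H1 H2.
Qed.

End Schwarz.

(** * Derivative tests at a maximum *)

Section DerivativeTests.
Context {R : realType}.
Implicit Types (x d h : 'rV[R]_3) (A : set 'rV[R]_3) (f g : 'rV[R]_3 -> R).

Lemma is_derive_at0 f x d (l : R) : is_derive x d f l ->
  is_derive (0 : R) (1 : R) (fun t => f (x + t *: d)) l.
Proof. by move=> D; apply: is_derive_line; rewrite scale0r addr0. Qed.

Lemma derive_gt0_right (k : R -> R) (l : R) : is_derive (0 : R) (1 : R) k l -> 0 < l ->
  exists2 e : R, 0 < e & forall t, 0 < t < e -> k 0 < k t.
Proof.
move=> [dk <-] l0; have := dk => /derivable1_diffP _.
have /cvgrPdist_lt /(_ _ l0) : (fun h : R => h^-1 *: ((k \o shift 0) (h *: (1 : R)) - k 0))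
   @ 0^' --> 'D_1 k 0 by exact: dk.
rewrite near_withinE => /nbhs_ballP[e /= e0 eP]; exists e => // t /andP[t0 te].
have {eP} := eP t; rewrite -ball_normE /= sub0r normrN gtr0_norm // => /(_ te (lt0r_neq0 t0)).
rewrite addr0 [t *: 1]mulr1 => /(le_lt_trans (ler_norm _)).
rewrite ltrBlDr -[X in X < _]addr0 ltrD2l.
by rewrite /GRing.scale /= pmulr_rgt0 ?invr_gt0 // subr_gt0.
Qed.

(** Only one-sided, so that it can be used at a boundary point of a shell, in the
    directions that enter the shell. *)
Lemma derive_le0_at_max f x d (l e : R) : is_derive x d f l -> 0 < e ->
  (forall t : R, 0 < t < e -> f (x + t *: d) <= f x) -> l <= 0.
Proof.
move=> /is_derive_at0 D e0 fmax; rewrite leNgt; apply/negP => l0.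
have [r r0 rP] := derive_gt0_right D l0.
pose t := Num.min e r / 2.
have m0 : 0 < Num.min e r by rewrite lt_min e0 r0.
have t0 : 0 < t by rewrite divr_gt0.
have /andP[te tr] : (t < e) && (t < r).
  by rewrite -lt_min /t ltr_pdivrMr // ltr_pMr // ltr1n.
have := rP t; rewrite t0 tr => /(_ isT); rewrite scale0r addr0.
by rewrite ltNge fmax // t0 te.
Qed.

(** Here [g] is the derivative of [f] along the line: if its own derivative [l]
    were positive, [g] would be positive and [f] increasing just after [x]. *)
Lemma derive2_le0_at_max f g x d (l e : R) : 0 < e ->
  (forall t : R, 0 <= t < e -> is_derive (x + t *: d) d f (g (x + t *: d))) ->
  is_derive x d g l -> g x = 0 ->
  (forall t : R, 0 < t < e -> f (x + t *: d) <= f x) -> l <= 0.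
Proof.
move=> e0 Df /is_derive_at0 Dg gx fmax; rewrite leNgt; apply/negP => l0.
have [r r0 rP] := derive_gt0_right Dg l0.
pose t := Num.min e r / 2.
have m0 : 0 < Num.min e r by rewrite lt_min e0 r0.
have t0 : 0 < t by rewrite divr_gt0.
have /andP[te tr] : (t < e) && (t < r).
  by rewrite -lt_min /t ltr_pdivrMr // ltr_pMr // ltr1n.
have Dk (s : R) : 0 <= s < e -> is_derive s (1 : R) (fun t => f (x + t *: d)) (g (x + s *: d)).
  by move=> /Df; exact: is_derive_line.
have cf : {within `[0, t], continuous (fun t => f (x + t *: d))}.
  apply: derivable_within_continuous => s; rewrite in_itv /= => /andP[s0 st].
  have /Dk D : 0 <= s < e by rewrite s0 (le_lt_trans st).
  exact: ex_derive.
have Dk' (s : R) : s \in `]0, t[%R -> is_derive s (1 : R) (fun t => f (x + t *: d)) (g (x + s *: d)).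
  by rewrite in_itv /= => /andP[s0 st]; apply: Dk; rewrite (ltW s0) (lt_trans st).
have [s] := MVT t0 Dk' cf; rewrite in_itv /= => /andP[s0 st]; rewrite subr0 scale0r addr0 => E.
have := rP s; rewrite s0 (lt_trans st tr) scale0r addr0 gx => /(_ isT) gs.
have := fmax t; rewrite t0 te => /(_ isT); rewrite -subr_le0 E leNgt => /negP; apply.
by rewrite mulr_gt0.
Qed.

End DerivativeTests.

(** * Spherical shells *)

Section Shells.
Context {R : realType}.
Implicit Types (x d h : 'rV[R]_3) (A : set 'rV[R]_3) (f g : 'rV[R]_3 -> R) (a b r : R).

Lemma dotC x d : dot x d = dot d x.
Proof. by rewrite !dotE; ring. Qed.

Lemma dotZl (t : R) x d : dot (t *: x) d = t * dot x d.
Proof. by rewrite !dotE !mxE; ring. Qed.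

Lemma dotBl x d h : dot (x - d) h = dot x h - dot d h.
Proof. by rewrite !dotE !mxE; ring. Qed.

Lemma dot_basis i x : dot (basis R i) x = x 0 i.
Proof. by rewrite dotE !basisE; move: i; apply: ord3P; rewrite /= ?eqxx /=; ring. Qed.

Lemma dot_ge0 x : 0 <= dot x x.
Proof. by rewrite dotE !addr_ge0 // -expr2 sqr_ge0. Qed.

Lemma enorm_sqr x : enorm x ^+ 2 = dot x x.
Proof. by rewrite sqr_sqrtr // dot_ge0. Qed.

Lemma enorm_ge0 x : 0 <= enorm x.
Proof. exact: sqrtr_ge0. Qed.

Lemma enormZ (t : R) x : enorm (t *: x) = `|t| * enorm x.
Proof.
rewrite /enorm dotZl dotC dotZl mulrA -expr2 sqrtrM ?sqr_ge0 //.
by rewrite sqrtr_sqr.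
Qed.

Lemma dot_eq0 x : dot x x = 0 -> x = 0.
Proof.
rewrite dotE -!expr2 => /eqP; rewrite !paddr_eq0 ?addr_ge0 ?sqr_ge0 // !sqrf_eq0.
by move=> /andP[/andP[/eqP x0 /eqP x1] /eqP x2]; apply: rowP3; rewrite mxE.
Qed.

Lemma coord_le_enorm x i : `|x 0 i| <= enorm x.
Proof.
rewrite -(@ler_pXn2r _ 2) ?nnegrE ?enorm_ge0 // enorm_sqr -normrX ger0_norm ?sqr_ge0 //.
have h j : 0 <= x 0 j ^+ 2 by exact: sqr_ge0.
have := h 0; have := h 1; have := h 2; rewrite dotE -!expr2.
by move: i; apply: ord3P; move: (_ ^+ 2) (_ ^+ 2) (_ ^+ 2) => p q s; lra.
Qed.

Lemma norm_le_enorm x : `|x| <= enorm x.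
Proof. by apply: norm_le_coord; [exact: enorm_ge0|exact: coord_le_enorm]. Qed.

Lemma dot_continuous x : {for x, continuous (fun y : 'rV[R]_3 => dot y y)}.
Proof.
suff H : {for x, continuous (fun x : 'rV[R]_3 => x 0 0 * x 0 0 + x 0 1 * x 0 1 + x 0 2 * x 0 2)}.
  rewrite (_ : (fun y : 'rV[R]_3 => dot y y) =
    fun x => x 0 0 * x 0 0 + x 0 1 * x 0 1 + x 0 2 * x 0 2) //.
  by apply/funext => v; rewrite dotE.
by apply: ctD; [apply: ctD|]; apply: ctM; exact: coord_continuous.
Qed.

Lemma der_coord x d i : is_derive x d (fun y : 'rV[R]_3 => y 0 i) (d 0 i).
Proof.
have cE y : dotr (basis R i) y = y 0 i.
  by rewrite /dotr dotE !basisE; move: i; apply: ord3P; rewrite /= !(mulr0, mulr1, addr0, add0r).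
have E : (dotr (basis R i) : 'rV[R]_3 -> R^o) = (fun y : 'rV[R]_3 => y 0 i : R^o).
  by apply/funext => y; exact: cE.
have cl := @continuous_dotl R (basis R i).
have Df : differentiable (dotr (basis R i) : 'rV[R]_3 -> R^o) x.
  by apply: linear_differentiable; exact: cl.
rewrite -(cE d) -E; apply: DeriveDef; first exact: diff_derivable.
by rewrite deriveE // diff_lin.
Qed.

Lemma der_sqnorm x d : is_derive x d (fun y => dot y y) (2 * dot d x).
Proof.
have -> : (fun y : 'rV[R]_3 => dot y y) =
    fun x => x 0 0 * x 0 0 + x 0 1 * x 0 1 + x 0 2 * x 0 2.
  by apply/funext => v; rewrite dotE.
have D i := derM (der_coord x d i) (der_coord x d i).
by apply: (is_derive_eq (derD (derD (D 0) (D 1)) (D 2))); rewrite dotE; ring.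
Qed.

Lemma enorm_continuous : continuous (@enorm R).
Proof.
move=> x; apply: (@continuous_comp _ _ _ (fun y : 'rV[R]_3 => dot y y) Num.sqrt).
  exact: dot_continuous.
exact: sqrt_continuous.
Qed.

Lemma shell_open a b : open (shell a b : set 'rV[R]_3).
Proof.
rewrite (_ : shell a b = (@enorm R) @^-1` `]a, b[%classic).
  apply: open_comp; last exact: interval_open.
  by move=> x _; exact: enorm_continuous.
by apply/funext => x; rewrite /shell /preimage /= in_itv.
Qed.

Lemma closed_shell_closed a b : closed (closed_shell a b : set 'rV[R]_3).
Proof.
rewrite (_ : closed_shell a b = (@enorm R) @^-1` `[a, b]%classic).
  apply: closed_comp; last exact: interval_closed.
  by move=> x _; exact: enorm_continuous.
by apply/funext => x; rewrite /closed_shell /preimage /= in_itv.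
Qed.

Lemma closed_shell_compact a b : compact (closed_shell a b : set 'rV[R]_3).
Proof.
apply: bounded_closed_compact; last exact: closed_shell_closed.
exists b; split; first exact: num_real.
by move=> M bM x /andP[_ xb] /=; rewrite (le_trans (norm_le_enorm x)) // (le_trans xb) // ltW.
Qed.

Lemma shell_sub_closed a b : shell a b `<=` (closed_shell a b : set 'rV[R]_3).
Proof. by move=> x /andP[/ltW ax /ltW xb]; apply/andP. Qed.

Lemma enorm_outward x d (t : R) : 0 < dot x d -> 0 < t -> enorm x < enorm (x + t *: d).
Proof.
move=> xd t0; rewrite -(@ltr_pXn2r _ 2) ?nnegrE ?enorm_ge0 // !enorm_sqr.
have -> : dot (x + t *: d) (x + t *: d) = dot x x + (2 * (t * dot x d) + t ^+ 2 * dot d d).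
  by rewrite !dotE !mxE; ring.
have h1 : 0 < t * dot x d by rewrite mulr_gt0.
have h2 : 0 <= t ^+ 2 * dot d d by rewrite mulr_ge0 ?sqr_ge0 ?dot_ge0.
by rewrite ltrDl; apply: ltr_wpDr => //; rewrite mulr_gt0.
Qed.

Lemma small_step_lt x d b : enorm x < b ->
  exists2 e : R, 0 < e & forall t, 0 < t < e -> enorm (x + t *: d) < b.
Proof.
move=> xb.
have oA : open ((@enorm R) @^-1` `]-oo, b[%classic : set 'rV[R]_3).
  apply: open_comp; last exact: interval_open.
  by move=> y _; exact: enorm_continuous.
have Ax : ((@enorm R) @^-1` `]-oo, b[%classic : set 'rV[R]_3) x by rewrite /preimage /= in_itv.
have [e e0 eP] := line_in_open d oA Ax; exists e => // t /andP[t0 te].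
have := eP t; rewrite gtr0_norm // => /(_ te).
by rewrite /preimage /= in_itv.
Qed.

Lemma shell_dense a b x (e : R) : 0 < a -> a < b -> closed_shell a b x -> 0 < e ->
  exists2 y, shell a b y & `|y - x| < e.
Proof.
move=> a0 ab /andP[ax xb] e0; have x0 := lt_le_trans a0 ax.
(* Move [x] slightly along its ray, towards the sphere halfway. *)
pose m := (a + b) / 2; pose k := m / enorm x - 1.
pose t := Num.min 1 (e / (`|k| * `|x| + 1)) / 2.
have d0 : 0 < `|k| * `|x| + 1 by rewrite ltr_wpDl // mulr_ge0.
have m0 : 0 < Num.min 1 (e / (`|k| * `|x| + 1)) by rewrite lt_min ltr01 divr_gt0.
have t0 : 0 < t by rewrite divr_gt0.
have /andP[t1 te] : (t < 1) && (t < e / (`|k| * `|x| + 1)).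
  by rewrite -lt_min /t ltr_pdivrMr // ltr_pMr // ltr1n.
exists ((1 + t * k) *: x).
  have k1 : 0 < 1 + t * k.
    rewrite (_ : 1 + t * k = (1 - t) + t * (m / enorm x)); last by rewrite /k; ring.
    by rewrite addr_gt0 ?subr_gt0 // mulr_gt0 // divr_gt0 // divr_gt0 // addr_gt0 // (lt_trans a0).
  rewrite /shell /= enormZ gtr0_norm //.
  rewrite (_ : (1 + t * k) * enorm x = enorm x + t * (m - enorm x)); last first.
    by rewrite /k; field; rewrite gt_eqF.
  rewrite (_ : enorm x + t * (m - enorm x) = (1 - t) * enorm x + t * m); last by ring.
  have mE : m + m = a + b by rewrite /m; field.
  have h1 : (1 - t) * a <= (1 - t) * enorm x by rewrite ler_wpM2l // subr_ge0 ltW.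
  have h2 : (1 - t) * enorm x <= (1 - t) * b by rewrite ler_wpM2l // subr_ge0 ltW.
  have h3 : t * a < t * m by rewrite ltr_pM2l //; lra.
  have h4 : t * m < t * b by rewrite ltr_pM2l //; lra.
  move: h1 h2 h3 h4; set p := (1 - t) * enorm x; set q := t * m.
  by rewrite !mulrBl !mul1r; lra.
rewrite scalerDl scale1r addrC addKr normrZ normrM (gtr0_norm t0) -mulrA.
have lt_e : t * (`|k| * `|x| + 1) < e by rewrite -ltr_pdivlMr.
by apply: le_lt_trans lt_e; rewrite ler_wpM2l ?lerDl // ltW.
Qed.

Lemma eq_closed_shell a b f g : 0 < a -> a < b ->
  {within closed_shell a b, continuous f} -> {within closed_shell a b, continuous g} ->
  (forall x, shell a b x -> f x = g x) -> forall x, closed_shell a b x -> f x = g x.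
Proof.
move=> a0 ab cf cg fg x cx; apply/eqP; rewrite -subr_eq0; apply/negPn/negP => ne.
have e0 : 0 < `|f x - g x| / 2 by rewrite divr_gt0 // normr_gt0.
have [r r0 rP] := within_cont_ball cf cx e0.
have [s s0 sP] := within_cont_ball cg cx e0.
have m0 : 0 < Num.min r s by rewrite lt_min r0 s0.
have [y sy] := shell_dense a0 ab cx m0; rewrite lt_min => /andP[yr ys].
have cy := shell_sub_closed sy.
have H1 := rP y cy yr; have H2 := sP y cy ys.
rewrite (fg y sy) in H1; exact: not_half_close ne H1 H2.
Qed.

End Shells.

(** * Transport along an outgoing field *)

Section Transport.
Context {R : realType}.
Implicit Types (x d h : 'rV[R]_3) (f g : 'rV[R]_3 -> R) (w : 'rV[R]_3 -> 'rV[R]_3).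
Variables (a b : R).
Hypotheses (a0 : 0 < a) (ab : a < b).

(** No flow map is needed: [f + k |x|^2] strictly increases along [w], so its
    maximum over the shell outside [x] lies on the outer sphere. *)
Lemma transport_le f w (c : R) :
  {within closed_shell a b, continuous f} ->
  (forall x, shell a b x -> is_derive x (w x) f 0) ->
  (forall x, shell a b x -> 0 < dot (w x) x) ->
  (forall x, sphere b x -> f x = c) ->
  forall x, shell a b x -> f x <= c.
Proof.
move=> cf Df wx fb x sx; apply/ler_addgt0Pr => e e0.
(* This [k] makes the added term equal to [e] on the outer sphere. *)
pose k := e / b ^+ 2; have b0 := lt_trans a0 ab.
have k0 : 0 < k by rewrite divr_gt0 // exprn_gt0.
pose g y := f y + k * dot y y.
have [ax xb] := andP sx.
have sub : closed_shell (enorm x) b `<=` closed_shell a b.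
  by move=> y /andP[xy yb]; apply/andP; rewrite (le_trans (ltW ax)).
have cg : {within closed_shell (enorm x) b, continuous g}.
  apply: wcD; first exact: (continuous_subspaceW sub cf).
  apply: wcM; first exact: wcC.
  by apply: continuous_subspaceT; exact: dot_continuous.
have ne : closed_shell (enorm x) b !=set0.
  by exists x; rewrite /closed_shell /= lexx ltW.
have [m + mmax] := EVT_max_rV ne (@closed_shell_compact _ _ _) cg.
rewrite inE => cm; have /andP[xm mb] := cm.
have gxm : g x <= g m by apply: mmax; rewrite inE /closed_shell /= lexx ltW.
have {mb} [mb|mb] : enorm m = b \/ enorm m < b.
  by move: mb; rewrite le_eqVlt => /orP[/eqP|]; [left|right].
  have : f x <= g m by apply: le_trans gxm; rewrite lerDl mulr_ge0 ?dot_ge0 // ltW.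
  rewrite /g -enorm_sqr (fb m mb) mb /k divfK //.
  by rewrite gt_eqF // exprn_gt0.
have sm : shell a b m by apply/andP; rewrite (lt_le_trans ax).
have wm := wx m sm.
have Dd := der_sqnorm m (w m).
have Dg : is_derive m (w m) g (k * (2 * dot (w m) m)).
  apply: (is_derive_eq (derD (Df m sm) (derM (derC k _ _) Dd))).
  by rewrite mul0r !add0r.
have [r r0 rP] := small_step_lt (w m) mb.
have : k * (2 * dot (w m) m) <= 0.
  apply: (derive_le0_at_max Dg r0) => t tr; apply: mmax; rewrite inE; apply/andP.
  split; last exact/ltW/rP.
  apply: le_trans xm _; apply: ltW; apply: enorm_outward; first by rewrite dotC.
  by case/andP: tr.
by rewrite leNgt mulr_gt0 // mulr_gt0.
Qed.

(** Apply the one-sided bound to [f] and to [- f].  This is how energy, entropy and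
    the ratio of vorticity to mass flux are all computed from their values on the
    outer sphere. *)
Lemma transport f w (c : R) :
  {within closed_shell a b, continuous f} ->
  (forall x, shell a b x -> is_derive x (w x) f 0) ->
  (forall x, shell a b x -> 0 < dot (w x) x) ->
  (forall x, sphere b x -> f x = c) ->
  forall x, closed_shell a b x -> f x = c.
Proof.
move=> cf Df wx fb x cx.
have cc : {within closed_shell a b, continuous (fun=> c : R)} by exact: wcC.
apply: (@eq_closed_shell R a b f (fun=> c) a0 ab cf cc _ x cx) => {cx}x sx.
apply/eqP; rewrite eq_le (transport_le cf Df wx fb sx) -lerN2.
apply: (transport_le (wcN cf) _ wx _ sx) => [y sy|y /fb -> //].
by have := derN (Df y sy); rewrite oppr0.
Qed.

End Transport.

(** * Integrals over the unit interval *)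

Section UnitIntegral.
Context {R : realType}.
Local Notation mu := (@lebesgue_measure R).

Definition unit_integral (f : R -> R) : R := \int[mu]_(t in `]0, 1[) f t.

Lemma continuous_unit_integrable (f : R -> R) : {within `[0, 1], continuous f} ->
  mu.-integrable `]0, 1[ (EFin \o f).
Proof.
move=> cf; apply: (@integrableS _ _ _ mu `[0, 1]%classic).
- exact: measurable_itv.
- exact: measurable_itv.
- exact: subset_itv_oo_cc.
- by apply: continuous_compact_integrable => //; exact: segment_compact.
Qed.

Lemma unit_integral_le (f : R -> R) (K : R) : {within `[0, 1], continuous f} ->
  (forall t, 0 < t < 1 -> `|f t| <= K) -> `|unit_integral f| <= K.
Proof.
move=> cf fK; have int_f := continuous_unit_integrable cf.
apply: le_trans (le_normr_Rintegral _ int_f) _; first exact: measurable_itv.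
have KE : \int[mu]_(t in `]0%R, 1%R[) K = K.
  rewrite Rintegral_cst /=; last exact: measurable_itv.
  by rewrite lebesgue_measure_itv /= lte_fin ltr01 oppr0 adde0 /= mulr1.
rewrite -[leRHS]KE; apply: le_Rintegral.
- exact: measurable_itv.
- by apply: continuous_unit_integrable => x; apply: continuous_comp;
    [exact: cf|exact: norm_continuous].
- by apply: continuous_unit_integrable; exact: wcC.
- by move=> t; rewrite /= in_itv; exact: fK.
Qed.

Lemma unit_FTC (f P : R -> R) : {within `[0, 1], continuous f} ->
  {within `[0, 1], continuous P} ->
  (forall t : R, 0 < t < 1 -> is_derive t (1 : R) P (f t)) ->
  unit_integral f = P 1 - P 0.
Proof.
move=> cf /(continuous_within_itvP _ ltr01)[cP P0 P1] dP.
have int1 : mu.-integrable `[0, 1[ (EFin \o f).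
  apply: (@integrableS _ _ _ mu `[0, 1]%classic).
  - exact: measurable_itv.
  - exact: measurable_itv.
  - by move=> t; rewrite /= !in_itv /= => /andP[-> /ltW].
  - by apply: continuous_compact_integrable => //; exact: segment_compact.
have int0 := continuous_unit_integrable cf.
rewrite /unit_integral (Rintegral_itv_obnd_cbnd int0) (Rintegral_itv_bndo_bndc int1).
rewrite /Rintegral (continuous_FTC2 ltr01 cf (F := P)) //.
- split => // t; rewrite in_itv /= => /dP D; exact: ex_derive.
- by move=> t; rewrite in_itv /= => /dP D; rewrite derive1E derive_val.
Qed.

(** Leibniz rule followed by the fundamental theorem of calculus: when the
    derivative [D0] of the integrand in the parameter is the derivative of [P] in
    the integration variable, only boundary terms remain. *)
Lemma is_derive_unit_integral (F D : R -> R -> R) (P D0 : R -> R) (e K : R) :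
  0 < e ->
  (forall s, `|s| < e -> {within `[0, 1], continuous (F s)}) ->
  (forall s t : R, `|s| < e -> 0 < t < 1 -> is_derive s (1 : R) (F^~ t) (D s t)) ->
  (forall s t, `|s| < e -> 0 < t < 1 -> `|D s t| <= K) ->
  {within `[0, 1], continuous D0} -> (forall t, 0 < t < 1 -> D 0 t = D0 t) ->
  {within `[0, 1], continuous P} ->
  (forall t : R, 0 < t < 1 -> is_derive t (1 : R) P (D0 t)) ->
  is_derive (0 : R) (1 : R) (fun s => unit_integral (F s)) (P 1 - P 0).
Proof.
move=> e0 cF dF DK cD0 DD0 cP dP; rewrite -(unit_FTC cD0 cP dP).
have I0 : `](-e), e[%classic (0 : R) by rewrite /= in_itv /= oppr_lt0 e0.
have toN (s : R) : `](-e), e[%classic s -> `|s| < e by rewrite /= in_itv /= ltr_norml.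
have Kge0 : 0 <= K.
  have h : 0 < (2^-1 : R) < 1 by rewrite invr_gt0 ltr0n invf_lt1 // ltr1n.
  have z : `|0 : R| < e by rewrite normr0.
  exact: le_trans (normr_ge0 _) (DK 0 _ z h).
have intF s : `](-e), e[%classic s -> mu.-integrable `]0, 1[ (EFin \o F s).
  by move=> /toN se; exact: continuous_unit_integrable (cF s se).
have derF s t : `](-e), e[%classic s -> `]0, 1[%classic t -> derivable (F^~ t) s 1.
  move=> /toN se; rewrite /= in_itv /= => t01; have d := dF s t se t01.
  exact: ex_derive.
have mB : measurable (`]0, 1[%classic : set (measurableTypeR R)) by exact: measurable_itv.
have d1E s t : `](-e), e[%classic s -> `]0, 1[%classic t -> partial1of2 F s t = D s t.
  move=> /toN se; rewrite /= in_itv /= => t01; have d := dF s t se t01.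
  by rewrite partial1of2E derive_val.
have intK : mu.-integrable `]0, 1[ (EFin \o (fun=> K)).
  by apply: continuous_unit_integrable; exact: wcC.
have dub s t : `](-e), e[%classic s -> `]0, 1[%classic t -> `|partial1of2 F s t| <= K.
  move=> Is It; rewrite d1E //; move: It; rewrite /= in_itv /= => t01.
  by apply: DK t01; exact: toN.
apply: DeriveDef.
  have H := @derivable_under_integral R _ _ mu F _ mB 0 _ _ I0 intF derF (fun=> K) (fun=> Kge0) intK dub.
  exact: H.
rewrite -derive1E (@differentiation_under_integral R _ _ mu F _ mB 0 _ _ I0 intF derF (fun=> K) (fun=> Kge0) intK dub).
apply: eq_Rintegral => t; rewrite inE /= => It; rewrite d1E //.
by apply: DD0; move: It; rewrite in_itv.
Qed.

End UnitIntegral.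

(** * Curves and radial functions *)

Section Curves.
Context {R : realType}.
Implicit Types (x d h : 'rV[R]_3) (f g : 'rV[R]_3 -> R).

Lemma der_enorm x d : 0 < enorm x -> is_derive x d (@enorm R) (dot d x / enorm x).
Proof.
move=> x0; have xx : 0 < dot x x by rewrite -enorm_sqr exprn_gt0.
have D := @der_comp R _ Num.sqrt (fun y => dot y y) x d _ _
  (is_derive1_sqrt xx) (der_sqnorm x d).
apply: (is_derive_eq D); rewrite -/(enorm x).
by field; rewrite gt_eqF.
Qed.

Lemma der_curve (A : set 'rV[R]_3) f (c : R -> 'rV[R]_3) (t : R) (c' : 'rV[R]_3) :
  open A -> C1_on A f -> A (c t) ->
  (forall i, is_derive t (1 : R) (fun s => c s 0 i) (c' 0 i)) ->
  is_derive t (1 : R) (fun s => f (c s)) (dot c' (grad f (c t))).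
Proof.
move=> oA Cf Ac dc.
have Dc : derivable c t 1 by apply/derivable_mxP => i j; rewrite ord1; exact: ex_derive.
have Dcv : 'D_1 c t = c'.
  by rewrite derive_mx //; apply/rowP => j; rewrite mxE derive_val.
have [fd fv] := C1_is_diff oA Cf Ac.
have cd : differentiable c t by apply/derivable1_diffP.
have fcd := differentiable_comp cd fd.
apply: DeriveDef; first exact/derivable1_diffP.
rewrite deriveE // diff_comp // /comp.
by rewrite fv /dotr -(deriveE (1 : R) cd) Dcv.
Qed.

End Curves.

Section Bounded.
Context {R : realType} (e : R).
Implicit Types h k : R -> R -> R.

(** Domination required by differentiation under the integral, for integrands
    given by formulas. *)
Definition bounded_near h :=
  exists K : R, forall s t : R, `|s| < e -> 0 < t < 1 -> `|h s t| <= K.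

Lemma bdC (c : R) : bounded_near (fun _ _ => c).
Proof. by exists `|c| => s t _ _. Qed.

Lemma bdD h k : bounded_near h -> bounded_near k -> bounded_near (fun s t => h s t + k s t).
Proof.
move=> [K hK] [L kL]; exists (K + L) => s t se t01.
by apply: le_trans (ler_normD _ _) _; apply: lerD; [exact: hK|exact: kL].
Qed.

Lemma bdN h : bounded_near h -> bounded_near (fun s t => - h s t).
Proof. by move=> [K hK]; exists K => s t se t01; rewrite normrN; exact: hK. Qed.

Lemma bdM h k : bounded_near h -> bounded_near k -> bounded_near (fun s t => h s t * k s t).
Proof.
move=> [K hK] [L kL]; exists (K * L) => s t se t01.
by rewrite normrM; apply: ler_pM; [exact: normr_ge0|exact: normr_ge0|exact: hK|exact: kL].
Qed.

Lemma bd_sum (h : 'I_3 -> R -> R -> R) : (forall i, bounded_near (h i)) ->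
  bounded_near (fun s t => \sum_(i < 3) h i s t).
Proof.
move=> hb; have [K hK] := bdD (bdD (hb 0) (hb 1)) (hb 2).
by exists K => s t se t01; rewrite sum3; exact: hK.
Qed.

Lemma bd_t : bounded_near (fun _ t => t).
Proof. by exists 1 => s t _ /andP[t0 t1]; rewrite gtr0_norm // ltW. Qed.

End Bounded.

(** * The potential of an irrotational field *)

Section Potential.
Context {R : realType}.
Implicit Types (x d h : 'rV[R]_3).
Variables (a b : R) (u : 'I_3 -> 'rV[R]_3 -> R) (g : 'I_3 -> 'I_3 -> 'rV[R]_3 -> R).
Hypotheses (a0 : 0 < a) (ab : a < b).
Hypothesis Cu : forall i, C1_on (shell a b) (u i).
Hypothesis cu : forall i, {within closed_shell a b, continuous (u i)}.
Hypothesis cg : forall i j, {within closed_shell a b, continuous (g i j)}.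
Hypothesis gE : forall i j x, shell a b x -> partial j (u i) x = g i j x.
Hypothesis irr : forall i j x, shell a b x -> g i j x = g j i x.
Hypothesis normal : forall x d, sphere b x -> dot x d = 0 -> \sum_(i < 3) u i x * d 0 i = 0.

Let b0 : 0 < b := lt_trans a0 ab.

Definition stretch x (t : R) : R := 1 - t + t * (b / enorm x).

Lemma enorm_stretch x t : 0 < enorm x -> 0 <= t <= 1 ->
  enorm (stretch x t *: x) = (1 - t) * enorm x + t * b.
Proof.
move=> x0 /andP[t0 t1]; rewrite enormZ ger0_norm.
  by rewrite /stretch; field; rewrite gt_eqF.
by rewrite /stretch addr_ge0 ?subr_ge0 // mulr_ge0 // divr_ge0 //; exact: ltW.
Qed.

Lemma stretch_shell x t : shell a b x -> 0 < t < 1 -> shell a b (stretch x t *: x).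
Proof.
move=> /andP[ax xb] /andP[t0 t1]; have x0 := lt_trans a0 ax.
have t01 : 0 <= t <= 1 by rewrite !ltW.
rewrite /shell /= enorm_stretch //.
have h1 : t * enorm x < t * b by rewrite ltr_pM2l.
have h2 : (1 - t) * enorm x < (1 - t) * b by rewrite ltr_pM2l // subr_gt0.
by move: h1 h2; rewrite !mulrBl !mul1r; move: (t * enorm x) (t * b) => p q; lra.
Qed.

Lemma stretch_closed x t : shell a b x -> 0 <= t <= 1 -> closed_shell a b (stretch x t *: x).
Proof.
move=> /andP[ax xb] /[dup] t01 /andP[t0 t1]; have x0 := lt_trans a0 ax.
rewrite /closed_shell /= enorm_stretch //.
have h1 : t * enorm x <= t * b by rewrite ler_wpM2l // ltW.
have h2 : (1 - t) * enorm x <= (1 - t) * b by rewrite ler_wpM2l ?subr_ge0 // ltW.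
by move: h1 h2; rewrite !mulrBl !mul1r; move: (t * enorm x) (t * b) => p q; lra.
Qed.

Definition potential_integrand x t : R :=
  - ((b / enorm x - 1) * \sum_(i < 3) u i (stretch x t *: x) * x 0 i).

(** Work of [u] along the radial segment from the outer sphere to [x].  The
    starting point varies with [x]; this is harmless because [u] is normal to the
    outer sphere. *)
Definition potential x : R := unit_integral (potential_integrand x).

Lemma stretch_cont x t : {for t, continuous (stretch x)}.
Proof.
by apply: ctD; [apply: ctB; [exact: ctC|exact: cvg_id]|apply: ctM; [exact: cvg_id|exact: ctC]].
Qed.

Lemma stretch_within x (k : 'rV[R]_3 -> R) : shell a b x ->
  {within closed_shell a b, continuous k} ->
  {within `[0, 1], continuous (fun t => k (stretch x t *: x))}.
Proof.
move=> sx ck.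
have cs : {within `[0, 1], continuous (fun t => stretch x t *: x)}.
  apply: continuous_subspaceT => t.
  have ct := @stretch_cont x t.
  apply: (@ct_comp R R (matrix R 1 3) (stretch x) (fun k => k *: x) t _ ct).
  exact: scalel_continuous.
apply: (wc_comp ck cs) => t; rewrite /= in_itv /=; exact: stretch_closed.
Qed.

Lemma wc_sum (A : set R) (k : 'I_3 -> R -> R) :
  (forall i, {within A, continuous (k i)}) ->
  {within A, continuous (fun t => \sum_(i < 3) k i t)}.
Proof.
move=> ck; have E : (fun t => \sum_(i < 3) k i t) = fun t => k 0 t + k 1 t + k 2 t.
  by apply/funext => t; exact: sum3.
by rewrite E; apply: wcD; [apply: wcD|]; exact: ck.
Qed.

Lemma potential_integrand_cont x : shell a b x ->
  {within `[0, 1], continuous (potential_integrand x)}.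
Proof.
move=> sx; apply: wcN; apply: wcM; first exact: wcC.
apply: wc_sum => i; have H := stretch_within sx (@cu i).
by apply: (wcM H); exact: wcC.
Qed.

Lemma within_shell_bounded (k : 'rV[R]_3 -> R) : {within closed_shell a b, continuous k} ->
  exists M : R, forall x, closed_shell a b x -> `|k x| <= M.
Proof.
move=> ck; have /compact_bounded[M [_ /(_ (M + 1))]] :=
  continuous_compact ck (@closed_shell_compact R a b).
rewrite ltrDl => /(_ ltr01) HM; exists (M + 1) => x cx.
by apply: HM; exists x.
Qed.

(** The segment has length [b - |x|]. *)
Lemma potential_bound : exists M : R, forall x, shell a b x ->
  `|potential x| <= M * (b - enorm x).
Proof.
have [M0 M0P] := within_shell_bounded (@cu 0).
have [M1 M1P] := within_shell_bounded (@cu 1).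
have [M2 M2P] := within_shell_bounded (@cu 2).
exists (M0 + M1 + M2) => x sx; have [ax xb] := andP sx.
have x0 := lt_trans a0 ax.
apply: unit_integral_le; first exact: potential_integrand_cont.
move=> t t01; have cy := shell_sub_closed (stretch_shell sx t01).
rewrite /potential_integrand normrN normrM sum3.
have -> : b / enorm x - 1 = (b - enorm x) / enorm x by field; rewrite gt_eqF.
rewrite normrM normfV (gtr0_norm x0) (@gtr0_norm _ (b - enorm x)) ?subr_gt0 //.
have term i Mi : (forall x, closed_shell a b x -> `|u i x| <= Mi) ->
    `|u i (stretch x t *: x) * x 0 i| <= Mi * enorm x.
  move=> HM; rewrite normrM; apply: ler_pM; [exact: normr_ge0|exact: normr_ge0| |].
  - exact: HM.
  - exact: coord_le_enorm.
have -> : (M0 + M1 + M2) * (b - enorm x) =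
    (b - enorm x) / enorm x * ((M0 + M1 + M2) * enorm x) by field; rewrite gt_eqF.
apply: ler_wpM2l; first by apply: divr_ge0; rewrite ?subr_ge0; exact: ltW.
rewrite !mulrDl; apply: le_trans (ler_normD _ _) _; apply: lerD; last exact: term.
by apply: le_trans (ler_normD _ _) _; apply: lerD; exact: term.
Qed.

(** Differentiate under the integral.  As [u] is irrotational the integrand of the
    derivative is itself an exact derivative along the segment, and the boundary
    term on the outer sphere vanishes because [u] is normal there. *)
Lemma potential_gradient x d : shell a b x ->
  is_derive x d potential (\sum_(i < 3) u i x * d 0 i).
Proof.
move=> sx; apply: is_derive_of_line.
have [e e0 eP] := line_in_open d (@shell_open R a b) sx.
pose N s := enorm (x + s *: d).
pose S' (s : R) := - (b * (dot d (x + s *: d) / N s)) / N s ^+ 2.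
pose A s t := stretch (x + s *: d) t.
pose Y s t := A s t *: (x + s *: d).
pose Y' s t : 'rV[R]_3 := \row_i (t * S' s * (x + s *: d) 0 i + A s t * d 0 i).
pose D s t := - (S' s * (\sum_(i < 3) u i (Y s t) * (x + s *: d) 0 i) +
  (b / N s - 1) * \sum_(i < 3)
     ((\sum_(j < 3) Y' s t 0 j * g i j (Y s t)) * (x + s *: d) 0 i + u i (Y s t) * d 0 i)).
pose P t := - \sum_(i < 3) u i (Y 0 t) * Y' 0 t 0 i.
have N0 s : `|s| < e -> 0 < N s.
  by move=> /eP /andP[aN _]; exact: lt_trans aN.
have dX i (s : R) : is_derive s (1 : R) (fun s => (x + s *: d) 0 i) (d 0 i).
  by apply: is_derive_line (der_coord _ _ _).
have dN (s : R) : `|s| < e -> is_derive s (1 : R) N (dot d (x + s *: d) / N s).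
  by move=> /N0 Ns; apply: is_derive_line; exact: der_enorm.
have dS (s : R) : `|s| < e -> is_derive s (1 : R) (fun s => b / N s) (S' s).
  move=> se; have Ns := N0 _ se.
  apply: (is_derive_eq (derM (derC b _ _) (derV (lt0r_neq0 Ns) (dN s se)))).
  by rewrite /S'; field; rewrite gt_eqF.
have dA (s t : R) : `|s| < e -> is_derive s (1 : R) (A^~ t) (t * S' s).
  move=> se; apply: (is_derive_eq (derD (derC (1 - t) _ _) (derM (derC t _ _) (dS s se)))).
  by rewrite mul0r !add0r.
have dY i (s t : R) : `|s| < e -> is_derive s (1 : R) (fun s => Y s t 0 i) (Y' s t 0 i).
  move=> se; have E : (fun s => Y s t 0 i) = fun s => A s t * (x + s *: d) 0 i.
    by apply/funext => r; rewrite /Y mxE.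
  by rewrite E; apply: (is_derive_eq (derM (dA s t se) (dX i s))); rewrite [RHS]mxE.
have sY (s t : R) : `|s| < e -> 0 < t < 1 -> shell a b (Y s t).
  by move=> /eP se; exact: stretch_shell.
have gradE i y : shell a b y -> grad (u i) y = \row_j g i j y.
  by move=> sy; apply/rowP => j; rewrite !mxE; exact: gE.
have duY i (s t : R) : `|s| < e -> 0 < t < 1 ->
    is_derive s (1 : R) (fun s => u i (Y s t)) (\sum_(j < 3) Y' s t 0 j * g i j (Y s t)).
  move=> se t01; have sYs := sY s t se t01.
  have H := @der_curve R (shell a b) (u i) (Y^~ t) s (Y' s t) (@shell_open R a b) (@Cu i) sYs
    (fun i => dY i s t se).
  by apply: (is_derive_eq H); rewrite (gradE _ _ sYs); apply: eq_bigr => j _; rewrite [X in _ * X]mxE.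
have dF (s t : R) : `|s| < e -> 0 < t < 1 ->
    is_derive s (1 : R) (fun s => potential_integrand (x + s *: d) t) (D s t).
  move=> se t01.
  have T i := derM (duY i s t se t01) (dX i s).
  have H := derN (derM (derB (dS s se) (derC 1 _ _)) (derD (derD (T 0) (T 1)) (T 2))).
  have E : (fun s => potential_integrand (x + s *: d) t) = (fun s => - ((b / N s - 1) *
     (u 0 (Y s t) * (x + s *: d) 0 0 + u 1 (Y s t) * (x + s *: d) 0 1 +
      u 2 (Y s t) * (x + s *: d) 0 2))).
    by apply/funext => r; rewrite /potential_integrand sum3.
  rewrite E; apply: (is_derive_eq H).
  by rewrite /D !sum3 subr0.
(* Symmetry of [g] turns the integrand [D 0] into the derivative of [P]. *)
have dP (t : R) : 0 < t < 1 -> is_derive t (1 : R) P (D 0 t).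
  move=> t01; have z : `|0 : R| < e by rewrite normr0.
  have sY0 := sY 0 t z t01.
  have dA0 : is_derive t (1 : R) (A 0) (b / N 0 - 1).
    apply: (is_derive_eq (derD (derB (derC 1 _ _) (is_derive_id _ _))
      (derM (is_derive_id t _) (derC (b / N 0) _ _)))).
    by rewrite /= mulr0 mul1r; ring.
  have dY0 i : is_derive t (1 : R) (fun t => Y 0 t 0 i)
      (((b / N 0 - 1) *: (x + 0 *: d) : 'rV[R]_3) 0 i).
    have E : (fun t => Y 0 t 0 i) = fun t => A 0 t * (x + 0 *: d) 0 i.
      by apply/funext => r; rewrite /Y mxE.
    rewrite E; apply: (is_derive_eq (derM dA0 (derC ((x + 0 *: d) 0 i) _ _))).
    by rewrite mulr0 addr0 [RHS]mxE.
  have dY'0 i : is_derive t (1 : R) (fun t => Y' 0 t 0 i)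
      (S' 0 * (x + 0 *: d) 0 i + (b / N 0 - 1) * d 0 i).
    have E : (fun t => Y' 0 t 0 i) = fun t => t * (S' 0 * (x + 0 *: d) 0 i) + A 0 t * d 0 i.
      by apply/funext => r; rewrite /Y' mxE mulrA.
    rewrite E; apply: (is_derive_eq (derD (derM (is_derive_id _ _) (derC (S' 0 * (x + 0 *: d) 0 i) _ _))
      (derM dA0 (derC (d 0 i) _ _)))).
    by rewrite /= !mulr0 !addr0 mul1r.
  have duY0 i : is_derive t (1 : R) (fun t => u i (Y 0 t))
      (\sum_(j < 3) ((b / N 0 - 1) * (x + 0 *: d) 0 j) * g i j (Y 0 t)).
    have H := @der_curve R (shell a b) (u i) (Y 0) t _ (@shell_open R a b) (@Cu i) sY0 dY0.
    apply: (is_derive_eq H); rewrite (gradE _ _ sY0); apply: eq_bigr => j _.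
    by rewrite [X in _ * X]mxE [X in X * _]mxE.
  have T i := derM (duY0 i) (dY'0 i).
  have H := derN (derD (derD (T 0) (T 1)) (T 2)).
  have E : P = fun t => - (u 0 (Y 0 t) * Y' 0 t 0 0 + u 1 (Y 0 t) * Y' 0 t 0 1 +
      u 2 (Y 0 t) * Y' 0 t 0 2) by apply/funext => r; rewrite /P sum3.
  rewrite E; apply: (is_derive_eq H).
  have YE i : Y' 0 t 0 i = t * S' 0 * (x + 0 *: d) 0 i + A 0 t * d 0 i by rewrite /Y' mxE.
  rewrite /D !sum3 !YE (irr 1 0 sY0) (irr 2 0 sY0) (irr 2 1 sY0).
  move: (g _ _ _) (g _ _ _) (g _ _ _) (g _ _ _) (g _ _ _) (g _ _ _) => g00 g01 g02 g11 g12 g22.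
  move: (u _ _) (u _ _) (u _ _) => u0 u1 u2.
  move: ((x + 0 *: d) 0 0) ((x + 0 *: d) 0 1) ((x + 0 *: d) 0 2) (d 0 0) (d 0 1) (d 0 2).
  move: (S' 0) (A 0 t) (b / N 0) => s1 al be x0 x1 x2 d0 d1 d2.
  clear; ring.
have sX s : `|s| < e -> shell a b (x + s *: d) by exact: eP.
have z0 : `|0 : R| < e by rewrite normr0.
have cF s : `|s| < e -> {within `[0, 1], continuous (potential_integrand (x + s *: d))}.
  by move=> /sX; exact: potential_integrand_cont.
have cA0 : {within `[0, 1], continuous (A 0)}.
  by apply: continuous_subspaceT => t; exact: (@stretch_cont (x + 0 *: d) t).
have cY' i : {within `[0, 1], continuous (fun t => Y' 0 t 0 i)}.
  have E : (fun t => Y' 0 t 0 i) = fun t => t * (S' 0 * (x + 0 *: d) 0 i) + A 0 t * d 0 i.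
    by apply/funext => r; rewrite /Y' mxE mulrA.
  rewrite E; apply: wcD; apply: wcM; [|exact: wcC|exact: cA0|exact: wcC].
  by apply: continuous_subspaceT => t; exact: cvg_id.
have cuY i : {within `[0, 1], continuous (fun t => u i (Y 0 t))}.
  exact: (stretch_within (sX 0 z0) (@cu i)).
have cgY i j : {within `[0, 1], continuous (fun t => g i j (Y 0 t))}.
  exact: (stretch_within (sX 0 z0) (@cg i j)).
have cP : {within `[0, 1], continuous P}.
  by apply: wcN; apply: wc_sum => i; apply: wcM; [exact: cuY|exact: cY'].
have cD : {within `[0, 1], continuous (D 0)}.
  apply: wcN; apply: wcD; apply: wcM; [exact: wcC| |exact: wcC|].
  - by apply: wc_sum => i; apply: wcM; [exact: cuY|exact: wcC].
  - apply: wc_sum => i; apply: wcD; apply: wcM; [|exact: wcC|exact: cuY|exact: wcC].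
    by apply: wc_sum => j; apply: wcM; [exact: cY'|exact: cgY].
have bX i : bounded_near e (fun s _ => (x + s *: d) 0 i).
  exists b => s t /sX /andP[_ xb] _.
  by apply: le_trans (coord_le_enorm _ _) _; exact: ltW.
have bN : bounded_near e (fun s _ => (N s)^-1).
  exists a^-1 => s t se _; have /andP[aN _] := sX s se.
  rewrite normfV (gtr0_norm (N0 s se)) lef_pV2 ?posrE //; first exact: ltW.
  exact: N0.
have bS' : bounded_near e (fun s _ => S' s).
  have E : (fun s _ : R => S' s) = fun s _ => - (b * ((d 0 0 * (x + s *: d) 0 0 +
      d 0 1 * (x + s *: d) 0 1 + d 0 2 * (x + s *: d) 0 2) * (N s)^-1)) * ((N s)^-1 * (N s)^-1).
    by apply/funext => s; apply/funext => _; rewrite /S' dotE -expr2 exprVn.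
  rewrite E; apply: bdM; last exact: bdM.
  apply: bdN; apply: bdM; first exact: bdC.
  apply: bdM; last exact: bN.
  by apply: bdD; [apply: bdD|]; apply: bdM; (exact: bdC || exact: bX).
have bS : bounded_near e (fun s _ => b / N s) by apply: bdM; [exact: bdC|exact: bN].
have bA : bounded_near e A.
  apply: bdD; first by apply: bdD; [exact: bdC|apply: bdN; exact: bd_t].
  by apply: bdM; [exact: bd_t|exact: bS].
have bY' i : bounded_near e (fun s t => Y' s t 0 i).
  have E : (fun s t => Y' s t 0 i) = fun s t => t * S' s * (x + s *: d) 0 i + A s t * d 0 i.
    by apply/funext => s; apply/funext => t; rewrite /Y' mxE.
  rewrite E; apply: bdD; apply: bdM; [|exact: bX|exact: bA|exact: bdC].
  by apply: bdM; [exact: bd_t|exact: bS'].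
have bk (k : 'rV[R]_3 -> R) : {within closed_shell a b, continuous k} ->
    bounded_near e (fun s t => k (Y s t)).
  move=> /within_shell_bounded[M HM]; exists M => s t se t01; apply: HM.
  by apply: shell_sub_closed; exact: sY.
have [K HK] : bounded_near e D.
  apply: bdN; apply: bdD; apply: bdM; [exact: bS'| | |].
  - by apply: bd_sum => i; apply: bdM; [exact: (bk _ (@cu i))|exact: bX].
  - by apply: bdD; [exact: bS|exact: bdC].
  - apply: bd_sum => i; apply: bdD; apply: bdM; [|exact: bX|exact: (bk _ (@cu i))|exact: bdC].
    by apply: bd_sum => j; apply: bdM; [exact: bY'|exact: (bk _ (@cg i j))].
have H := is_derive_unit_integral e0 cF dF HK cD (fun t _ => erefl (D 0 t)) cP dP.
apply: (is_derive_eq H).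
have N00 := N0 0 z0.
(* At t = 1 the curve runs in the outer sphere, to which [u] is orthogonal. *)
have P1 : P 1 = 0.
  rewrite /P -[RHS]oppr0; congr (- _); apply: normal.
    rewrite /sphere /= /Y /A enorm_stretch ?subrr ?mul0r ?add0r ?mul1r //.
    by rewrite lexx ler01.
  rewrite dotE /Y /Y' !mxE /A /stretch subrr add0r !mul1r -/(N 0) /S'.
  have := enorm_sqr (x + 0 *: d); rewrite -/(N 0) dotE.
  rewrite [dot d _]dotE !mxE.
  move: (N 0) N00 (x 0 0) (x 0 1) (x 0 2) (d 0 0) (d 0 1) (d 0 2) => n n0 x0 x1 x2 d0 d1 d2.
  rewrite !mul0r !addr0 => nE; move: (n) n0 nE => {}n n0 nE.
  transitivity (b / n * (b * ((d0 * x0 + d1 * x1 + d2 * x2) / n)) *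
    (1 - (x0 * x0 + x1 * x1 + x2 * x2) / n ^+ 2)); first by field; rewrite gt_eqF.
  by rewrite -nE divff ?subrr ?mulr0 // expf_neq0 // gt_eqF.
have P0 : P 0 = - \sum_(i < 3) u i x * d 0 i.
  rewrite /P; congr (- _); apply: eq_bigr => i _.
  rewrite /Y /Y' mxE /A /stretch subr0 !mul0r !addr0 add0r !scale1r mul1r scale0r addr0.
  exact: erefl.
by rewrite P1 P0 sub0r opprK.
Qed.

End Potential.

(** * Tangential derivatives on the outer sphere *)

Section BoundaryDerivative.
Context {R : realType}.
Implicit Types (x d h : 'rV[R]_3).
Variables (a b : R) (f : 'rV[R]_3 -> R) (g : 'I_3 -> 'rV[R]_3 -> R).
Hypotheses (a0 : 0 < a) (ab : a < b).
Hypothesis Cf : C1_on (shell a b) f.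
Hypothesis cf : {within closed_shell a b, continuous f}.
Hypothesis cg : forall i, {within closed_shell a b, continuous (g i)}.
Hypothesis gE : forall i x, shell a b x -> partial i f x = g i x.

Let b0 : 0 < b := lt_trans a0 ab.

Lemma wc_dot (A : set 'rV[R]_3) (k : 'I_3 -> 'rV[R]_3 -> R) d :
  (forall i, {within A, continuous (k i)}) ->
  {within A, continuous (fun z => \sum_(i < 3) d 0 i * k i z)}.
Proof.
move=> ck; have E : (fun z => \sum_(i < 3) d 0 i * k i z) =
    fun z => d 0 0 * k 0 z + d 0 1 * k 1 z + d 0 2 * k 2 z.
  by apply/funext => z; exact: sum3.
by rewrite E; apply: wcD; [apply: wcD|]; apply: wcM; (exact: wcC || exact: ck).
Qed.

Lemma chord_MVT x w : closed_shell a b x -> closed_shell a b (x + w) ->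
  (forall s : R, 0 < s < 1 -> shell a b (x + s *: w)) ->
  exists2 s : R, 0 < s < 1 & f (x + w) - f x = \sum_(i < 3) w 0 i * g i (x + s *: w).
Proof.
move=> cx cxw sw.
have D (s : R) : s \in `]0, 1[%R -> is_derive s (1 : R) (fun s => f (x + s *: w))
    (dot w (grad f (x + s *: w))).
  rewrite in_itv /= => /sw ss; apply: is_derive_line.
  exact: (@C1_is_derive R (shell a b) f _ w (@shell_open R a b) Cf ss).
have cl : {within `[0, 1], continuous (fun s : R => x + s *: w)}.
  apply: continuous_subspaceT => s.
  have c0 : {for s, continuous (fun _ : R => x)} by exact: cst_continuous.
  have c1 : {for s, continuous (fun s : R => s *: w)} by exact: scalel_continuous.
  exact: (continuousD c0 c1).
have clf : {within `[0, 1], continuous (fun s : R => f (x + s *: w))}.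
  apply: (wc_comp cf cl) => s; rewrite /= in_itv /= => /andP[].
  rewrite le_eqVlt => /orP[/eqP <- _|s0]; first by rewrite scale0r addr0.
  rewrite le_eqVlt => /orP[/eqP ->|s1]; first by rewrite scale1r.
  by apply: shell_sub_closed; apply: sw; rewrite s0.
have [s] := MVT ltr01 D clf; rewrite in_itv /= => s01.
rewrite scale1r scale0r addr0 subr0 mulr1 => ->; exists s => //.
by apply: eq_bigr => i _; congr (_ * _); rewrite mxE; apply: gE; exact: sw.
Qed.

(** [f] is only known inside the sphere, so tangential curves are replaced by
    chords: [f] vanishes at both ends, hence its derivative along the chord
    vanishes somewhere inside, and short chords are nearly tangent. *)
Lemma boundary_tangential_le0 x d : (forall y, sphere b y -> f y = 0) ->
  sphere b x -> dot x d = 0 -> \sum_(i < 3) d 0 i * g i x <= 0.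
Proof.
move=> fb sx xd; rewrite leNgt; apply/negP => S0.
have sxE : dot x x = b ^+ 2 by rewrite -enorm_sqr sx.
have cx : closed_shell a b x by rewrite /closed_shell /= sx lexx ltW.
set S := \sum_(i < 3) _ in S0.
pose G z := \sum_(i < 3) d 0 i * g i z; pose H z := \sum_(i < 3) x 0 i * g i z.
have S20 : 0 < S / 2 by rewrite divr_gt0.
have [r1 r10 r1P] := within_cont_ball (@wc_dot _ g d cg) cx S20.
have [r2 r20 r2P] := within_cont_ball (@wc_dot _ g x cg) cx ltr01.
have oA : open ((@enorm R) @^-1` `]a, +oo[%classic : set 'rV[R]_3).
  by apply: open_comp; [move=> y _; exact: enorm_continuous|exact: interval_open].
have Ax : ((@enorm R) @^-1` `]a, +oo[%classic : set 'rV[R]_3) x.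
  by rewrite /preimage /= in_itv /= sx ab.
have [r3 r30 r3P] := open_ball oA Ax.
have d0 : 0 < dot d d.
  rewrite lt_neqAle dot_ge0 andbT eq_sym; apply/eqP => /dot_eq0 dz.
  by move: S0; rewrite /S sum3 dz !mxE !mul0r !addr0 ltxx.
pose k := dot d d / b ^+ 2.
have k0 : 0 < k by rewrite divr_gt0 // exprn_gt0.
pose m := Num.min r1 (Num.min r2 r3).
have m0 : 0 < m by rewrite !lt_min r10 r20.
pose B := 2 * (`|d| + k * `|x| + 1).
have B0 : 0 < B by rewrite mulr_gt0 // ltr_wpDl // addr_ge0 // mulr_ge0 // ltW.
pose K := k * (`|H x| + 1).
have K0 : 0 < K by rewrite mulr_gt0 // ltr_wpDl.
pose t := Num.min 1 (Num.min (m / B) (S / 2 / K)) / 2.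
have n0 : 0 < Num.min 1 (Num.min (m / B) (S / 2 / K)).
  by rewrite !lt_min ltr01 !divr_gt0.
have t0 : 0 < t by rewrite divr_gt0.
have : t < Num.min 1 (Num.min (m / B) (S / 2 / K)).
  by rewrite /t ltr_pdivrMr // ltr_pMr // ltr1n.
rewrite !lt_min => /and3P[t1 tB tK].
have q0 : 0 < 1 + k * t ^+ 2 by rewrite addr_gt0 // mulr_gt0 // exprn_gt0.
(* Rational parametrization of the circle: with these coefficients
   [x + A *: (d - (k * t) *: x)] lies on the sphere through [x]. *)
pose A := 2 * t / (1 + k * t ^+ 2).
have A0 : 0 < A by rewrite divr_gt0 // mulr_gt0.
have A2 : A <= 2 * t.
  rewrite ler_pdivrMr //; apply: ler_peMr; first by rewrite mulr_ge0 // ltW.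
  by rewrite lerDl mulr_ge0 ?sqr_ge0 // ltW.
pose w := A *: (d - (k * t) *: x).
have nw : `|w| < m.
  rewrite normrZ (gtr0_norm A0).
  have h1 : `|d - (k * t) *: x| <= `|d| + k * `|x| + 1.
    apply: le_trans (ler_normB _ _) _; rewrite normrZ (gtr0_norm (mulr_gt0 k0 t0)).
    rewrite -addrA lerD2l -mulrA; apply: (@le_trans _ _ (k * `|x|)); last by rewrite lerDl.
    by rewrite ler_wpM2l ?(ltW k0) // ler_piMl // ltW.
  apply: (@le_lt_trans _ _ (2 * t * (`|d| + k * `|x| + 1))).
    by apply: ler_pM => //; exact: ltW.
  by rewrite mulrAC mulrC -/B -ltr_pdivlMr.
have nE (s : R) : dot (x + s *: w) (x + s *: w) = b ^+ 2 * (1 - 2 * A * k * t * (s * (1 - s))).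
  have -> : dot (x + s *: w) (x + s *: w) = dot x x + 2 * s * A * (dot x d - k * t * dot x x)
     + (s * A) ^+ 2 * (dot d d - 2 * (k * t) * dot x d + (k * t) ^+ 2 * dot x x).
    by rewrite /w !dotE !mxE; ring.
  rewrite xd sxE (_ : dot d d = k * b ^+ 2); last by rewrite /k divfK // expf_neq0 // gt_eqF.
  by rewrite /A; field; rewrite gt_eqF.
have nears (s : R) : 0 <= s <= 1 -> `|x + s *: w - x| < m.
  move=> /andP[s0 s1]; rewrite addrC addKr normrZ (ger0_norm s0).
  by apply: le_lt_trans nw; rewrite ler_piMl.
have above (s : R) : 0 <= s <= 1 -> a < enorm (x + s *: w).
  move=> /nears; rewrite !lt_min => /and3P[_ _ /r3P].
  by rewrite /preimage /= in_itv /= andbT.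
have inside (s : R) : 0 < s < 1 -> shell a b (x + s *: w).
  move=> /andP[s0 s1]; apply/andP; split; first by apply: above; rewrite !ltW.
  have ss : 0 < s * (1 - s) by rewrite mulr_gt0 // subr_gt0.
  have bge := ltW b0.
  rewrite -(@ltr_pXn2r _ 2) ?nnegrE ?enorm_ge0 // enorm_sqr nE.
  rewrite gtr_pMr ?exprn_gt0 // gtrBl.
  exact: mulr_gt0 (mulr_gt0 (mulr_gt0 (mulr_gt0 (ltr0Sn R 1) A0) k0) t0) ss.
have yb : sphere b (x + w).
  have bge := ltW b0; apply/eqP; rewrite -(@eqrXn2 _ 2) ?enorm_ge0 //.
  by rewrite enorm_sqr -[w]scale1r nE subrr !mulr0 subr0 mulr1.
have cy : closed_shell a b (x + w) by rewrite /closed_shell /= yb lexx ltW.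
have [s s01] := chord_MVT cx cy inside.
rewrite (fb _ yb) (fb _ sx) subrr => Es.
have s01' : 0 <= s <= 1 by case/andP: s01 => s0 s1; rewrite !ltW.
have cz := shell_sub_closed (inside s s01).
have := nears s s01'; rewrite !lt_min => /and3P[/(r1P _ cz) Gz /(r2P _ cz) Hz _].
have GH : G (x + s *: w) = k * t * H (x + s *: w).
  move: Es; rewrite /G /H !sum3 !mxE.
  move: (g 0 _) (g 1 _) (g 2 _) => g0 g1 g2 Es.
  have An : A != 0 by rewrite gt_eqF.
  apply: (mulfI An); apply/eqP; rewrite -subr_eq0; apply/eqP; rewrite [RHS]Es; ring.
have : S / 2 < G (x + s *: w).
  move: Gz; rewrite -/(G (x + s *: w)) -/S.
  by rewrite distrC => /(le_lt_trans (ler_norm _)); lra.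
rewrite GH ltNge => /negP; apply.
apply: (@le_trans _ _ (k * t * (`|H x| + 1))).
  apply: (ler_wpM2l (ltW (mulr_gt0 k0 t0))).
  move: Hz; rewrite -/(H (x + s *: w)) -/(H x) => Hz.
  rewrite -[H (x + s *: w)](subrK (H x)) addrC.
  apply: lerD; [exact: ler_norm|exact: ltW (le_lt_trans (ler_norm _) Hz)].
by rewrite mulrAC -/K mulrC -ler_pdivlMr // ltW.
Qed.

End BoundaryDerivative.

Section BoundaryTangential.
Context {R : realType}.
Variables (a b : R) (f : 'rV[R]_3 -> R) (g : 'I_3 -> 'rV[R]_3 -> R).

(** [g] is the continuous extension of the gradient of [f] to the closed shell;
    apply the one-sided bound to [d] and to [- d]. *)
Lemma boundary_tangential x d : 0 < a -> a < b ->
  C1_on (shell a b) f -> {within closed_shell a b, continuous f} ->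
  (forall i, {within closed_shell a b, continuous (g i)}) ->
  (forall i y, shell a b y -> partial i f y = g i y) ->
  (forall y, sphere b y -> f y = 0) ->
  sphere b x -> dot x d = 0 -> \sum_(i < 3) d 0 i * g i x = 0.
Proof.
move=> a0 ab Cf cf cg gE fb sx xd; apply/eqP; rewrite eq_le.
rewrite (boundary_tangential_le0 a0 ab Cf cf cg gE fb sx xd) /= -oppr_le0.
have xNd : dot x (- d) = 0 by rewrite -[RHS]oppr0 -xd !dotE !mxE; ring.
have := boundary_tangential_le0 a0 ab Cf cf cg gE fb sx xNd.
by rewrite !sum3 !mxE !mulNr -!opprD.
Qed.

End BoundaryTangential.

(** * Comparison with radial barriers *)

Section EllipticAlgebra.
Context {R : realFieldType}.

(** The symbol [C I - (V/n)^2 x x^T] is positive definite in the subsonic range: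
    it equals [(C - V^2) I + (V/n)^2 (n^2 I - x x^T)], and [n^2 I - x x^T] is the
    sum of the squares of the three rotation fields at [x].  So the operator is
    the sum of six second order conditions, along the axes and along the
    rotations. *)
Lemma radial_ellipticity (J00 J01 J02 J10 J11 J12 J20 J21 J22 n x0 x1 x2 C V V' sg : R) :
  0 < n -> x0 * x0 + x1 * x1 + x2 * x2 = n ^+ 2 -> V ^+ 2 < C ->
  (forall d0 d1 d2, sg *
    (d0 * d0 * J00 + d0 * d1 * J01 + d0 * d2 * J02 +
    (d1 * d0 * J10 + d1 * d1 * J11 + d1 * d2 * J12) +
    (d2 * d0 * J20 + d2 * d1 * J21 + d2 * d2 * J22) -
    ((V' * n - V) / n ^+ 2 * ((d0 * x0 + d1 * x1 + d2 * x2) ^+ 2 / n) +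
    V / n * (d0 * d0 + d1 * d1 + d2 * d2))) <= 0) ->
  C * (J00 + J11 + J22) = (V / n) ^+ 2 *
    (x0 * x0 * J00 + x0 * x1 * J01 + x0 * x2 * J02 +
    (x1 * x0 * J10 + x1 * x1 * J11 + x1 * x2 * J12) +
    (x2 * x0 * J20 + x2 * x1 * J21 + x2 * x2 * J22)) ->
  0 <= sg * ((C - V ^+ 2) * V' + 2 * C * V / n).
Proof.
move=> n0 X VC H; set N := (X in _ = (V / n) ^+ 2 * X -> _) => P.
pose T := J00 + J11 + J22.
have nn : n != 0 by rewrite gt_eqF.
have S1 : sg * (T - ((V' * n - V) / n ^+ 2 * (n ^+ 2 / n) + 3 * (V / n))) <= 0.
  have h0 := H 1 0 0; have h1 := H 0 1 0; have h2 := H 0 0 1.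
  have := lerD (lerD h0 h1) h2; rewrite !addr0; apply: le_trans.
  rewrite -X le_eqVlt; apply/orP; left; apply/eqP.
  by rewrite /T; ring.
have S2 : sg * (n ^+ 2 * T - N - V / n * (2 * n ^+ 2)) <= 0.
  have h0 := H 0 x2 (- x1); have h1 := H x2 0 (- x0); have h2 := H x1 (- x0) 0.
  have := lerD (lerD h0 h1) h2; rewrite !addr0; apply: le_trans.
  rewrite -X le_eqVlt; apply/orP; left; apply/eqP.
  by rewrite /T /N; ring.
have A0 : 0 <= C - V ^+ 2 by rewrite subr_ge0 ltW.
have B0 : 0 <= V ^+ 2 / n ^+ 2 by rewrite divr_ge0 ?sqr_ge0.
have := lerD (ler_wpM2l A0 S1) (ler_wpM2l B0 S2); rewrite !mulr0 addr0 -oppr_ge0.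
have -> // : - ((C - V ^+ 2) * (sg * (T - ((V' * n - V) / n ^+ 2 * (n ^+ 2 / n) + 3 * (V / n)))) +
   V ^+ 2 / n ^+ 2 * (sg * (n ^+ 2 * T - N - V / n * (2 * n ^+ 2)))) =
   sg * ((C - V ^+ 2) * V' + 2 * C * V / n) + sg * ((V / n) ^+ 2 * N - C * T).
  by field.
by rewrite P subrr mulr0 addr0.
Qed.

End EllipticAlgebra.

Section Comparison.
Context {R : realType}.
Implicit Types (x d h : 'rV[R]_3).
Variables (a b : R) (w : 'rV[R]_3 -> 'rV[R]_3) (phi : 'rV[R]_3 -> R).
Variables (c2 : R -> R) (Phi v v' : R -> R) (sg : R).
Hypotheses (a0 : 0 < a) (ab : a < b).
Hypothesis Cw : forall i, C1_on (shell a b) (fun x => w x 0 i).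
Hypothesis dphi : forall x d, shell a b x -> is_derive x d phi (dot (w x) d).
Hypothesis dPhi : forall r : R, a < r < b -> is_derive r (1 : R) Phi (v r).
Hypothesis dv : forall r : R, a < r < b -> is_derive r (1 : R) v (v' r).
Hypothesis v0 : forall r : R, a < r < b -> 0 < v r.
Hypothesis subsonic : forall r : R, a < r < b -> v r ^+ 2 < c2 (v r ^+ 2).
Hypothesis outgoing : forall x, shell a b x -> 0 < dot (w x) x.
Hypothesis pde : forall x, shell a b x ->
  c2 (dot (w x) (w x)) * (\sum_(i < 3) partial i (fun x => w x 0 i) x) =
  \sum_(i < 3) \sum_(j < 3) w x 0 i * w x 0 j * partial j (fun x => w x 0 i) x.
Hypothesis strict : forall r : R, a < r < b ->
  sg * ((c2 (v r ^+ 2) - v r ^+ 2) * v' r + 2 * c2 (v r ^+ 2) * v r / r) < 0.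

Let g x := sg * (phi x - Phi (enorm x)).
Let beta (r : R) := v r / r.
Let G x : 'rV[R]_3 := sg *: (w x - beta (enorm x) *: x).

Lemma der_gap x d : shell a b x -> is_derive x d g (dot d (G x)).
Proof.
move=> sx; have x0 := lt_trans a0 (andP sx).1.
have D := derM (derC sg x d) (derB (dphi d sx) (der_comp (dPhi sx) (der_enorm d x0))).
apply: (is_derive_eq D); rewrite mul0r add0r /G /beta !dotE !mxE.
by field; rewrite gt_eqF.
Qed.

Lemma gap_step x d (e : R) : shell a b x -> 0 < e ->
  (forall t : R, 0 < t < e -> g (x + t *: d) <= g x) -> dot d (G x) <= 0.
Proof. by move=> sx e0 gmax; exact: derive_le0_at_max (der_gap d sx) e0 gmax. Qed.

Lemma der_gap_gradient x d : shell a b x ->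
  let r := enorm x in
  is_derive x d (fun y => dot d (G y))
    (sg * (\sum_(i < 3) \sum_(j < 3) d 0 i * d 0 j * partial j (fun x => w x 0 i) x
     - ((v' r * r - v r) / r ^+ 2 * (dot d x ^+ 2 / r) + v r / r * dot d d))).
Proof.
move=> sx r; have x0 := lt_trans a0 (andP sx).1.
have Dw i : is_derive x d (fun y => w y 0 i) (\sum_(j < 3) d 0 j * partial j (fun x => w x 0 i) x).
  apply: (is_derive_eq (@C1_is_derive R _ _ x d (@shell_open R a b) (@Cw i) sx)).
  by rewrite /dot; apply: eq_bigr => j _; rewrite mxE.
have Dr := der_enorm d x0.
have Db : is_derive x d (fun y => v (enorm y) / enorm y)
    ((v' r * r - v r) / r ^+ 2 * (dot d x / r)).
  apply: (is_derive_eq (derF (lt0r_neq0 x0) (der_comp (dv sx) Dr) Dr)).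
  by rewrite -/r; field; rewrite gt_eqF.
have T i := derM (derC (d 0 i) x d)
  (derM (derC sg x d) (derB (Dw i) (derM Db (der_coord x d i)))).
have E : (fun y => dot d (G y)) =
   (fun y => d 0 0 * (sg * (w y 0 0 - v (enorm y) / enorm y * y 0 0)) +
   d 0 1 * (sg * (w y 0 1 - v (enorm y) / enorm y * y 0 1)) +
   d 0 2 * (sg * (w y 0 2 - v (enorm y) / enorm y * y 0 2))).
  by apply/funext => y; rewrite dotE !mxE.
rewrite E; apply: (is_derive_eq (derD (derD (T 0) (T 1)) (T 2))).
clear Dw Dr Db T E; rewrite -/r in x0 *; clearbody r; rewrite !sum3 !dotE.
move: (partial _ _ _) (partial _ _ _) (partial _ _ _) (partial _ _ _) (partial _ _ _)
  (partial _ _ _) (partial _ _ _) (partial _ _ _) (partial _ _ _).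
move=> p1 p2 p3 p4 p5 p6 p7 p8 p9.
move: (v' r) (v r) (w x) (d 0 0) (d 0 1) (d 0 2) (x 0 0) (x 0 1) (x 0 2).
move=> V' V W d0 d1 d2 x0' x1 x2.
by field; rewrite gt_eqF.
Qed.

Lemma gap_second x d (e : R) : shell a b x -> 0 < e -> G x = 0 ->
  (forall t : R, 0 < t < e -> g (x + t *: d) <= g x) ->
  let r := enorm x in
  sg * (\sum_(i < 3) \sum_(j < 3) d 0 i * d 0 j * partial j (fun x => w x 0 i) x
     - ((v' r * r - v r) / r ^+ 2 * (dot d x ^+ 2 / r) + v r / r * dot d d)) <= 0.
Proof.
move=> sx e0 Gx gmax /=.
have [e1 e10 e1P] := line_in_open d (@shell_open R a b) sx.
have m0 : 0 < Num.min e e1 by rewrite lt_min e0.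
have Df (t : R) : 0 <= t < Num.min e e1 -> is_derive (x + t *: d) d g (dot d (G (x + t *: d))).
  by move=> /andP[t0]; rewrite lt_min => /andP[_ te]; apply: der_gap; apply: e1P; rewrite ger0_norm.
have G0 : dot d (G x) = 0 by rewrite Gx dotE !mxE; ring.
have gm (t : R) : 0 < t < Num.min e e1 -> g (x + t *: d) <= g x.
  by move=> /andP[t0]; rewrite lt_min => /andP[te _]; apply: gmax; rewrite t0.
exact: (@derive2_le0_at_max R g (fun y => dot d (G y)) x d _ _ m0 Df (der_gap_gradient d sx) G0 gm).
Qed.

Definition row3 (d0 d1 d2 : R) : 'rV[R]_3 := d0 *: basis R 0 + d1 *: basis R 1 + d2 *: basis R 2.

Lemma row3E (d0 d1 d2 : R) : [/\ row3 d0 d1 d2 0 0 = d0, row3 d0 d1 d2 0 1 = d1 & row3 d0 d1 d2 0 2 = d2].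
Proof. by rewrite /row3; split; rewrite !mxE !eqxx /= !(mulr0, mulr1, addr0, add0r). Qed.

(** At an interior maximum the two velocities agree, hence the flow is subsonic
    there and the equation for [w] is elliptic, whatever [w] does elsewhere.  The
    second order conditions then bound the operator from one side, against the
    strict inequality satisfied by the barrier. *)
Lemma no_interior_max x (rho : R) : shell a b x -> 0 < rho -> sg ^+ 2 = 1 ->
  (forall y, `|y - x| < rho -> g y <= g x) -> False.
Proof.
move=> sx rho0 sg1 gmax; have x0 := lt_trans a0 (andP sx).1.
have dir d : exists2 e : R, 0 < e & forall t : R, 0 < t < e -> g (x + t *: d) <= g x.
  have d1 : 0 < `|d| + 1 by rewrite ltr_wpDl.
  exists (rho / (`|d| + 1)); first by rewrite divr_gt0.
  move=> t /andP[t0 te]; apply: gmax; rewrite addrC addKr normrZ (gtr0_norm t0).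
  apply: (@le_lt_trans _ _ (t * (`|d| + 1))); first by rewrite ler_wpM2l ?lerDl // ltW.
  by rewrite -ltr_pdivlMr.
have Gx : G x = 0.
  have [e e0 eP] := dir (G x); apply: dot_eq0; apply/eqP.
  by rewrite eq_le dot_ge0 andbT; exact: gap_step sx e0 eP.
have second d := let: ex_intro2 e e0 eP := dir d in gap_second sx e0 Gx eP.
have sg0 : sg != 0 by apply: contra_eq_neq sg1 => ->; rewrite expr0n /= eq_sym oner_neq0.
have wx : w x = beta (enorm x) *: x.
  by move/eqP: Gx; rewrite /G scaler_eq0 (negbTE sg0) subr_eq0 => /eqP.
have rr : dot x x = enorm x ^+ 2 by rewrite enorm_sqr.
have St := strict (r := enorm x) sx.
have Su := subsonic (r := enorm x) sx.
have wwE : dot (w x) (w x) = v (enorm x) ^+ 2.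
  by rewrite wx dotZl dotC dotZl rr /beta; field; rewrite gt_eqF.
have Pd := pde sx; rewrite wwE in Pd.
have H (d0 d1 d2 : R) := second (row3 d0 d1 d2).
move: St; rewrite ltNge => /negP; apply.
pose J i j := partial j (fun x => w x 0 i) x.
apply: (@radial_ellipticity R (J 0 0) (J 0 1) (J 0 2) (J 1 0) (J 1 1) (J 1 2)
  (J 2 0) (J 2 1) (J 2 2) (enorm x) (x 0 0) (x 0 1) (x 0 2) _ _ _ _ x0 _ Su).
- by rewrite -dotE.
- move=> d0 d1 d2; have := H d0 d1 d2; have [E0 E1 E2] := row3E d0 d1 d2.
  by rewrite /= !dotE !sum3 E0 E1 E2.
- move: Pd; rewrite !sum3 -!/(J _ _) => ->; rewrite wx /beta !mxE.
  move: (J 0 0) (J 0 1) (J 0 2) (J 1 0) (J 1 1) (J 1 2) (J 2 0) (J 2 1) (J 2 2).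
  by move=> J00 J01 J02 J10 J11 J12 J20 J21 J22; ring.
Qed.

Lemma gap_continuous x : shell a b x -> {for x, continuous g}.
Proof.
move=> sx; apply: ctM; first exact: ctC.
have pphi i y : shell a b y -> is_derive y (basis R i) phi (w y 0 i).
  move=> sy; apply: (is_derive_eq (dphi (basis R i) sy)).
  by rewrite dotC dot_basis.
apply: ctB; last first.
  apply: ct_comp; last exact: enorm_continuous.
  by have D := dPhi (r := enorm x) sx; apply/differentiable_continuous/derivable1_diffP.
apply: differentiable_continuous.
have pc i : (forall y, shell a b y -> derivable phi y (basis R i)) /\
             {within shell a b, continuous (partial i phi)}.
  split=> [y /(pphi i) D|]; first exact: ex_derive.
  apply: eq_within (Cw i).1 _ => y /(pphi i) D.
  by rewrite (is_derive_partial D).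
by have [] := partials_is_diff (@shell_open R a b) pc sx.
Qed.

(** Test the one-sided first order condition along the outward directions [x]
    and [w x], and combine: [|w|^2 - beta^2 |x|^2] is
    [w . (w - beta x) + beta x . (w - beta x)]. *)
Lemma inner_max_speed x : shell a b x ->
  (forall d, 0 < dot x d ->
    exists2 e : R, 0 < e & forall t : R, 0 < t < e -> g (x + t *: d) <= g x) ->
  sg * dot (w x) (w x) <= sg * v (enorm x) ^+ 2.
Proof.
move=> sx gmax; have x0 := lt_trans a0 (andP sx).1.
have rr : dot x x = enorm x ^+ 2 by rewrite enorm_sqr.
have step d : 0 < dot x d -> sg * (dot (w x) d - beta (enorm x) * dot x d) <= 0.
  move=> /gmax[e e0 eP]; have := gap_step sx e0 eP.
  by rewrite dotC /G dotZl dotBl dotZl.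
have b0 : 0 <= beta (enorm x) by rewrite divr_ge0 // ltW // v0.
have h1 : sg * (dot (w x) (w x) - beta (enorm x) * dot x (w x)) <= 0.
  by apply: step; rewrite dotC; exact: outgoing.
have h2 : sg * (dot (w x) x - beta (enorm x) * dot x x) <= 0.
  by apply: step; rewrite rr exprn_gt0.
have h3 := ler_wpM2l b0 h2; rewrite mulr0 in h3.
have vE : v (enorm x) ^+ 2 = beta (enorm x) ^+ 2 * enorm x ^+ 2.
  by rewrite /beta; field; rewrite gt_eqF.
rewrite -subr_le0 vE -rr -[X in _ <= X]addr0; apply: le_trans (lerD h1 h3).
by rewrite [dot x (w x)]dotC le_eqVlt; apply/orP; left; apply/eqP; ring.
Qed.

(** A positive maximum of the difference is excluded inside by strictness, near
    the inner sphere by the prescribed speed, and near the outer sphere by the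
    common value.  The sign [sg] treats super- and subsolutions at once, and the
    hypotheses near the two spheres are stated inside the open shell, where the
    gradient of [phi] is known. *)
Lemma comparison : sg ^+ 2 = 1 ->
  (exists2 a' : R, a < a' & forall x, shell a b x -> enorm x < a' ->
     sg * v (enorm x) ^+ 2 < sg * dot (w x) (w x)) ->
  (forall eta : R, 0 < eta -> exists2 b' : R, b' < b & forall x, shell a b x ->
     b' < enorm x -> `|phi x - Phi (enorm x)| < eta) ->
  forall x, shell a b x -> sg * (phi x - Phi (enorm x)) <= 0.
Proof.
move=> sg1 [a' aa' inner] outer x sx; rewrite leNgt; apply/negP => gx0.
have [b' b'b outer_small] := outer _ gx0; have [ax xb] := andP sx.
pose a1 := (a + Num.min a' (enorm x)) / 2; pose b1 := (Num.max b' (enorm x) + b) / 2.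
have /andP[aa1 a1m] : (a < a1) && (a1 < Num.min a' (enorm x)).
  have : a < Num.min a' (enorm x) by rewrite lt_min aa'.
  by move=> h; rewrite midf_lt // midf_lt.
have /andP[mb1 b1b] : (Num.max b' (enorm x) < b1) && (b1 < b).
  have : Num.max b' (enorm x) < b by rewrite gt_max b'b.
  by move=> h; rewrite midf_lt // midf_lt.
move: a1m mb1; rewrite lt_min gt_max => /andP[a1a' a1x] /andP[b'b1 xb1].
have sub y : closed_shell a1 b1 y -> shell a b y.
  by move=> /andP[h1 h2]; apply/andP; split; [exact: lt_le_trans h1|exact: le_lt_trans b1b].
have cg : {within closed_shell a1 b1, continuous g}.
  apply: (@continuous_subspaceW _ _ _ _ _ sub).
  rewrite continuous_open_subspace; last exact: shell_open.
  by move=> y; rewrite inE; exact: gap_continuous.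
have ne : closed_shell a1 b1 !=set0 by exists x; apply/andP; rewrite !ltW.
have [m + mmax] := EVT_max_rV ne (@closed_shell_compact _ _ _) cg.
rewrite inE => cm; have sm := sub m cm.
have gxm : g x <= g m by apply: mmax; rewrite inE; apply/andP; rewrite !ltW.
have mb1 : enorm m < b1.
  rewrite ltNge; apply/negP => b1m.
  have := outer_small m sm (lt_le_trans b'b1 b1m).
  rewrite ltNge => /negP; apply; apply: le_trans gxm _.
  apply: le_trans (ler_norm _) _; rewrite /g normrM.
  have -> : `|sg| = 1.
    by apply/eqP; rewrite -(@eqrXn2 _ 2) // expr1n -normrX sg1 normr1.
  by rewrite mul1r.
have [a1m|ma1] := ltP a1 (enorm m).
  have sm1 : shell a1 b1 m by apply/andP.
  have [r r0 rP] := open_ball (@shell_open R a1 b1) sm1.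
  apply: (no_interior_max sm r0 sg1) => y /rP sy.
  by apply: mmax; rewrite inE; exact: shell_sub_closed.
have /inner_max_speed := sm; have := inner m sm (le_lt_trans ma1 a1a').
rewrite ltNge => /negP h /(_ _)/h; apply => d md.
have [e e0 eP] := small_step_lt d mb1; exists e => // t te.
apply: mmax; rewrite inE; apply/andP; split; last exact/ltW/eP.
apply: le_trans (_ : enorm m <= _); first by case/andP: cm.
by apply/ltW/enorm_outward => //; case/andP: te.
Qed.

End Comparison.

(** * The spherically symmetric subsonic flow *)

Section Profile.
Context {R : realType}.
Variables (gamma E1 : R).
Hypothesis gamma1 : 1 < gamma.

(** Square of the sonic speed at squared speed [q] on the energy level [E1]. *)
Definition sonic2 (q : R) : R := (gamma - 1) * (E1 - q / 2).

(** Logarithm of the mass flux density [rho v], up to an additive constant. *)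
Definition logflux (v : R) : R := ln v + (gamma - 1)^-1 * ln (E1 - v ^+ 2 / 2).

Let g1 : 0 < gamma - 1. Proof. by rewrite subr_gt0. Qed.

Definition subsonic_speed (v : R) := 0 < v /\ v ^+ 2 < sonic2 (v ^+ 2).

Lemma subsonic_energy v : subsonic_speed v -> 0 < E1 - v ^+ 2 / 2.
Proof.
move=> [v0 vc]; have : 0 < sonic2 (v ^+ 2) by apply: le_lt_trans vc; exact: sqr_ge0.
by rewrite /sonic2 pmulr_rgt0.
Qed.

Lemma subsonic_le v w : subsonic_speed w -> 0 < v -> v <= w -> subsonic_speed v.
Proof.
move=> [w0 wc] v0 vw; split => //.
have vw2 : v ^+ 2 <= w ^+ 2 by rewrite ler_pXn2r // nnegrE ltW.
apply: (le_lt_trans vw2); apply: lt_le_trans wc _.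
rewrite /sonic2; apply: (ler_wpM2l (ltW g1)); move: vw2; move: (v ^+ 2) (w ^+ 2) => p q; lra.
Qed.

Lemma der_logflux v : subsonic_speed v ->
  is_derive v (1 : R) logflux ((sonic2 (v ^+ 2) - v ^+ 2) / (v * sonic2 (v ^+ 2))).
Proof.
move=> sv; have e0 := subsonic_energy sv; have [v0 vc] := sv.
have Dq : is_derive v (1 : R) (fun v => E1 - v ^+ 2 / 2) (- v).
  apply: (is_derive_eq (derB (derC E1 _ _) (derM (derX (is_derive_id v (1:R))) (derC 2^-1 _ _)))).
  by rewrite /=; field.
have Dl := @der_comp R R (@ln R) (fun v => E1 - v ^+ 2 / 2) v 1 _ _ (is_derive1_ln e0) Dq.
apply: (is_derive_eq (derD (is_derive1_ln v0) (derM (derC (gamma - 1)^-1 _ _) Dl))).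
rewrite /sonic2; move: e0; set e := E1 - _ => e0; field.
by rewrite !gt_eqF.
Qed.

Lemma logflux_lt v w : subsonic_speed w -> 0 < v -> v < w -> logflux v < logflux w.
Proof.
move=> sw v0 vw.
have sx x : x \in `[v, w]%R -> subsonic_speed x.
  by rewrite in_itv /= => /andP[vx xw]; apply: subsonic_le xw => //; exact: lt_le_trans vx.
have D x : x \in `]v, w[%R -> is_derive x (1 : R) logflux
    ((sonic2 (x ^+ 2) - x ^+ 2) / (x * sonic2 (x ^+ 2))).
  by move=> /subset_itv_oo_cc /sx; exact: der_logflux.
have cH : {within `[v, w], continuous logflux}.
  by apply: derivable_within_continuous => x /sx /der_logflux H; exact: ex_derive.
have [c cvw] := MVT vw D cH.
have [c0 cc] := sx c (subset_itv_oo_cc cvw).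
rewrite -subr_gt0 => ->; rewrite mulr_gt0 ?subr_gt0 // divr_gt0 ?subr_gt0 // mulr_gt0 //.
by apply: le_lt_trans cc; exact: sqr_ge0.
Qed.

Lemma logflux_inj v w : subsonic_speed v -> subsonic_speed w ->
  logflux v = logflux w -> v = w.
Proof.
move=> sv sw e; have [vw|wv|//] := ltgtP v w.
- by have := logflux_lt sw sv.1 vw; rewrite e ltxx.
- by have := logflux_lt sv sw.1 wv; rewrite e ltxx.
Qed.

Variables (q0 r0 : R).
Hypotheses (r00 : 0 < r0) (sq0 : subsonic_speed q0).

(** Leaves room to continue the profile inside the inner sphere. *)
Lemma faster_subsonic : exists2 q1, q0 < q1 & subsonic_speed q1.
Proof.
have [q00 qc] := sq0.
have c0 : 0 < sonic2 (q0 ^+ 2) - q0 ^+ 2 by rewrite subr_gt0.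
pose D := (gamma + 1) * (q0 + 1).
have D0 : 0 < D by rewrite mulr_gt0 ?addr_gt0 // (lt_trans _ gamma1).
pose e := Num.min 1 ((sonic2 (q0 ^+ 2) - q0 ^+ 2) / D).
have e0 : 0 < e by rewrite lt_min ltr01 divr_gt0.
have : e <= Num.min 1 ((sonic2 (q0 ^+ 2) - q0 ^+ 2) / D) by [].
rewrite le_min => /andP[e1]; rewrite ler_pdivlMr // => eD.
exists (q0 + e); first by rewrite ltrDl.
split; first by rewrite addr_gt0.
rewrite -subr_gt0.
have -> : sonic2 ((q0 + e) ^+ 2) - (q0 + e) ^+ 2 =
    sonic2 (q0 ^+ 2) - q0 ^+ 2 - e * ((gamma + 1) * (q0 + e / 2)).
  by rewrite /sonic2; field.
rewrite subr_gt0; apply: lt_le_trans eD; rewrite ltr_pM2l // /D ltr_pM2l.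
  by rewrite ltrD2l ltr_pdivrMr // mul1r (le_lt_trans e1) // ltr1n.
by rewrite addr_gt0 // (lt_trans _ gamma1).
Qed.

(** Conservation of mass reads [logflux v + 2 ln r = const]; on the subsonic
    branch [logflux] is increasing, so the radius [T w] at which the speed is [w]
    is explicit and the profile is its inverse function.  It is defined on a ray
    starting below [r0], which spares one-sided derivatives at [r0] and allows
    small dilations of the radius. *)
Lemma profile_exists : exists (v : R -> R) (rm : R), [/\ 0 < rm, rm < r0, v r0 = q0 &
  forall r : R, rm < r -> [/\ subsonic_speed (v r),
     logflux (v r) + 2 * ln r = logflux q0 + 2 * ln r0 &
     is_derive r (1 : R) v (- (2 * sonic2 (v r ^+ 2) * v r) / (r * (sonic2 (v r ^+ 2) - v r ^+ 2)))]].
Proof.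
have [q1 q01 sq1] := faster_subsonic; have q00 := sq0.1.
pose C := logflux q0 + 2 * ln r0.
pose T w := expR ((C - logflux w) / 2).
pose v r := xget 0 [set w : R | 0 < w < q1 /\ logflux w = C - 2 * ln r].
have T_gt w : 0 < w < q1 -> T q1 < T w.
  move=> /andP[w0 wq]; rewrite ltr_expR ltr_pM2r ?invr_gt0 //.
  by rewrite ltrD2l ltrN2; exact: logflux_lt.
have Tq0 : T q0 = r0.
  rewrite /T /C addrAC subrr add0r mulrC mulKf ?lnK // ; by rewrite pnatr_eq0.
have vP r : T q1 < r -> 0 < v r < q1 /\ logflux (v r) = C - 2 * ln r.
  move=> rq; have r0' : 0 < r by apply: lt_trans rq; exact: expR_gt0.
  suff Hw : exists w : R, 0 < w < q1 /\ logflux w = C - 2 * ln r by exact: (xgetPex 0 Hw).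
  have E0 : 0 < E1.
    have := subsonic_energy sq0; rewrite subr_gt0; apply: le_lt_trans.
    by rewrite divr_ge0 ?sqr_ge0.
  (* The energy is at most [E1], so [logflux l] is below the target value as soon
     as [ln l] is small enough; [q1] gives the upper end for the intermediate
     value theorem. *)
  pose l := Num.min q0 (expR (C - 2 * ln r - (gamma - 1)^-1 * ln E1)).
  have l0 : 0 < l by rewrite lt_min q00 expR_gt0.
  have lq1 : l < q1 by rewrite gt_min q01.
  have sl : subsonic_speed l by apply: subsonic_le sq1 l0 (ltW lq1).
  have Hl : logflux l <= C - 2 * ln r.
    rewrite /logflux -lerBrDr.
    apply: (@le_trans _ _ (C - 2 * ln r - (gamma - 1)^-1 * ln E1)).
      by rewrite -[leRHS]expRK ler_ln ?posrE ?expR_gt0 // ge_min lexx orbT.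
    rewrite lerD2l lerN2 ler_wpM2l ?invr_ge0 ?(ltW g1) //.
    by rewrite ler_ln ?posrE // ?subsonic_energy // gerBl divr_ge0 ?sqr_ge0.
  have Hq1 : C - 2 * ln r < logflux q1.
    move: rq; rewrite -[X in _ < X]lnK ?posrE // ltr_expR ltr_pdivrMr //.
    by rewrite [_ * 2]mulrC ltrBlDl -ltrBlDr.
  have cH : {within `[l, q1], continuous logflux}.
    apply: derivable_within_continuous => x; rewrite in_itv /= => /andP[lx xq].
    have sx : subsonic_speed x by apply: subsonic_le sq1 _ xq; exact: lt_le_trans lx.
    by have H := der_logflux sx; exact: ex_derive.
  have [|w] := @IVT R logflux l q1 (C - 2 * ln r) (ltW lq1) cH.
    by rewrite ge_min Hl le_max (ltW Hq1) orbT.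
  rewrite in_itv /= => /andP[lw wq] Hw; exists w; split => //.
  rewrite (lt_le_trans l0 lw) lt_neqAle wq andbT.
  by apply/eqP => wE; move: Hq1; rewrite -Hw wE ltxx.
have subs r : T q1 < r -> subsonic_speed (v r).
  by move=> /vP[/andP[v0 vq] _]; apply: subsonic_le sq1 v0 (ltW vq).
exists v, (T q1); split.
- exact: expR_gt0.
- by rewrite -Tq0; apply: T_gt; rewrite q00.
- have r0q : T q1 < r0 by rewrite -Tq0; apply: T_gt; rewrite q00.
  apply: logflux_inj (subs _ r0q) sq0 _; rewrite (vP _ r0q).2 /C; ring.
- move=> r rq; have [/andP[v0 vq] Hv] := vP r rq; have sv := subs r rq.
  split => //; first by rewrite Hv /C; ring.
  have r0' : 0 < r by apply: lt_trans rq; exact: expR_gt0.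
  have TK w : 0 < w < q1 -> v (T w) = w.
    move=> w01; have Tw := T_gt w w01; have [w0 wq] := andP w01.
    apply: logflux_inj (subs _ Tw) (subsonic_le sq1 w0 (ltW wq)) _.
    by rewrite (vP _ Tw).2 /T expRK; field.
  have TvE : T (v r) = r.
    rewrite /T Hv; have -> : (C - (C - 2 * ln r)) / 2 = ln r by field.
    by rewrite lnK.
  have near_in : \forall w \near v r, 0 < w < q1.
    have vin : v r \in `]0, q1[%R by rewrite in_itv /= v0.
    by have := near_in_itvoo vin; apply: filterS => w; rewrite in_itv.
  have dT w : 0 < w < q1 -> is_derive w (1 : R) T
      (T w * (- ((sonic2 (w ^+ 2) - w ^+ 2) / (w * sonic2 (w ^+ 2))) / 2)).
    move=> /andP[w0 wq]; have sw := subsonic_le sq1 w0 (ltW wq).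
    have De := derM (derB (derC C _ _) (der_logflux sw)) (derC 2^-1 _ _).
    apply: (is_derive_eq (@der_comp R R (@expR R) (fun w => (C - logflux w) / 2) w 1 _ _
      (is_derive_expR _) De)).
    by rewrite mulr0 addr0 sub0r.
  have near1 : {near v r, cancel T v} by apply: filterS near_in => w /TK.
  have near2 : {near v r, continuous T}.
    apply: filterS near_in => w /dT D.
    by apply/differentiable_continuous/derivable1_diffP.
  have [_ vc] := sv.
  have c0 : 0 < sonic2 (v r ^+ 2) by apply: le_lt_trans vc; exact: sqr_ge0.
  have vin : 0 < v r < q1 by rewrite v0.
  have cv : 0 < sonic2 (v r ^+ 2) - v r ^+ 2 by rewrite subr_gt0.
  have ne : T (v r) * (- ((sonic2 (v r ^+ 2) - v r ^+ 2) / (v r * sonic2 (v r ^+ 2))) / 2) != 0.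
    rewrite TvE; apply: mulf_neq0; first by rewrite gt_eqF.
    rewrite mulNr oppr_eq0 gt_eqF //.
    by apply: divr_gt0 => //; apply: divr_gt0 => //; exact: mulr_gt0.
  have := is_derive_inverse near1 near2 (dT _ vin) ne.
  rewrite TvE => D; apply: (is_derive_eq D).
  by field; rewrite !gt_eqF //.
Qed.

End Profile.

(** * Rigidity of potential flows *)

Section Auxiliary.
Context {R : realType}.
Implicit Types (x d : 'rV[R]_3) (f : 'rV[R]_3 -> R).

Lemma derivative_cst_on (A : set 'rV[R]_3) f (c l : R) x d : open A -> A x ->
  (forall y, A y -> f y = c) -> is_derive x d f l -> l = 0.
Proof.
move=> oA Ax fc D.
have nf : \near x, f x = (fun=> c) x by apply: filterS (open_nbhs_nbhs (conj oA Ax)) => y /fc.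
have D2 := near_eq_is_derive nf D.
by rewrite -(@derive_val _ _ _ _ _ _ _ D2) derive_cst.
Qed.

Lemma antiderivative (v : R -> R) (m m' : R) : m < m' ->
  (forall r, m < r -> {for r, continuous v}) ->
  exists P : R -> R, forall r : R, m' < r -> is_derive r (1 : R) P (v r).
Proof.
move=> mm' cv; exists (fun r => \int[lebesgue_measure]_(t in `[m', r]) v t) => r m'r.
have rr : r < r + 1 by rewrite ltrDl.
have cvi : {within `[m', r + 1], continuous v}.
  apply: continuous_in_subspaceT => t; rewrite inE /= in_itv /= => /andP[mt _].
  by apply: cv; exact: lt_le_trans mt.
have iv : (@lebesgue_measure R).-integrable `[m', r + 1] (EFin \o v).
  by apply: continuous_compact_integrable => //; exact: segment_compact.
have [D E] := continuous_FTC1_closed rr iv m'r (cv r (lt_trans mm' m'r)).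
by apply: DeriveDef; [exact: D|rewrite -derive1E; exact: E].
Qed.

(** Uniform continuity at the inner sphere, by compactness. *)
Lemma near_inner_sphere (a b c eta : R) f : a < b ->
  {within closed_shell a b, continuous f} -> (forall x, sphere a x -> f x = c) ->
  0 < eta -> exists2 a', a < a' & forall x, shell a b x -> enorm x < a' -> `|f x - c| < eta.
Proof.
move=> ab cf fa eta0.
pose K := [set x : 'rV[R]_3 | closed_shell a b x /\ eta <= `|f x - c|].
have cK : compact K.
  apply: (subclosed_compact _ (@closed_shell_compact R a b)); last by move=> x [].
  move=> x clx.
  have cx : closed_shell a b x.
    apply: (@closed_shell_closed R a b) => U /clx[y [[cy _] Uy]]; by exists y.
  split => //; rewrite leNgt; apply/negP => fx.
  have e0 : 0 < eta - `|f x - c| by rewrite subr_gt0.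
  have [r r0 rP] := within_cont_ball cf cx e0.
  have [|y [[cy fy] ]] := clx [set y | `|y - x| < r].
    by apply/nbhs_ballP; exists r => //= y; rewrite -ball_normE /= distrC.
  move=> /= /(rP y cy) yx; move: fy; rewrite leNgt => /negP; apply.
  rewrite -(subrK (f x) (f y)) -addrA; apply: le_lt_trans (ler_normD _ _) _.
  by rewrite -ltrBrDr.
have [K0|K0] := pselect (K !=set0); last first.
  exists b => // x sx _; rewrite ltNge; apply/negP => fx; apply: K0; exists x.
  by split => //; exact: shell_sub_closed.
have [m + mmin] := EVT_min_rV K0 cK (continuous_subspaceT (@enorm_continuous R)).
rewrite inE => -[/andP[am mb] fm].
exists (enorm m).
  rewrite lt_neqAle am andbT; apply/eqP => /esym sm.
  by move: fm; rewrite fa // subrr normr0 leNgt eta0.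
move=> x sx xm; rewrite ltNge; apply/negP => fx.
have : enorm m <= enorm x.
  by apply: mmin; rewrite inE; split => //; exact: shell_sub_closed.
by rewrite leNgt xm.
Qed.

End Auxiliary.

Section Rigidity.
Context {R : realType}.
Implicit Types (x d : 'rV[R]_3).
Variables (gamma E1 q0 r0 r1 rm : R) (v : R -> R).
Hypotheses (gamma1 : 1 < gamma) (rm0 : 0 < rm) (rmr0 : rm < r0) (r01 : r0 < r1).
Let c2 := sonic2 gamma E1.
Let v' r := - (2 * c2 (v r ^+ 2) * v r) / (r * (c2 (v r ^+ 2) - v r ^+ 2)).
Hypothesis vr0 : v r0 = q0.
Hypothesis sv : forall r, rm < r -> subsonic_speed gamma E1 (v r).
Hypothesis dv : forall r : R, rm < r -> is_derive r (1 : R) v (v' r).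

Variables (w : 'rV[R]_3 -> 'rV[R]_3) (g : 'I_3 -> 'I_3 -> 'rV[R]_3 -> R).
Hypothesis Cw : forall i, C1_on (shell r0 r1) (fun x => w x 0 i).
Hypothesis cw : forall i, {within closed_shell r0 r1, continuous (fun x => w x 0 i)}.
Hypothesis cg : forall i j, {within closed_shell r0 r1, continuous (g i j)}.
Hypothesis gE : forall i j x, shell r0 r1 x -> partial j (fun x => w x 0 i) x = g i j x.
Hypothesis irr : forall i j x, shell r0 r1 x -> g i j x = g j i x.
Hypothesis normal : forall x d, sphere r1 x -> dot x d = 0 -> dot (w x) d = 0.
Hypothesis outgoing : forall x, shell r0 r1 x -> 0 < dot (w x) x.
Hypothesis pde : forall x, shell r0 r1 x ->
  c2 (dot (w x) (w x)) * (\sum_(i < 3) partial i (fun x => w x 0 i) x) =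
  \sum_(i < 3) \sum_(j < 3) w x 0 i * w x 0 j * partial j (fun x => w x 0 i) x.
Hypothesis inlet : forall x, sphere r0 x -> dot (w x) (w x) = q0 ^+ 2.

Let r00 : 0 < r0 := lt_trans rm0 rmr0.
Let r10 : 0 < r1 := lt_trans r00 r01.
Let phi := potential r1 (fun i x => w x 0 i).

Lemma dphi x d : shell r0 r1 x -> is_derive x d phi (dot (w x) d).
Proof. exact: (potential_gradient r00 r01 Cw cw cg gE irr normal). Qed.

Lemma profile_decreasing r s : rm < r -> r < s -> v s < v r.
Proof.
move=> mr rs.
have m_in t : t \in `[r, s]%R -> rm < t by rewrite in_itv /= => /andP[rt _]; exact: lt_le_trans rt.
have D t : t \in `]r, s[%R -> is_derive t (1 : R) v (v' t).
  by move=> /subset_itv_oo_cc /m_in; exact: dv.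
have cv : {within `[r, s], continuous v}.
  by apply: derivable_within_continuous => t /m_in /dv Dt; exact: ex_derive.
have [t /subset_itv_oo_cc /m_in mt] := MVT rs D cv.
rewrite -subr_lt0 => ->; rewrite pmulr_llt0 ?subr_gt0 //.
have [v0 vc] := sv mt; have c0 : 0 < c2 (v t ^+ 2) by apply: le_lt_trans vc; exact: sqr_ge0.
rewrite /v' mulNr oppr_lt0 divr_gt0 //; first by rewrite mulr_gt0 // mulr_gt0.
by rewrite mulr_gt0 ?subr_gt0 // (lt_trans rm0).
Qed.

(** A pure dilation [(1 + e) r] would give another exact solution.  The offset
    makes the ratio of the dilated radius to [r] vary, so that the equation
    becomes a strict inequality; taken as [r0 / 2], it is below every radius in
    the shell, and the radius is displaced in the direction of the sign of [e]. *)
Definition dilation (e r : R) : R := r + e * (r - r0 / 2).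

Variables (m : R) (P : R -> R).
Hypotheses (mrm : rm < m) (mr0 : m < r0).
Hypothesis dP : forall r : R, m < r -> is_derive r (1 : R) P (v r).

Let barrier (e r : R) := (P (dilation e r) - P (dilation e r1)) / (1 + e).

(** Reading the profile at the dilated radius makes it a strict super- or
    subsolution, according to the sign of the dilation; as the profile is
    decreasing, the dilation also moves its inlet speed strictly to the right
    side of [q0]. *)
Lemma barrier_comparison (sg del : R) : sg ^+ 2 = 1 -> 0 < del -> del < 1 ->
  m < (1 - del) * r0 ->
  forall x, shell r0 r1 x -> sg * (phi x - barrier (sg * del) (enorm x)) <= 0.
Proof.
move=> sg1 del0 del1 mdel.
have sgN : `|sg| = 1 by apply/eqP; rewrite -(@eqrXn2 _ 2) // expr1n -normrX sg1 normr1.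
have := lexx `|sg|; rewrite [in X in _ <= X]sgN ler_norml => /andP[sgm sgp].
set e := sg * del.
have em : - del <= e by rewrite /e -mulN1r ler_wpM2r // ltW.
have e1 : 0 < 1 + e by move: em del1; lra.
have dil r : r0 <= r -> m < dilation e r.
  move=> rr; apply: lt_le_trans mdel _; rewrite /dilation.
  have h1 : - del * (r - r0 / 2) <= e * (r - r0 / 2).
    by rewrite ler_wpM2r //; move: rr r00; lra.
  have h2 : (1 - del) * r0 <= (1 - del) * r by rewrite ler_wpM2l // subr_ge0 ltW.
  have h3 : 0 <= del * r0 by rewrite mulr_ge0 // ltW.
  by move: h1 h2 h3; rewrite !mulrBl !mulNr !mulrBr !mul1r; lra.
have mdil r : r0 <= r -> rm < dilation e r by move=> /dil; exact: lt_trans.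
have Ddil r : is_derive r (1 : R) (dilation e) (1 + e).
  apply: (is_derive_eq (derD (is_derive_id r _) (derM (derC e _ _)
    (derB (is_derive_id r _) (derC (r0 / 2) _ _))))).
  by rewrite mul0r add0r subr0 mulr1.
have DP r : r0 <= r -> is_derive r (1 : R) (fun r => P (dilation e r)) (v (dilation e r) * (1 + e)).
  by move=> rr; exact: (@der_comp R R P (dilation e) r 1 _ _ (dP (dil r rr)) (Ddil r)).
have dPhi r : r0 < r < r1 -> is_derive r (1 : R) (barrier e) (v (dilation e r)).
  move=> /andP[/ltW rr _].
  apply: (is_derive_eq (derM (derB (DP r rr) (derC (P (dilation e r1)) _ _)) (derC (1 + e)^-1 _ _))).
  by field; rewrite gt_eqF.
have dve r : r0 <= r -> is_derive r (1 : R) (fun r => v (dilation e r)) (v' (dilation e r) * (1 + e)).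
  by move=> rr; exact: (@der_comp R R v (dilation e) r 1 _ _ (dv (mdil r rr)) (Ddil r)).
apply: (@comparison R r0 r1 w phi c2 (barrier e) (fun r => v (dilation e r))
  (fun r => v' (dilation e r) * (1 + e)) sg r00) => //.
- exact: dphi.
- by move=> r /andP[/ltW rr _]; exact: dve.
- by move=> r /andP[/ltW rr _]; have [] := sv (mdil r rr).
- by move=> r /andP[/ltW rr _]; have [] := sv (mdil r rr).
- move=> r /andP[/ltW rr _]; have [v0 vc] := sv (mdil r rr).
  have th0 : 0 < dilation e r by apply: lt_trans (mdil r rr).
  have rp : 0 < r by apply: lt_le_trans rr.
  have c0 : 0 < c2 (v (dilation e r) ^+ 2) by apply: le_lt_trans vc; exact: sqr_ge0.
  have cv : 0 < c2 (v (dilation e r) ^+ 2) - v (dilation e r) ^+ 2 by rewrite subr_gt0.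
  have thE : dilation e r - (1 + e) * r = - e * (r0 / 2) by rewrite /dilation; ring.
  rewrite /v'; move: (dilation e r) (v _) (c2 _) v0 th0 c0 cv thE => th V C V0 th0 C0 CV thE.
  have -> : sg * ((C - V ^+ 2) * (- (2 * C * V) / (th * (C - V ^+ 2)) * (1 + e)) + 2 * C * V / r)
     = - (2 * C * V / (r * th)) * (sg ^+ 2 * del * (r0 / 2)).
    transitivity (sg * (2 * C * V / (r * th)) * (th - (1 + e) * r)).
      by field; rewrite !gt_eqF.
    by rewrite thE /e; ring.
  rewrite sg1 mul1r mulNr oppr_lt0 mulr_gt0 //; last by rewrite mulr_gt0 // divr_gt0.
  by rewrite divr_gt0 // mulr_gt0 // mulr_gt0.
- have V0 := (sv (mdil r0 (lexx r0))).1.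
  pose V := v (dilation e r0).
  have gap : 0 < sg * (q0 ^+ 2 - V ^+ 2).
    have q00 : 0 < q0 by rewrite -vr0; have [] := sv rmr0.
    have half : dilation e r0 - r0 = e * (r0 / 2) by rewrite /dilation; field.
    have rh : 0 < r0 / 2 by rewrite divr_gt0.
    move: sg1 => /eqP; rewrite sqrf_eq1 => /orP[/eqP sgE|/eqP sgE]; rewrite sgE.
      rewrite mul1r subr_gt0 ltr_pXn2r // ?nnegrE ?(ltW q00) ?(ltW V0) //.
      rewrite -vr0; apply: profile_decreasing => //.
      by rewrite -subr_gt0 half mulr_gt0 // /e sgE mul1r.
    rewrite mulN1r oppr_gt0 subr_lt0 ltr_pXn2r // ?nnegrE ?(ltW q00) ?(ltW V0) //.
    rewrite -vr0; apply: profile_decreasing; first exact: mdil.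
    by rewrite -subr_gt0 -opprB half oppr_gt0 pmulr_llt0 // /e sgE mulN1r oppr_lt0.
  have gap2 : 0 < sg * (q0 ^+ 2 - V ^+ 2) / 2 by rewrite divr_gt0.
  have cww : {within closed_shell r0 r1, continuous (fun x => dot (w x) (w x))}.
    have E : (fun x => dot (w x) (w x)) = fun x => w x 0 0 * w x 0 0 + w x 0 1 * w x 0 1 +
       w x 0 2 * w x 0 2 by apply/funext => y; rewrite dotE.
    by rewrite E; apply: wcD; [apply: wcD|]; apply: wcM; exact: cw.
  have [a2 ra2 a2P] := near_inner_sphere r01 cww inlet gap2.
  have cV : {for r0, continuous (fun r => v (dilation e r) ^+ 2)}.
    apply: ctX; have D := dve r0 (lexx r0).
    by apply/differentiable_continuous/derivable1_diffP.
  have := cV; move/cvgrPdist_lt => /(_ _ gap2) /nbhs_ballP[del1' /= del10 del1P].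
  exists (Num.min a2 (r0 + del1')); first by rewrite lt_min ra2 ltrDl.
  move=> x sx; rewrite lt_min => /andP[/(a2P _ sx) xa2 xdel]; have [xr0 _] := andP sx.
  have := del1P (enorm x); rewrite -ball_normE /= distrC gtr0_norm ?subr_gt0 // ltrBlDl.
  move=> /(_ xdel) h; move: xa2 h gap.
  rewrite -/V; move: (v _ ^+ 2) (dot _ _) (q0 ^+ 2) (V ^+ 2) => A B Q W.
  have bnd (z c : R) : `|z| < c -> sg * z < c.
    by move=> zc; apply: le_lt_trans (ler_norm _) _; rewrite normrM sgN mul1r.
  rewrite [`|B - Q|]distrC => /bnd h1 ; rewrite distrC => /bnd h2 _.
  move: h1 h2; rewrite !mulrBr; move: (sg * A) (sg * B) (sg * Q) (sg * W) => sA sB sQ sW; lra.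
- move=> eta eta0.
  have [M HM] := potential_bound r00 r01 cw.
  have eta2 : 0 < eta / 2 by rewrite divr_gt0.
  have cb : {for r1, continuous (barrier e)}.
    have D := DP r1 (ltW r01).
    apply: ctM; last exact: ctC.
    apply: ctB; last exact: ctC.
    by apply/differentiable_continuous/derivable1_diffP.
  have b1 : barrier e r1 = 0 by rewrite /barrier subrr mul0r.
  have := cb; move/cvgrPdist_lt => /(_ _ eta2) /nbhs_ballP[del2 /= del20 del2P].
  have M1 : 0 < `|M| + 1 by rewrite ltr_wpDl.
  pose k := Num.min del2 (eta / 2 / (`|M| + 1)).
  have k0 : 0 < k by rewrite lt_min del20 divr_gt0.
  exists (r1 - k); first by rewrite gtrBl.
  move=> x sx; have [_ xr1] := andP sx; rewrite ltrBlDr addrC -ltrBlDr => xk.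
  have : r1 - enorm x < k by move: xk; lra.
  rewrite lt_min => /andP[xd xM].
  have h1 := del2P (enorm x); rewrite -ball_normE /= gtr0_norm ?subr_gt0 // in h1.
  have {}h1 := h1 xd; rewrite b1 sub0r normrN in h1.
  apply: le_lt_trans (ler_normB _ _) _; rewrite [ltRHS]splitr; apply: ltrD h1.
  apply: le_lt_trans (HM x sx) _; move: xM; rewrite ltr_pdivlMr //; apply: le_lt_trans.
  rewrite [leRHS]mulrC ler_wpM2r ?subr_ge0 ?(ltW xr1) //.
  by apply: le_trans (ler_norm _) _; rewrite lerDl.
Qed.

(** Let the dilation tend to the identity, from both sides. *)
Lemma potential_unique x : shell r0 r1 x -> phi x = P (enorm x) - P r1.
Proof.
move=> sx; have rx := (andP sx).1.
suff H sg : sg ^+ 2 = 1 -> sg * (phi x - (P (enorm x) - P r1)) <= 0.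
  have h1 := H 1 (expr1n _ _); have h2 := H (-1) (etrans (sqrrN 1) (expr1n _ _)).
  by apply/eqP; rewrite -subr_eq0 eq_le; move: h1 h2; rewrite mul1r mulN1r oppr_le0 => -> ->.
move=> sg1; rewrite leNgt; apply/negP => gap.
have sgN : `|sg| = 1 by apply/eqP; rewrite -(@eqrXn2 _ 2) // expr1n -normrX sg1 normr1.
have dil0 r : dilation 0 r = r by rewrite /dilation mul0r addr0.
have cdil r : {for 0, continuous (dilation^~ r)}.
  by apply: ctD; [exact: ctC|apply: ctM; [exact: cvg_id|exact: ctC]].
have cP r : m < r -> {for 0, continuous (fun e => P (dilation e r))}.
  move=> mr; apply: (@ct_comp R R R (dilation^~ r) P 0 _ (cdil r)).
  by rewrite dil0; have D := dP mr; apply/differentiable_continuous/derivable1_diffP.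
have cb : {for 0, continuous (barrier^~ (enorm x))}.
  apply: ctF; first by rewrite addr0 oner_neq0.
  - apply: ctB; apply: cP; [exact: lt_trans rx|exact: lt_trans r01].
  - by apply: ctD; [exact: ctC|exact: cvg_id].
have b0 : barrier 0 (enorm x) = P (enorm x) - P r1 by rewrite /barrier !dil0 addr0 divr1.
have := cb; move/cvgrPdist_lt => /(_ _ gap) /nbhs_ballP[d /= d0 dP'].
have z0 : 0 < 1 - m / r0 by rewrite subr_gt0 ltr_pdivrMr // mul1r.
pose del := Num.min d (Num.min 1 (1 - m / r0)) / 2.
have n0 : 0 < Num.min d (Num.min 1 (1 - m / r0)) by rewrite !lt_min d0 ltr01.
have del0 : 0 < del by rewrite divr_gt0.
have : del < Num.min d (Num.min 1 (1 - m / r0)).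
  by rewrite /del ltr_pdivrMr // ltr_pMr // ltr1n.
rewrite !lt_min => /and3P[deld del1 delm].
have mdel : m < (1 - del) * r0 by move: delm; rewrite ltrBrDl -ltrBrDr ltr_pdivrMr.
have B := barrier_comparison sg1 del0 del1 mdel sx.
have := dP' (sg * del); rewrite -ball_normE /= sub0r normrN normrM sgN mul1r gtr0_norm //.
move=> /(_ deld); rewrite b0 => h.
have : sg * (barrier (sg * del) (enorm x) - (P (enorm x) - P r1)) <
     sg * (phi x - (P (enorm x) - P r1)).
  by apply: le_lt_trans (ler_norm _) _; rewrite normrM sgN mul1r distrC.
move: B; rewrite !mulrBr.
move: (sg * _) (sg * _) (sg * _) (sg * _) => A1 A2 A3 A4; lra.
Qed.

Lemma velocity_radial_interior x : shell r0 r1 x -> w x = (v (enorm x) / enorm x) *: x.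
Proof.
move=> sx; have rx := (andP sx).1; have x0 := lt_trans r00 rx.
have H d : dot (w x) d - v (enorm x) * (dot d x / enorm x) = 0.
  have D := derB (dphi d sx) (@der_comp R _ P (@enorm R) x d _ _ (dP (lt_trans mr0 rx)) (der_enorm d x0)).
  apply: (derivative_cst_on (c := - P r1) (@shell_open R r0 r1) sx _ D) => y /potential_unique ->.
  by ring.
apply/rowP => i; have := H (basis R i).
rewrite [dot (w x) _]dotC !dot_basis.
by move=> /eqP; rewrite subr_eq0 mxE => /eqP ->; field; rewrite gt_eqF.
Qed.

End Rigidity.

(** * Closure properties of the classes C^1 and C^2 *)

Section C1Closure.
Context {R : realType}.
Implicit Types (A : set 'rV[R]_3) (f h : 'rV[R]_3 -> R).

Lemma C1_onI A f (df : 'I_3 -> 'rV[R]_3 -> R) : open A ->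
  (forall i x, A x -> is_derive x (basis R i) f (df i x)) ->
  (forall i, {within A, continuous (df i)}) -> C1_on A f.
Proof.
move=> oA D cdf.
have pf i : (forall x, A x -> derivable f x (basis R i)) /\ {within A, continuous (partial i f)}.
  split=> [x Ax|]; first by have Dx := D i x Ax; exact: ex_derive.
  apply: eq_within (cdf i) _ => x Ax; have Dx := D i x Ax.
  by rewrite (is_derive_partial Dx).
split; last exact: pf.
rewrite continuous_open_subspace // => x; rewrite inE => Ax.
by apply: differentiable_continuous; have [] := partials_is_diff oA pf Ax.
Qed.

Lemma C1_on_eq A f h : open A -> (forall x, A x -> f x = h x) -> C1_on A f -> C1_on A h.
Proof.
move=> oA fh Cf.
apply: (@C1_onI A h (fun i => partial i f) oA); last by move=> i; exact: (Cf.2 i).2.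
move=> i x Ax.
have nf : \near x, f x = h x by apply: filterS (open_nbhs_nbhs (conj oA Ax)) => y /fh.
exact: near_eq_is_derive nf (C1_partial i Cf Ax).
Qed.

Lemma partial_eq_on A f h i x : open A -> (forall x, A x -> f x = h x) -> A x ->
  partial i f x = partial i h x.
Proof.
move=> oA fh Ax.
have nf : \near x, f x = h x by apply: filterS (open_nbhs_nbhs (conj oA Ax)) => y /fh.
exact: near_eq_derive nf.
Qed.

Lemma C1_onC A (c : R) : open A -> C1_on A (fun=> c).
Proof.
move=> oA; apply: (@C1_onI A _ (fun _ _ => 0) oA (fun i x _ => derC c x _)) => i.
exact: wcC.
Qed.

Lemma C1_on_coord A i : open A -> C1_on A (fun x => x 0 i).
Proof.
move=> oA; apply: (@C1_onI A _ (fun j _ => basis R j 0 i) oA (fun j x _ => der_coord x _ i)) => j.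
exact: wcC.
Qed.

Lemma C1_onD A f h : open A -> C1_on A f -> C1_on A h -> C1_on A (fun x => f x + h x).
Proof.
move=> oA Cf Ch; apply: (@C1_onI A _ (fun i x => partial i f x + partial i h x) oA) => [i x Ax|i].
  exact: derD (C1_partial i Cf Ax) (C1_partial i Ch Ax).
exact: wcD (Cf.2 i).2 (Ch.2 i).2.
Qed.

Lemma C1_onM A f h : open A -> C1_on A f -> C1_on A h -> C1_on A (fun x => f x * h x).
Proof.
move=> oA Cf Ch.
apply: (@C1_onI A _ (fun i x => partial i f x * h x + f x * partial i h x) oA) => [i x Ax|i].
  exact: derM (C1_partial i Cf Ax) (C1_partial i Ch Ax).
apply: wcD; apply: wcM; [exact: (Cf.2 i).2|exact: Ch.1|exact: Cf.1|exact: (Ch.2 i).2].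
Qed.

Lemma C1_onN A f : open A -> C1_on A f -> C1_on A (fun x => - f x).
Proof.
move=> oA Cf; apply: (@C1_onI A _ (fun i x => - partial i f x) oA) => [i x Ax|i].
  exact: derN (C1_partial i Cf Ax).
exact: wcN (Cf.2 i).2.
Qed.

Lemma C1_onB A f h : open A -> C1_on A f -> C1_on A h -> C1_on A (fun x => f x - h x).
Proof. by move=> oA Cf Ch; exact: C1_onD oA Cf (C1_onN oA Ch). Qed.

Lemma C1_onV A f : open A -> (forall x, A x -> f x != 0) -> C1_on A f ->
  C1_on A (fun x => (f x)^-1).
Proof.
move=> oA f0 Cf.
apply: (@C1_onI A _ (fun i x => - partial i f x / (f x * f x)) oA) => [i x Ax|i].
  apply: (is_derive_eq (derV (f0 x Ax) (C1_partial i Cf Ax))); by rewrite expr2.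
apply: wcF; [by move=> x Ax; rewrite mulf_neq0 // f0|exact: wcN (Cf.2 i).2|].
exact: wcM Cf.1 Cf.1.
Qed.

Lemma C1_onF A f h : open A -> (forall x, A x -> h x != 0) -> C1_on A f -> C1_on A h ->
  C1_on A (fun x => f x / h x).
Proof. by move=> oA h0 Cf Ch; exact: C1_onM oA Cf (C1_onV oA h0 Ch). Qed.

Lemma C2_onI A f (df : 'I_3 -> 'rV[R]_3 -> R) : open A ->
  (forall i x, A x -> is_derive x (basis R i) f (df i x)) ->
  (forall i, C1_on A (df i)) -> C2_on A f.
Proof.
move=> oA D Cdf; split; first exact: C1_onI oA D (fun i => (Cdf i).1).
move=> i; apply: (C1_on_eq oA _ (Cdf i)) => x Ax; have Dx := D i x Ax.
by rewrite (is_derive_partial Dx).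
Qed.

Lemma C2_on_eq A f h : open A -> (forall x, A x -> f x = h x) -> C2_on A f -> C2_on A h.
Proof.
move=> oA fh [Cf Cpf]; split; first exact: C1_on_eq oA fh Cf.
by move=> i; apply: (C1_on_eq oA _ (Cpf i)) => x Ax; exact: partial_eq_on oA fh Ax.
Qed.

Lemma C2_onC A (c : R) : open A -> C2_on A (fun=> c).
Proof.
move=> oA; apply: (@C2_onI A _ (fun _ _ => 0) oA (fun i x _ => derC c x _)) => i.
exact: C1_onC.
Qed.

Lemma C2_on_coord A i : open A -> C2_on A (fun x => x 0 i).
Proof.
move=> oA; apply: (@C2_onI A _ (fun j _ => basis R j 0 i) oA (fun j x _ => der_coord x _ i)) => j.
exact: C1_onC.
Qed.

Lemma C2_onM A f h : open A -> C2_on A f -> C2_on A h -> C2_on A (fun x => f x * h x).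
Proof.
move=> oA [Cf Cpf] [Ch Cph].
apply: (@C2_onI A _ (fun i x => partial i f x * h x + f x * partial i h x) oA) => [i x Ax|i].
  exact: derM (C1_partial i Cf Ax) (C1_partial i Ch Ax).
by apply: (C1_onD oA); apply: (C1_onM oA).
Qed.

Lemma C1_on_sub A (B : set 'rV[R]_3) f : open A -> open B -> B `<=` A -> C1_on A f -> C1_on B f.
Proof.
move=> oA oB BA Cf; apply: (@C1_onI B f (fun i => partial i f) oB) => [i x /BA Ax|i].
  exact: C1_partial Cf Ax.
exact: continuous_subspaceW BA (Cf.2 i).2.
Qed.

Lemma C2_on_sub A (B : set 'rV[R]_3) f : open A -> open B -> B `<=` A -> C2_on A f -> C2_on B f.
Proof.
move=> oA oB BA [Cf Cpf]; split; first exact: C1_on_sub oA oB BA Cf.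
by move=> i; exact: C1_on_sub oA oB BA (Cpf i).
Qed.

End C1Closure.

(** * Vorticity *)

Section Vorticity.
Context {R : realType}.
Implicit Types (x d : 'rV[R]_3).

(** Vorticity vector of a field with velocity gradient [J i j = d_j u_i]; the
    indices are added modulo 3. *)
Definition vorticity (J : 'I_3 -> 'I_3 -> R) (k : 'I_3) : R :=
  J (k + 2) (k + 1) - J (k + 1) (k + 2).

Lemma vorticityE J : [/\ vorticity J 0 = J 2 1 - J 1 2, vorticity J 1 = J 0 2 - J 2 0 &
  vorticity J 2 = J 1 0 - J 0 1].
Proof.
by rewrite /vorticity; split; congr (J _ _ - J _ _); apply/val_inj.
Qed.

Variables (a b : R) (u : 'I_3 -> 'rV[R]_3 -> R) (g : 'I_3 -> 'I_3 -> 'rV[R]_3 -> R).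
Hypotheses (a0 : 0 < a) (ab : a < b).
Hypothesis Cu : forall i, C1_on (shell a b) (u i).
Hypothesis cu : forall i, {within closed_shell a b, continuous (u i)}.
Hypothesis cg : forall i j, {within closed_shell a b, continuous (g i j)}.
Hypothesis gE : forall i j x, shell a b x -> partial j (u i) x = g i j x.
Hypothesis parallel : forall i j x, sphere b x -> u i x * x 0 j = u j x * x 0 i.

Lemma wc_coord (A : set 'rV[R]_3) i : {within A, continuous (fun x => x 0 i)}.
Proof. by apply: continuous_subspaceT; exact: coord_continuous. Qed.

(** The moment (cross product of [u] and [x]) vanishes on the sphere, hence so do
    its tangential derivatives, and the normal vorticity is a combination of
    these. *)
Lemma normal_vorticity0 x : sphere b x ->
  \sum_(k < 3) vorticity (fun i j => g i j x) k * x 0 k = 0.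
Proof.
move=> sx.
pose f i j y := u i y * y 0 j - u j y * y 0 i.
pose h i j k y := g i k y * y 0 j + u i y * basis R k 0 j - (g j k y * y 0 i + u j y * basis R k 0 i).
have T i j d : dot x d = 0 -> \sum_(k < 3) d 0 k * h i j k x = 0.
  apply: (@boundary_tangential R a b (f i j) (h i j) x d a0 ab) => //.
  - apply: C1_onB; [exact: shell_open|..]; apply: C1_onM;
      by [exact: shell_open|exact: Cu|apply: C1_on_coord; exact: shell_open].
  - by apply: wcB; apply: wcM; (exact: cu || exact: wc_coord).
  - by move=> k; apply: wcB; apply: wcD; apply: wcM; (exact: cg || exact: cu || exact: wc_coord || exact: wcC).
  - move=> k y sy; apply: is_derive_partial; rewrite /h -(gE i k sy) -(gE j k sy).
    exact: derB (derM (C1_partial k (@Cu i) sy) (der_coord y (basis R k) j))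
      (derM (C1_partial k (@Cu j) sy) (der_coord y (basis R k) i)).
  - by move=> y sy; rewrite /f (parallel i j sy) subrr.
(* Multiples of the projections of the coordinate directions to the tangent
   plane. *)
pose D k : 'rV[R]_3 := dot x x *: basis R k - x 0 k *: x.
have xD k : dot x (D k) = 0.
  rewrite /D dotC dotBl !dotZl.
  by rewrite dot_basis mulrC subrr.
have := T 1 2 (D 0) (xD 0); have := T 2 0 (D 1) (xD 1); have := T 0 1 (D 2) (xD 2).
have xx : dot x x != 0 by rewrite -enorm_sqr sx expf_neq0 // gt_eqF // (lt_trans a0).
rewrite !sum3 /D /h !mxE !eqxx /=; have [-> -> ->] := vorticityE (fun i j => g i j x).
move=> h2 h1 h0; apply: (mulfI xx); rewrite mulr0.
have sum0 (L p q r : R) : p = 0 -> q = 0 -> r = 0 -> L = p + q + r -> L = 0.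
  by move=> -> -> -> ->; rewrite !addr0.
apply: (sum0 _ _ _ _ h0 h1 h2); rewrite !dotE.
move: (g _ _ _) (g _ _ _) (g _ _ _) (g _ _ _) (g _ _ _) (g _ _ _).
by move: (x 0 0) (x 0 1) (x 0 2) => *; ring.
Qed.

End Vorticity.

(** * Pointwise consequences of the Euler equations *)

Section EulerAlgebra.
Context {R : realType}.
Implicit Types (J : 'I_3 -> 'I_3 -> R) (u dp dr : 'I_3 -> R).

(** Energy equation minus [u] times the momentum equation; the bracket is the
    gradient of [ln (p / rho^gamma)], the entropy up to a factor and a constant. *)
Lemma entropy_transport_algebra J u dp dr (gamma p r : R) :
  1 < gamma -> 0 < p -> 0 < r ->
  (forall i, \sum_(j < 3) r * u j * J i j + dp i = 0) ->
  \sum_(j < 3) u j * (\sum_(i < 3) u i * J i j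
    + gamma / (gamma - 1) * ((dp j * r - p * dr j) / r ^+ 2)) = 0 ->
  \sum_(j < 3) u j * (dp j / p - gamma * (dr j / r)) = 0.
Proof.
move=> g1 p0 r0 mom; have := mom 2; have := mom 1; have := mom 0; rewrite !sum3.
move: (J _ _) (J _ _) (J _ _) (J _ _) (J _ _) (J _ _) (J _ _) (J _ _) (J _ _).
move=> J1 J2 J3 J4 J5 J6 J7 J8 J9 m0 m1 m2 en.
have comb (L N M0 M1 M2 k c : R) : M0 = 0 -> M1 = 0 -> M2 = 0 -> N = 0 ->
  L = k * N - c * (u 0 * M0 + u 1 * M1 + u 2 * M2) -> L = 0.
  by move=> -> -> -> -> ->; ring.
apply: (comb _ _ _ _ _ ((gamma - 1) * r / p) ((gamma - 1) / p) m0 m1 m2 en).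
by field; rewrite !gt_eqF // subr_gt0.
Qed.

(** Crocco's theorem for constant energy and entropy: the velocity is parallel
    to its vorticity. *)
Lemma crocco_algebra J u dp dr (gamma p r : R) j :
  1 < gamma -> 0 < p -> 0 < r ->
  \sum_(k < 3) r * u k * J j k + dp j = 0 ->
  \sum_(i < 3) u i * J i j + gamma / (gamma - 1) * ((dp j * r - p * dr j) / r ^+ 2) = 0 ->
  dp j / p - gamma * (dr j / r) = 0 ->
  \sum_(k < 3) u k * (J k j - J j k) = 0.
Proof.
move=> g1 p0 r0 mom en ent.
transitivity (\sum_(i < 3) u i * J i j + gamma / (gamma - 1) * ((dp j * r - p * dr j) / r ^+ 2)
  - r^-1 * (\sum_(k < 3) r * u k * J j k + dp j)
  - p / ((gamma - 1) * r) * (dp j / p - gamma * (dr j / r))).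
  by rewrite !sum3; field; rewrite !gt_eqF // subr_gt0.
by rewrite mom en ent !mulr0 !subr0.
Qed.

(** With constant entropy [dp = c^2 d rho], so the density drops out of mass and
    momentum. *)
Lemma sonic_equation_algebra J u dp dr (gamma p r : R) :
  1 < gamma -> 0 < p -> 0 < r ->
  \sum_(j < 3) (dr j * u j + r * J j j) = 0 ->
  (forall i, \sum_(j < 3) r * u j * J i j + dp i = 0) ->
  (forall j, dp j / p - gamma * (dr j / r) = 0) ->
  gamma * p / r * (\sum_(i < 3) J i i) = \sum_(i < 3) \sum_(j < 3) u i * u j * J i j.
Proof.
move=> g1 p0 r0 mass mom ent; apply/eqP; rewrite -subr_eq0; apply/eqP.
have g0 : 0 < gamma by apply: lt_trans g1.
transitivity (gamma * p / r ^+ 2 * (\sum_(j < 3) (dr j * u j + r * J j j))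
  - r^-1 * (\sum_(i < 3) u i * (\sum_(j < 3) r * u j * J i j + dp i))
  + p / r * (\sum_(j < 3) u j * (dp j / p - gamma * (dr j / r)))).
  by rewrite !sum3; field; rewrite !gt_eqF.
rewrite mass mulr0 sub0r big1 => [|i _]; last by rewrite mom mulr0.
by rewrite mulr0 oppr0 add0r big1 ?mulr0 // => j _; rewrite ent mulr0.
Qed.

(** Expand the double product [(u ^ W) ^ x = (u . x) W - (W . x) u] for the
    vorticity [W].  The factor [r] will be the density, so that [W] is compared
    with the mass flux. *)
Lemma vorticity_parallel J u (x : 'I_3 -> R) (r : R) :
  r != 0 -> \sum_(i < 3) u i * x i != 0 ->
  (forall j, \sum_(k < 3) u k * (J k j - J j k) = 0) ->
  forall k, vorticity J k =
    (\sum_(i < 3) vorticity J i * x i) / (r * (\sum_(i < 3) u i * x i)) * (r * u k).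
Proof.
move=> r0; rewrite !sum3 => ux cr; have := cr 0; have := cr 1; have := cr 2.
rewrite !sum3; have [-> -> ->] := vorticityE J => c2 c1 c0.
have key (W N U c : R) : U != 0 -> U * W = N * c -> W = N / (r * U) * (r * c).
  by move=> U0 E; rewrite -[LHS](mulKf U0) E; field; rewrite U0.
have sub0 (L M p q p1 q1 : R) : p = 0 -> q = 0 -> L - M = p1 * p + q1 * q -> L = M.
  by move=> -> -> E; apply/eqP; rewrite -subr_eq0 E !mulr0 addr0.
apply: ord3P; have [E0 E1 E2] := vorticityE J; rewrite ?E0 ?E1 ?E2; apply: key => //.
- by apply: (sub0 _ _ _ _ (- x 1) (x 2) c2 c1); ring.
- by apply: (sub0 _ _ _ _ (x 0) (- x 2) c2 c0); ring.
- by apply: (sub0 _ _ _ _ (x 1) (- x 0) c0 c1); ring.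
Qed.

End EulerAlgebra.

(** * From the Euler system to an irrotational flow *)

Section Admissible.
Context {R : realType}.
Implicit Types (x d : 'rV[R]_3).
Variables (gamma k0 cnu r0 r1 p0 E1 s1 : R) (V : flow R).
Hypotheses (gamma1 : 1 < gamma) (k00 : 0 < k0) (cnu0 : 0 < cnu) (r00 : 0 < r0) (r01 : r0 < r1).
Hypothesis adm : admissible_solution gamma k0 cnu r0 r1 p0 E1 s1 V.

Local Notation S := (shell r0 r1).
Local Notation cS := (closed_shell r0 r1).
Let u i x := velocity V x 0 i.
Let rho := density V.
Let p := pressure V.
Let s := entropy V.
Let J x i j := partial j (u i) x.
Let oS : open (S : set 'rV[R]_3) := @shell_open R r0 r1.
Let g0 : 0 < gamma := lt_trans ltr01 gamma1.

Lemma adm_gas x : cS x -> gas_state gamma k0 cnu V x.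
Proof. by move=> cx; have [[+ _ _ _] _ _] := adm; apply; rewrite inE. Qed.

Lemma adm_p x : cS x -> 0 < p x. Proof. by move=> /adm_gas[]. Qed.
Lemma adm_rho x : cS x -> 0 < rho x. Proof. by move=> /adm_gas[]. Qed.

Lemma adm_C2u i : C2_on S (u i).
Proof. have [_ [H _ _ _] _] := adm; exact: (H i).1. Qed.

Lemma adm_cu i : {within cS, continuous (u i)}.
Proof. have [_ [H _ _ _] _] := adm; have [_ [_ c _]] := H i; exact: c. Qed.

Lemma adm_C2 : [/\ C2_on S p, C2_on S rho & C2_on S s].
Proof. have [_ [_ [cp _] [cr _] [cs _]] _] := adm; split; [exact: cp|exact: cr|exact: cs]. Qed.

Lemma adm_c : [/\ {within cS, continuous p}, {within cS, continuous rho} & {within cS, continuous s}].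
Proof.
have [_ [_ [_ [_ cp _]] [_ [_ cr _]] [_ [_ cs _]]] _] := adm.
split; [exact: cp|exact: cr|exact: cs].
Qed.

(** The velocity gradient extends to the closed shell; the extensions are chosen
    once for all pairs of indices. *)
Lemma adm_extension : exists g : 'I_3 -> 'I_3 -> 'rV[R]_3 -> R,
  (forall i j, {within cS, continuous (g i j)}) /\ (forall i j x, S x -> J x i j = g i j x).
Proof.
have ext i j : exists h : 'rV[R]_3 -> R, {within cS, continuous h} /\ forall x, S x -> J x i j = h x.
  have [_ [H _ _ _] _] := adm; have [_ [_ _ /(_ j)[h ch hE]]] := H i.
  exists h; split; [exact: ch|move=> x Sx; apply: hE; rewrite inE; exact: Sx].
have [g gP] := choice (fun ij : 'I_3 * 'I_3 => ext ij.1 ij.2).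
exists (fun i j => g (i, j)); split => i j; first exact: (gP (i, j)).1.
exact: (gP (i, j)).2.
Qed.

Lemma adm_outgoing x : cS x -> 0 < dot (velocity V x) x.
Proof.
move=> cx; have [_ _ /(_ x)] := adm; rewrite inE => /(_ cx).
rewrite pmulr_rgt0; last exact: adm_rho.
have x0 : 0 < enorm x by case/andP: cx => h _; exact: lt_le_trans h.
by rewrite /normal_velocity pmulr_lgt0 // invr_gt0.
Qed.

Lemma adm_euler x : S x -> euler gamma V x.
Proof. by move=> Sx; have [[_ + _ _] _ _] := adm; apply; rewrite inE. Qed.

Let rj x j := partial j rho x.
Let pj x j := partial j p x.

Lemma Dp x j : S x -> is_derive x (basis R j) p (pj x j).
Proof. by move=> Sx; have [[C _] _ _] := adm_C2; exact: C1_partial C Sx. Qed.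
Lemma Drho x j : S x -> is_derive x (basis R j) rho (rj x j).
Proof. by move=> Sx; have [_ [C _] _] := adm_C2; exact: C1_partial C Sx. Qed.
Lemma Du x i j : S x -> is_derive x (basis R j) (u i) (J x i j).
Proof. by move=> Sx; exact: C1_partial (adm_C2u i).1 Sx. Qed.

Lemma divergence_scale (f : 'rV[R]_3 -> R) (df : 'I_3 -> R) x : S x ->
  (forall j, is_derive x (basis R j) f (df j)) ->
  divergence (fun y => f y *: velocity V y) x = \sum_(j < 3) (df j * u j x + f x * J x j j).
Proof.
move=> Sx D; apply: eq_bigr => j _.
have -> : (fun y => (f y *: velocity V y) 0 j) = fun y => f y * u j y.
  by apply/funext => y; rewrite mxE.
exact: is_derive_partial (derM (D j) (Du j j Sx)).
Qed.

Lemma adm_mass x : S x -> \sum_(j < 3) (rj x j * u j x + rho x * J x j j) = 0.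
Proof.
move=> Sx; have [_ E _] := adm_euler Sx.
by rewrite -[RHS]E; apply: esym; exact: divergence_scale Sx (fun j => Drho j Sx).
Qed.

Lemma adm_momentum x i : S x -> \sum_(j < 3) rho x * u j x * J x i j + pj x i = 0.
Proof.
move=> Sx; have [/(_ i) E _ _] := adm_euler Sx; rewrite -[RHS]E; congr (_ + _).
have D j := derM (Drho j Sx) (Du i j Sx).
apply: esym; apply: etrans (divergence_scale Sx D) _; have := adm_mass Sx; rewrite !sum3.
move: (rj _ _) (rj _ _) (rj _ _) (rho x) (J _ _ _) (J _ _ _) (J _ _ _) (J _ _ _) (J _ _ _) (J _ _ _).
move: (u 0 x) (u 1 x) (u 2 x) (u i x) => u0 u1 u2 ui a0 a1 a2 r j0 j1 j2 j3 j4 j5 m.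
apply/eqP; rewrite -subr_eq0; apply/eqP; rewrite -[RHS](mulr0 ui) -m; ring.
Qed.

Definition energy x : R :=
  (u 0 x * u 0 x + u 1 x * u 1 x + u 2 x * u 2 x) / 2 + gamma / (gamma - 1) * (p x / rho x).

Lemma bernoulliE x : cS x -> bernoulli gamma V x = energy x.
Proof.
move=> cx; have px := adm_p cx; have rx := adm_rho cx.
have gn : gamma - 1 != 0 by rewrite subr_eq0 gt_eqF.
rewrite /bernoulli /energy enorm_sqr dotE /sound_speed sqr_sqrtr.
  apply: f_equal2; first exact: erefl.
  rewrite -/(p x) -/(rho x); move: (p x) (rho x) rx => P r rx.
  by field; rewrite gn gt_eqF.
by rewrite divr_ge0 // ?mulr_ge0 // ltW.
Qed.

Lemma Denergy x j : S x -> is_derive x (basis R j) energy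
  (\sum_(i < 3) u i x * J x i j + gamma / (gamma - 1) * ((pj x j * rho x - p x * rj x j) / rho x ^+ 2)).
Proof.
move=> Sx; have rx := adm_rho (shell_sub_closed Sx).
have D i := derM (Du i j Sx) (Du i j Sx).
have Dq := derF (lt0r_neq0 rx) (Dp j Sx) (Drho j Sx).
apply: (is_derive_eq (derD (derM (derD (derD (D 0) (D 1)) (D 2)) (derC 2^-1 _ _))
  (derM (derC (gamma / (gamma - 1)) _ _) Dq))).
by rewrite mul0r add0r mulr0 addr0 sum3; congr (_ + _); field.
Qed.

Lemma energy_C1 : C1_on S energy.
Proof.
have [[Cp _] [Cr _] _] := adm_C2.
have Cu i := (adm_C2u i).1.
have rho0 x : S x -> rho x != 0 by move=> /shell_sub_closed /adm_rho /lt0r_neq0.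
apply: (C1_onD oS); apply: (C1_onM oS); [|exact: C1_onC oS|exact: C1_onC oS|].
  have Cuu i := C1_onM oS (Cu i) (Cu i).
  exact: (C1_onD oS (C1_onD oS (Cuu 0) (Cuu 1)) (Cuu 2)).
exact: C1_onF oS rho0 Cp Cr.
Qed.

Lemma energy_cont : {within cS, continuous energy}.
Proof.
have [cp cr _] := adm_c.
apply: wcD; apply: wcM; [|exact: wcC|exact: wcC|].
  by apply: wcD; [apply: wcD|]; apply: wcM; exact: adm_cu.
by apply: wcF => // x /adm_rho rx; rewrite gt_eqF.
Qed.

Lemma adm_energy x : S x -> \sum_(j < 3) u j x * (\sum_(i < 3) u i x * J x i j
   + gamma / (gamma - 1) * ((pj x j * rho x - p x * rj x j) / rho x ^+ 2)) = 0.
Proof.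
move=> Sx; have [_ _] := adm_euler Sx.
have -> : divergence (fun y => (density V y * bernoulli gamma V y) *: velocity V y) x =
          divergence (fun y => (rho y * energy y) *: velocity V y) x.
  apply: eq_bigr => j _; apply: (partial_eq_on _ oS _ Sx) => y Sy.
  by rewrite !mxE bernoulliE //; exact: shell_sub_closed.
have D j := derM (Drho j Sx) (Denergy j Sx).
rewrite (divergence_scale Sx D); have rx := adm_rho (shell_sub_closed Sx).
pose e j := \sum_(i < 3) u i x * J x i j
   + gamma / (gamma - 1) * ((pj x j * rho x - p x * rj x j) / rho x ^+ 2).
rewrite -[\sum_(j < 3) u j x * _]/(\sum_(j < 3) u j x * e j).
rewrite -[X in X = 0 -> _]/(\sum_(j < 3) ((rj x j * energy x + rho x * e j) * u j x
   + rho x * energy x * J x j j)).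
have := adm_mass Sx; move: e => e; rewrite !sum3.
move: (rj _ _) (rj _ _) (rj _ _) (J _ _ _) (J _ _ _) (J _ _ _) (e 0) (e 1) (e 2).
move: (u 0 x) (u 1 x) (u 2 x) (energy x) (rho x) rx => u0 u1 u2 En r rx.
move=> a0 a1 a2 j0 j1 j2 e0 e1 e2 mass en.
apply: (mulfI (lt0r_neq0 rx)); rewrite mulr0 -[RHS]subr0 -[X in _ = _ - X](mulr0 En).
by rewrite -{1}en -mass; ring.
Qed.

Lemma adm_energy_const x : cS x -> bernoulli gamma V x = E1.
Proof.
move=> cx; rewrite bernoulliE //; move: x cx.
apply: (transport (w := velocity V) r00 r01 energy_cont) => [x Sx|x Sx|x sx].
- apply: (is_derive_eq (C1_is_derive (velocity V x) oS energy_C1 Sx)).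
  rewrite /dot -[RHS](adm_energy Sx); apply: eq_bigr => j _; congr (_ * _).
  by rewrite mxE; exact: is_derive_partial (Denergy j Sx).
- exact: adm_outgoing (shell_sub_closed Sx).
- have cx : cS x by rewrite /closed_shell /= sx lexx ltW.
  rewrite -(bernoulliE cx); have [[_ _ _ H] _ _] := adm.
  by have [-> _ _] := H x (mem_set sx).
Qed.

Lemma ln_pressure x : cS x -> ln (p x) - gamma * ln (rho x) - s x / cnu = ln k0.
Proof.
move=> cx; have [_ rx E] := adm_gas cx; rewrite /p /rho /s E.
have A0 : 0 < Afun k0 cnu (entropy V x) by rewrite mulr_gt0 // expR_gt0.
rewrite lnM ?posrE ?powR_gt0 // ln_powR /Afun lnM ?posrE ?expR_gt0 // expRK.
by ring.
Qed.

Lemma entropy_gradient x j : S x ->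
  pj x j / p x - gamma * (rj x j / rho x) = partial j s x / cnu.
Proof.
move=> Sx; have [_ _ [Cs _]] := adm_C2; have cx := shell_sub_closed Sx.
have Dl (f : 'rV[R]_3 -> R) (df : R) : 0 < f x -> is_derive x (basis R j) f df ->
    is_derive x (basis R j) (fun y => ln (f y)) ((f x)^-1 * df).
  by move=> fx D; exact: (@der_comp R _ (@ln R) f x _ _ _ (is_derive1_ln fx) D).
have D := derB (derB (Dl p _ (adm_p cx) (Dp j Sx))
  (derM (derC gamma x _) (Dl rho _ (adm_rho cx) (Drho j Sx))))
  (derM (C1_partial j Cs Sx) (derC cnu^-1 x _)).
have := derivative_cst_on oS Sx (fun y Sy => ln_pressure (shell_sub_closed Sy)) D.
rewrite mul0r add0r mulr0 addr0 => /eqP; rewrite subr_eq0 => /eqP <-.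
by rewrite ![_^-1 * _]mulrC.
Qed.

Lemma adm_entropy_const x : cS x -> s x = s1.
Proof.
move: x; have [_ _ cs] := adm_c; have [_ _ [Cs _]] := adm_C2.
apply: (transport (w := velocity V) r00 r01 cs) => [x Sx|x Sx|x sx].
- apply: (is_derive_eq (C1_is_derive (velocity V x) oS Cs Sx)).
  have cx := shell_sub_closed Sx.
  have := entropy_transport_algebra gamma1 (adm_p cx) (adm_rho cx)
    (fun i => adm_momentum i Sx) (adm_energy Sx).
  have cn : cnu != 0 by rewrite gt_eqF.
  under eq_bigr => j _ do rewrite entropy_gradient //.
  move=> E; apply: (mulIf (invr_neq0 cn)); rewrite mul0r -[RHS]E /dot mulr_suml.
  by apply: eq_bigr => j _; rewrite mxE mulrA.
- exact: adm_outgoing (shell_sub_closed Sx).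
- by have [[_ _ _ H] _ _] := adm; have [_ sE _] := H x (mem_set sx); exact: sE.
Qed.

Lemma entropy_gradient0 x j : S x -> pj x j / p x - gamma * (rj x j / rho x) = 0.
Proof.
move=> Sx; rewrite entropy_gradient //; have [_ _ [Cs _]] := adm_C2.
have sc y : S y -> s y = s1 by move=> /shell_sub_closed; exact: adm_entropy_const.
by rewrite (derivative_cst_on oS Sx sc (C1_partial j Cs Sx)) mul0r.
Qed.

Lemma energy_gradient0 x j : S x -> \sum_(i < 3) u i x * J x i j
   + gamma / (gamma - 1) * ((pj x j * rho x - p x * rj x j) / rho x ^+ 2) = 0.
Proof.
move=> Sx; apply: (derivative_cst_on (c := E1) oS Sx _ (Denergy j Sx)) => y Sy.
have cy := shell_sub_closed Sy; by rewrite -bernoulliE // adm_energy_const.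
Qed.

Lemma crocco x j : S x -> \sum_(k < 3) u k x * (J x k j - J x j k) = 0.
Proof.
move=> Sx; have cx := shell_sub_closed Sx.
exact: crocco_algebra gamma1 (adm_p cx) (adm_rho cx) (adm_momentum j Sx)
  (energy_gradient0 j Sx) (entropy_gradient0 j Sx).
Qed.

Lemma sonic2E x : cS x -> sonic2 gamma E1 (dot (velocity V x) (velocity V x)) = gamma * p x / rho x.
Proof.
move=> cx; have := adm_energy_const cx; rewrite bernoulliE // /energy => <-.
have rx := adm_rho cx; have gn : gamma - 1 != 0 by rewrite subr_eq0 gt_eqF.
rewrite /sonic2 dotE -/(u 0 x) -/(u 1 x) -/(u 2 x).
move: (u 0 x) (u 1 x) (u 2 x) (p x) (rho x) rx => u0 u1 u2 P r rx.
by field; rewrite gn gt_eqF.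
Qed.

Lemma sonic_equation x : S x ->
  sonic2 gamma E1 (dot (velocity V x) (velocity V x)) * (\sum_(i < 3) J x i i) =
  \sum_(i < 3) \sum_(j < 3) u i x * u j x * J x i j.
Proof.
move=> Sx; have cx := shell_sub_closed Sx; rewrite sonic2E //.
exact: sonic_equation_algebra gamma1 (adm_p cx) (adm_rho cx) (adm_mass Sx)
  (fun i => adm_momentum i Sx) (fun j => entropy_gradient0 j Sx).
Qed.

Let om x k := vorticity (J x) k.

Lemma C1J i j : C1_on S (fun x => J x i j).
Proof. exact: (adm_C2u i).2 j. Qed.

Lemma C1om k : C1_on S (fun x => om x k).
Proof. by apply: (C1_onB oS); exact: C1J. Qed.

Lemma divergence_vorticity x : S x -> \sum_(k < 3) partial k (fun y => om y k) x = 0.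
Proof.
move=> Sx.
have D i j k : is_derive x (basis R k) (fun y => J y i j) (partial k (partial j (u i)) x).
  exact: C1_partial (C1J i j) Sx.
have Dv k : partial k (fun y => om y k) x =
    partial k (partial (k + 1) (u (k + 2))) x - partial k (partial (k + 2) (u (k + 1))) x.
  exact: is_derive_partial (derB (D _ _ _) (D _ _ _)).
rewrite sum3 !Dv.
have e01 : 0 + 1 = 1 :> 'I_3 by apply/val_inj.
have e02 : 0 + 2 = 2 :> 'I_3 by apply/val_inj.
have e11 : 1 + 1 = 2 :> 'I_3 by apply/val_inj.
have e12 : 1 + 2 = 0 :> 'I_3 by apply/val_inj.
have e21 : 2 + 1 = 0 :> 'I_3 by apply/val_inj.
have e22 : 2 + 2 = 1 :> 'I_3 by apply/val_inj.
rewrite e01 e02 e11 e12 e21 e22.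
rewrite (partialC 1 0 oS (adm_C2u 2) Sx) (partialC 2 0 oS (adm_C2u 1) Sx)
  (partialC 2 1 oS (adm_C2u 0) Sx).
by move: (partial _ _ _) (partial _ _ _) (partial _ _ _) => *; ring.
Qed.

(** The ratio of vorticity to mass flux. *)
Let mu x := (\sum_(i < 3) om x i * x 0 i) / (rho x * (\sum_(i < 3) u i x * x 0 i)).

Lemma flux_neq0 x : cS x -> rho x * (\sum_(i < 3) u i x * x 0 i) != 0.
Proof.
move=> cx; rewrite gt_eqF // mulr_gt0 //; first exact: adm_rho.
exact: adm_outgoing.
Qed.

Lemma vorticity_mu x k : S x -> om x k = mu x * (rho x * u k x).
Proof.
move=> Sx; have cx := shell_sub_closed Sx; have fx := flux_neq0 cx.
move: (fx); rewrite mulf_eq0 negb_or => /andP[rx ux].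
exact: (vorticity_parallel rx ux (fun j => crocco j Sx)).
Qed.

Lemma C1_sum3 (h : 'I_3 -> 'rV[R]_3 -> R) : (forall i, C1_on S (h i)) ->
  C1_on S (fun x => \sum_(i < 3) h i x).
Proof.
move=> Ch; apply: (C1_on_eq oS (f := fun x => h 0 x + h 1 x + h 2 x)).
  by move=> x _; rewrite sum3.
exact: C1_onD oS (C1_onD oS (Ch 0) (Ch 1)) (Ch 2).
Qed.

Lemma C1mu : C1_on S mu.
Proof.
have [_ [Cr _] _] := adm_C2.
apply: (C1_onF oS) => [x /shell_sub_closed cx||]; first exact: flux_neq0.
- by apply: C1_sum3 => i; apply: (C1_onM oS); [exact: C1om|exact: C1_on_coord].
- apply: (C1_onM oS Cr); apply: C1_sum3 => i.
  by apply: (C1_onM oS); [exact: (adm_C2u i).1|exact: C1_on_coord].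
Qed.

(** Both [mu rho u], which is the vorticity, and [rho u] are divergence free. *)
Lemma mu_transport x : S x -> is_derive x (velocity V x) mu 0.
Proof.
move=> Sx; have cx := shell_sub_closed Sx; have rx := adm_rho cx.
apply: (is_derive_eq (C1_is_derive (velocity V x) oS C1mu Sx)).
have Dm k : partial k (fun y => om y k) x =
    partial k mu x * (rho x * u k x) + mu x * (rj x k * u k x + rho x * J x k k).
  rewrite (partial_eq_on k oS (fun y Sy => vorticity_mu k Sy) Sx).
  exact: is_derive_partial (derM (C1_partial k C1mu Sx) (derM (Drho k Sx) (Du k k Sx))).
have := divergence_vorticity Sx; rewrite sum3 !Dm => E.
have := adm_mass Sx; rewrite sum3 => mass.
apply: (mulfI (lt0r_neq0 rx)); rewrite mulr0 -[RHS]subr0 -[X in _ = _ - X](mulr0 (mu x)).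
rewrite -{1}E -mass dotE !mxE -/(u 0 x) -/(u 1 x) -/(u 2 x).
move: (partial 0 mu x) (partial 1 mu x) (partial 2 mu x) (J _ _ _) (J _ _ _) (J _ _ _).
move: (rj _ _) (rj _ _) (rj _ _) (u 0 x) (u 1 x) (u 2 x) (rho x) (mu x) => *; ring.
Qed.

Lemma adm_parallel x : sphere r1 x -> velocity V x = (normal_velocity V x / enorm x) *: x.
Proof.
move=> sx; have [[_ _ _ H] _ _] := adm; have [_ _ T] := H x (mem_set sx).
by apply/eqP; rewrite -subr_eq0; apply/eqP.
Qed.

(** On the outer sphere the velocity is normal, so the normal vorticity vanishes
    there and with it the continuous extension [mu'] of the ratio; transport
    carries this to the whole shell. *)
Lemma irrotational x i j : S x -> J x i j = J x j i.
Proof.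
have [g [cg gE]] := adm_extension.
pose mu' x := (\sum_(k < 3) vorticity (fun i j => g i j x) k * x 0 k) /
  (rho x * (\sum_(i < 3) u i x * x 0 i)).
have muE y : S y -> mu y = mu' y.
  move=> Sy; rewrite /mu /mu'; congr (_ / _); apply: eq_bigr => k _; congr (_ * _).
  by rewrite /om /vorticity !gE.
have [_ cr _] := adm_c.
have wcs (h : 'I_3 -> 'rV[R]_3 -> R) : (forall i, {within cS, continuous (h i)}) ->
    {within cS, continuous (fun x => \sum_(i < 3) h i x)}.
  move=> ch; apply: (@eq_within _ _ _ (fun x => h 0 x + h 1 x + h 2 x)).
    by apply: wcD; [apply: wcD|]; exact: ch.
  by move=> y _; rewrite sum3.
have cmu : {within cS, continuous mu'}.
  apply: wcF; first by move=> y; exact: flux_neq0.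
  - apply: wcs => k; apply: wcM; last exact: wc_coord.
    by apply: wcB; exact: cg.
  - apply: wcM; first exact: cr.
    by apply: wcs => k; apply: wcM; [exact: adm_cu|exact: wc_coord].
have mu0 y : cS y -> mu' y = 0.
  move: y; apply: (transport (w := velocity V) r00 r01 cmu) => [y Sy|y Sy|y sy].
  - have nf : \near y, mu y = mu' y.
      by apply: filterS (open_nbhs_nbhs (conj oS Sy)) => z; exact: muE.
    exact: near_eq_is_derive nf (mu_transport Sy).
  - exact: adm_outgoing (shell_sub_closed Sy).
  - rewrite /mu' (@normal_vorticity0 R r0 r1 u g r00 r01 (fun i => (adm_C2u i).1) adm_cu cg _ _ y sy).
    + by rewrite mul0r.
    + by move=> i' j' z; exact: gE.
    + by move=> i' j' z /adm_parallel E; rewrite /u E !mxE; ring.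
move=> Sx; have om0 k : om x k = 0.
  by rewrite vorticity_mu // muE // mu0 ?mul0r //; exact: shell_sub_closed.
have [E0 E1' E2] := vorticityE (J x).
have := om0 0; have := om0 1; have := om0 2; rewrite /om E0 E1' E2.
move=> /eqP; rewrite subr_eq0 => /eqP h2 /eqP; rewrite subr_eq0 => /eqP h1 /eqP.
rewrite subr_eq0 => /eqP h0.
move: i j; apply: ord3P; apply: ord3P.
- exact: erefl.
- exact: esym h2.
- exact: h1.
- exact: h2.
- exact: erefl.
- exact: esym h0.
- exact: esym h1.
- exact: h0.
- exact: erefl.
Qed.

End Admissible.

(** * Smooth radial functions *)

Section Radial.
Context {R : realType}.
Variable (m : R).
Hypothesis m0 : 0 < m.
Implicit Types f h : R -> R.

Definition C1_ray f := exists f1 : R -> R, (forall r : R, m < r -> is_derive r (1 : R) f (f1 r)) /\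
  forall r, m < r -> {for r, continuous f1}.

Lemma C1_ray_cont f r : C1_ray f -> m < r -> {for r, continuous f}.
Proof.
move=> [f1 [D _]] mr; have Dr := D r mr.
by apply/differentiable_continuous/derivable1_diffP.
Qed.

Lemma C1_rayC (c : R) : C1_ray (fun=> c).
Proof. by exists (fun=> 0); split=> r mr; [exact: derC|exact: ctC]. Qed.

Lemma C1_ray_id : C1_ray id.
Proof. by exists (fun=> 1); split=> r mr; [exact: is_derive_id|exact: ctC]. Qed.

Lemma C1_rayN f : C1_ray f -> C1_ray (fun r => - f r).
Proof.
move=> [f1 [D c]]; exists (fun r => - f1 r); split=> r mr; first exact: derN (D r mr).
exact: ctN (c r mr).
Qed.

Lemma C1_rayD f h : C1_ray f -> C1_ray h -> C1_ray (fun r => f r + h r).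
Proof.
move=> [f1 [D c]] [h1 [D' c']]; exists (fun r => f1 r + h1 r).
by split=> r mr; [exact: derD (D r mr) (D' r mr)|exact: ctD (c r mr) (c' r mr)].
Qed.

Lemma C1_rayM f h : C1_ray f -> C1_ray h -> C1_ray (fun r => f r * h r).
Proof.
move=> Cf Ch; have [f1 [D c]] := Cf; have [h1 [D' c']] := Ch.
exists (fun r => f1 r * h r + f r * h1 r); split=> r mr; first exact: derM (D r mr) (D' r mr).
apply: ctD; apply: ctM; [exact: c|exact: C1_ray_cont Ch mr|exact: C1_ray_cont Cf mr|exact: c'].
Qed.

Lemma C1_rayV f : (forall r, m < r -> f r != 0) -> C1_ray f -> C1_ray (fun r => (f r)^-1).
Proof.
move=> f0 Cf; have [f1 [D c]] := Cf; exists (fun r => - f1 r / f r ^+ 2).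
split=> r mr; first exact: derV (f0 r mr) (D r mr).
apply: ctF; [by rewrite expf_neq0 // f0|exact: ctN (c r mr)|].
exact: ctX (C1_ray_cont Cf mr).
Qed.

Let O : set 'rV[R]_3 := (@enorm R) @^-1` `]m, +oo[%classic.

Lemma outside_open : open O.
Proof. by apply: open_comp; [move=> y _; exact: enorm_continuous|exact: interval_open]. Qed.

Lemma outsideP x : O x <-> m < enorm x.
Proof. by rewrite /O /preimage /= in_itv /= andbT. Qed.

Lemma der_radial f f1 x d : (forall r : R, m < r -> is_derive r (1 : R) f (f1 r)) -> m < enorm x ->
  is_derive x d (fun y => f (enorm y)) (f1 (enorm x) * (dot d x / enorm x)).
Proof.
move=> D mx; exact: (@der_comp R _ f (@enorm R) x d _ _ (D _ mx) (der_enorm d (lt_trans m0 mx))).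
Qed.

Lemma C1_radial f : C1_ray f -> C1_on O (fun x => f (enorm x)).
Proof.
move=> [f1 [D c]].
apply: (@C1_onI R O _ (fun i x => f1 (enorm x) * (x 0 i / enorm x)) outside_open) => [i x|i].
  move=> /outsideP mx; apply: (is_derive_eq (der_radial (basis R i) D mx)).
  by rewrite dot_basis.
rewrite continuous_open_subspace; last exact: outside_open.
move=> x; rewrite inE => /outsideP mx.
have c1 : {for x, continuous (fun x => f1 (enorm x))}.
  exact: (@ct_comp _ _ _ (@enorm R) f1 x (c _ mx) (enorm_continuous (x := x))).
have c2 : {for x, continuous (fun x : 'rV[R]_3 => x 0 i / enorm x)}.
  by apply: ctF; [rewrite gt_eqF // (lt_trans m0)|exact: coord_continuous|exact: enorm_continuous].
exact: ctM c1 c2.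
Qed.

Lemma C2_radial f f1 : (forall r : R, m < r -> is_derive r (1 : R) f (f1 r)) -> C1_ray f1 ->
  C2_on O (fun x => f (enorm x)).
Proof.
move=> D Cf1.
apply: (@C2_onI R O _ (fun i x => f1 (enorm x) * (x 0 i / enorm x)) outside_open) => [i x|i].
  move=> /outsideP mx; apply: (is_derive_eq (der_radial (basis R i) D mx)).
  by rewrite dot_basis.
apply: (C1_onM outside_open (C1_radial Cf1)); apply: (C1_onF outside_open).
- by move=> x /outsideP mx; rewrite gt_eqF // (lt_trans m0).
- exact: C1_on_coord outside_open.
- exact: C1_radial C1_ray_id.
Qed.

(** A function that is C^2 on a neighbourhood of the closed shell provides the
    extensions of its own derivatives. *)
Lemma C2_on_regular (a b : R) (f f0 : 'rV[R]_3 -> R) : m < a -> C2_on O f0 ->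
  (forall x, closed_shell a b x -> f x = f0 x) ->
  C2_on (shell a b) f /\ C1_upto (shell a b) (closed_shell a b) f.
Proof.
move=> ma Cf0 ff0; have oS := @shell_open R a b.
have cO x : closed_shell a b x -> O x by move=> /andP[ax _]; apply/outsideP; exact: lt_le_trans ax.
have sO x : shell a b x -> O x by move=> /shell_sub_closed; exact: cO.
have C2 : C2_on (shell a b) f.
  apply: (C2_on_eq oS _ (C2_on_sub outside_open oS sO Cf0)) => x sx.
  by rewrite ff0 //; exact: shell_sub_closed.
split; first exact: C2.
split; [exact: C2.1| |].
  by apply: eq_within (continuous_subspaceW cO Cf0.1.1) _ => x cx; rewrite ff0.
move=> i; exists (partial i f0); first exact: continuous_subspaceW cO (Cf0.1.2 i).2.
move=> x; rewrite inE => sx; apply: (partial_eq_on i oS _ sx) => y sy.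
by rewrite ff0 //; exact: shell_sub_closed.
Qed.

End Radial.

(** * Gas states on a level set of energy and entropy *)

Section GasState.
Context {R : realType}.
Variables (gamma A1 : R).
Hypotheses (gamma1 : 1 < gamma) (A10 : 0 < A1).

(** Density of the gas of entropy constant [A1] in terms of the squared sonic
    speed [c], from [c = gamma A1 rho^(gamma - 1)]. *)
Definition density_of (c : R) : R := expR ((gamma - 1)^-1 * ln (c / (gamma * A1))).
Definition pressure_of (c : R) : R := density_of c * c / gamma.

Let g0 : 0 < gamma := lt_trans ltr01 gamma1.
Let g1 : 0 < gamma - 1. Proof. by rewrite subr_gt0. Qed.

Lemma density_of_gt0 c : 0 < density_of c. Proof. exact: expR_gt0. Qed.

Lemma pressure_of_gt0 c : 0 < c -> 0 < pressure_of c.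
Proof. by move=> c0; rewrite divr_gt0 // mulr_gt0 // density_of_gt0. Qed.

Lemma pressure_ofE c : 0 < c -> pressure_of c = A1 * density_of c `^ gamma.
Proof.
move=> c0; have gA : 0 < gamma * A1 by rewrite mulr_gt0.
apply: (@ln_inj _); rewrite ?posrE ?pressure_of_gt0 ?mulr_gt0 ?powR_gt0 ?density_of_gt0 //.
rewrite /pressure_of !lnM ?posrE ?powR_gt0 ?mulr_gt0 ?density_of_gt0 ?invr_gt0 //.
rewrite ln_powR /density_of expRK lnM ?posrE ?invr_gt0 // !lnV ?posrE // lnM ?posrE //.
by field; rewrite gt_eqF.
Qed.

Lemma sonic_of c : 0 < c -> gamma * pressure_of c / density_of c = c.
Proof.
move=> c0; have d0 := density_of_gt0 c; rewrite /pressure_of.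
by move: (density_of c) d0 => d d0; field; rewrite !gt_eqF.
Qed.

Lemma state_of p r : 0 < p -> 0 < r -> p = A1 * r `^ gamma ->
  r = density_of (gamma * p / r) /\ p = pressure_of (gamma * p / r).
Proof.
move=> p0 r0 pE; have gA : 0 < gamma * A1 by rewrite mulr_gt0.
suff rE : r = density_of (gamma * p / r).
  by split => //; rewrite /pressure_of -rE; field; rewrite !gt_eqF.
apply: (@ln_inj _); rewrite ?posrE ?density_of_gt0 // /density_of expRK.
have -> : gamma * p / r / (gamma * A1) = p / (A1 * r) by field; rewrite !gt_eqF.
have -> : ln (p / (A1 * r)) = (gamma - 1) * ln r.
  rewrite lnM ?posrE ?invr_gt0 ?mulr_gt0 // lnV ?posrE ?mulr_gt0 //.
  by rewrite pE !lnM ?posrE ?powR_gt0 // ln_powR; ring.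
by rewrite mulKf // gt_eqF.
Qed.

End GasState.

(** * The radial solution and its uniqueness *)

Section RadialFlow.
Context {R : realType}.
Implicit Types (x d : 'rV[R]_3).
Variables (gamma k0 cnu r0 r1 p0 E1 s1 : R).
Hypotheses (gamma1 : 1 < gamma) (k00 : 0 < k0) (cnu0 : 0 < cnu) (r00 : 0 < r0) (r01 : r0 < r1).
Hypothesis p00 : 0 < p0.
Let A1 := Afun k0 cnu s1.
Let rho0 := inlet_density gamma k0 cnu p0 s1.
Let q0 := Num.sqrt (2 * (E1 - gamma * p0 / ((gamma - 1) * rho0))).
Let c2 := sonic2 gamma E1.
Hypothesis Egap : 0 < E1 - gamma * p0 / ((gamma - 1) * rho0).
Hypothesis sq0 : subsonic_speed gamma E1 q0.

Let A10 : 0 < A1. Proof. by rewrite mulr_gt0 // expR_gt0. Qed.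
Let g0 : 0 < gamma := lt_trans ltr01 gamma1.
Let g1 : 0 < gamma - 1. Proof. by rewrite subr_gt0. Qed.

Lemma inlet_density_gt0 : 0 < rho0.
Proof. by rewrite powR_gt0 // divr_gt0. Qed.

Lemma inlet_stateE : p0 = A1 * rho0 `^ gamma.
Proof.
rewrite /rho0 /inlet_density -powRrM mulVf ?gt_eqF // powRr1; last by rewrite divr_ge0 // ltW.
by rewrite mulrC divfK // gt_eqF.
Qed.

Lemma q0_sqr : q0 ^+ 2 = 2 * (E1 - gamma * p0 / ((gamma - 1) * rho0)).
Proof. by rewrite sqr_sqrtr // mulr_ge0 // ltW. Qed.

Lemma inlet_sonic : c2 (q0 ^+ 2) = gamma * p0 / rho0.
Proof.
rewrite /c2 /sonic2 q0_sqr; have r := inlet_density_gt0; field.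
by rewrite !gt_eqF.
Qed.

Lemma Afun_inj s t : Afun k0 cnu s = Afun k0 cnu t -> s = t.
Proof.
move=> /(mulfI (lt0r_neq0 k00)) /expR_inj /(mulIf _) -> //.
by rewrite invr_eq0 gt_eqF.
Qed.

Variables (v : R -> R) (rm : R).
Hypotheses (rm0 : 0 < rm) (rmr0 : rm < r0) (vr0 : v r0 = q0).
Hypothesis vP : forall r : R, rm < r -> [/\ subsonic_speed gamma E1 (v r),
     logflux gamma E1 (v r) + 2 * ln r = logflux gamma E1 q0 + 2 * ln r0 &
     is_derive r (1 : R) v (- (2 * c2 (v r ^+ 2) * v r) / (r * (c2 (v r ^+ 2) - v r ^+ 2)))].

Let rhoP r := density_of gamma A1 (c2 (v r ^+ 2)).
Let pP r := pressure_of gamma A1 (c2 (v r ^+ 2)).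

Definition radial_flow : flow R :=
  Flow (fun x => (v (enorm x) / enorm x) *: x) (fun x => pP (enorm x))
       (fun x => rhoP (enorm x)) (fun=> s1).

Lemma c2_gt0 r : rm < r -> 0 < c2 (v r ^+ 2).
Proof. by move=> /vP[[_ vc] _ _]; apply: le_lt_trans vc; exact: sqr_ge0. Qed.

Local Notation cS := (closed_shell r0 r1).
Local Notation S := (shell r0 r1).

Lemma cS_gt x : cS x -> rm < enorm x.
Proof. by move=> /andP[h _]; exact: lt_le_trans h. Qed.

Lemma S_gt x : S x -> rm < enorm x.
Proof. by move=> /shell_sub_closed; exact: cS_gt. Qed.

Lemma radial_gas x : cS x -> gas_state gamma k0 cnu radial_flow x.
Proof.
move=> /cS_gt /c2_gt0 c; split; [exact: pressure_of_gt0|exact: density_of_gt0|].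
exact: pressure_ofE.
Qed.

Let V' r := - (2 * c2 (v r ^+ 2) * v r) / (r * (c2 (v r ^+ 2) - v r ^+ 2)).
Let rho' r := 2 * rhoP r * v r ^+ 2 / (r * (c2 (v r ^+ 2) - v r ^+ 2)).
Let p' r := 2 * rhoP r * c2 (v r ^+ 2) * v r ^+ 2 / (r * (c2 (v r ^+ 2) - v r ^+ 2)).

Lemma ray_facts r : rm < r -> [/\ 0 < r, 0 < v r, 0 < c2 (v r ^+ 2) &
  0 < c2 (v r ^+ 2) - v r ^+ 2].
Proof.
move=> mr; have [[v0 vc] _ _] := vP mr; split; [exact: lt_trans mr|exact: v0|exact: c2_gt0|].
by rewrite subr_gt0.
Qed.

Lemma der_v r : rm < r -> is_derive r (1 : R) v (V' r).
Proof. by move=> /vP[]. Qed.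

Lemma der_c2 r : rm < r -> is_derive r (1 : R) (fun r => c2 (v r ^+ 2)) (- (gamma - 1) * (v r * V' r)).
Proof.
move=> mr; have D := derX (der_v mr).
apply: (is_derive_eq (derM (derC (gamma - 1) _ _) (derB (derC E1 _ _) (derM D (derC 2^-1 _ _))))).
by rewrite mul0r add0r mulr0 addr0 sub0r; field.
Qed.

Lemma der_rhoP r : rm < r -> is_derive r (1 : R) rhoP (rho' r).
Proof.
move=> mr; have [rp v0 c0 cv] := ray_facts mr.
have gA : 0 < gamma * A1 by rewrite mulr_gt0.
have Dq := derM (der_c2 mr) (derC (gamma * A1)^-1 r 1).
have q1 : 0 < c2 (v r ^+ 2) * (gamma * A1)^-1 by rewrite divr_gt0.
have Dl := @der_comp R R (@ln R) (fun r => c2 (v r ^+ 2) * (gamma * A1)^-1) r 1 _ _ (is_derive1_ln q1) Dq.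
have De := derM (derC (gamma - 1)^-1 r 1) Dl.
have D := @der_comp R R (@expR R) (fun r => (gamma - 1)^-1 * ln (c2 (v r ^+ 2) * (gamma * A1)^-1)) r 1 _ _
  (is_derive_expR _) De.
apply: (is_derive_eq D).
rewrite -[expR _]/(rhoP r) /rho' /V' mul0r add0r mulr0 addr0.
move: (rhoP r) (v r) (c2 _) (gamma * A1) v0 c0 cv gA => P W C G W0 C0 CW G0.
by field; rewrite !gt_eqF.
Qed.

Lemma der_pP r : rm < r -> is_derive r (1 : R) pP (p' r).
Proof.
move=> mr; have [rp v0 c0 cv] := ray_facts mr.
apply: (is_derive_eq (derM (derM (der_rhoP mr) (der_c2 mr)) (derC gamma^-1 _ _))).
rewrite /p' /rho' /V' mulr0 addr0.
move: (rhoP r) (v r) (c2 _) v0 c0 cv => P W C W0 C0 CW.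
by field; rewrite !gt_eqF.
Qed.

Lemma sound_speed_radial r : rm < r -> sound_speed gamma (pP r) (rhoP r) ^+ 2 = c2 (v r ^+ 2).
Proof.
move=> mr; have c0 := c2_gt0 mr; rewrite /sound_speed sonic_of //.
by rewrite sqr_sqrtr // ltW.
Qed.

Lemma ray_cont (f : R -> R) (f' : R -> R) : (forall r, rm < r -> is_derive r (1 : R) f (f' r)) ->
  {within `[r0, r1], continuous f}.
Proof.
move=> D; apply: derivable_within_continuous => r; rewrite in_itv /= => /andP[rr _].
by have H := D r (lt_le_trans rmr0 rr); exact: ex_derive.
Qed.

Lemma radial_special : special_solution gamma k0 cnu r0 r1 p0 E1 s1 radial_flow.
Proof.
have [rhoE pE] := state_of gamma1 A10 p00 inlet_density_gt0 inlet_stateE.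
exists v, rhoP, pP; split; last first.
  by move=> x; rewrite inE => cx; split => //; exact: radial_gas.
split.
- by split; [exact: ray_cont der_v|exact: ray_cont der_rhoP|exact: ray_cont der_pP].
- move=> r; rewrite in_itv /= => /andP[rr _]; have mr := lt_le_trans rmr0 rr.
  have [rp v0 c0 cv] := ray_facts mr; split; [exact: pressure_of_gt0|exact: density_of_gt0|].
  rewrite -(@ltr_pXn2r _ 2) ?nnegrE ?sqrtr_ge0 // sound_speed_radial // ger0_norm ?ltW //.
  by rewrite -subr_gt0.
- move=> r; rewrite in_itv /= => /andP[rr _]; have mr := lt_trans rmr0 rr.
  have [rp v0 c0 cv] := ray_facts mr; rewrite sound_speed_radial //; split.
  + apply: (is_derive_eq (der_v mr)); rewrite /V'.
    by field; rewrite -opprB oppr_eq0 !gt_eqF.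
  + apply: (is_derive_eq (der_rhoP mr)); rewrite /rho'.
    by field; rewrite -opprB oppr_eq0 !gt_eqF.
  + apply: (is_derive_eq (der_pP mr)); rewrite /p'.
    by field; rewrite -opprB oppr_eq0 !gt_eqF.
- rewrite /pP /rhoP vr0 inlet_sonic; split.
  + by rewrite -pE.
  + by rewrite -rhoE.
  + exact: sq0.1.
  + exact: erefl.
Qed.

Lemma logflux_density w : subsonic_speed gamma E1 w -> logflux gamma E1 w =
  ln w + ln (density_of gamma A1 (c2 (w ^+ 2))) - (gamma - 1)^-1 * ln ((gamma - 1) / (gamma * A1)).
Proof.
move=> sw; have e0 := subsonic_energy gamma1 sw; have gA : 0 < gamma * A1 by rewrite mulr_gt0.
rewrite /density_of expRK /logflux /c2 /sonic2 -addrA -mulrBr; congr (_ + _ * _).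
have -> : (gamma - 1) * (E1 - w ^+ 2 / 2) / (gamma * A1) =
  (E1 - w ^+ 2 / 2) * ((gamma - 1) / (gamma * A1)) by ring.
by rewrite [in RHS]lnM ?posrE ?divr_gt0 // addrK.
Qed.

Lemma itv_const (f : R -> R) : {within `[r0, r1], continuous f} ->
  (forall r : R, r0 < r < r1 -> is_derive r (1 : R) f 0) ->
  forall r, r0 <= r <= r1 -> f r = f r0.
Proof.
move=> cf D r /andP[]; rewrite le_eqVlt => /orP[/eqP <- //|rr] rr1.
have D' t : t \in `]r0, r[%R -> is_derive t (1 : R) f ((fun=> 0) t).
  by rewrite in_itv /= => /andP[t0 t1]; apply: D; rewrite t0 (lt_le_trans t1).
have cf' : {within `[r0, r], continuous f}.
  apply: continuous_subspaceW cf => t; rewrite /= !in_itv /= => /andP[-> tr].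
  exact: le_trans tr rr1.
have [t _] := MVT rr D' cf'; rewrite mul0r => /eqP; rewrite subr_eq0 => /eqP. by [].
Qed.

Lemma within_ln (f : R -> R) : {within `[r0, r1], continuous f} ->
  (forall r, r0 <= r <= r1 -> 0 < f r) -> {within `[r0, r1], continuous (fun r => ln (f r))}.
Proof.
move=> /subspace_continuousP cf f0; apply/subspace_continuousP => r ir.
have fr : 0 < f r by apply: f0; move: ir; rewrite /= in_itv.
exact: (@cvg_comp _ _ _ f (@ln R) _ _ _ (cf r ir) (continuous_ln fr)).
Qed.

(** Energy, entropy and mass flux are first integrals of the system; with the
    inlet data they determine the squared sonic speed as a function of the speed,
    and the subsonic speed from the mass flux. *)
Lemma special_radial U : special_solution gamma k0 cnu r0 r1 p0 E1 s1 U ->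
  flow_eq_on cS U radial_flow.
Proof.
move=> [u [rho [p [[[cu cr cp] sub ode [bp br bu0 bu]] UE]]]].
have in_r r : r0 <= r <= r1 -> [/\ 0 < r, 0 < p r, 0 < rho r & u r ^+ 2 < gamma * p r / rho r].
  move=> rr; have r00' : 0 < r by case/andP: rr => h _; exact: lt_le_trans h.
  have ri : r \in `[r0, r1]%R by rewrite in_itv.
  have [pr rr0 ur] := sub r ri.
  split => //; rewrite -real_normK ?num_real //.
  have c0 : 0 <= gamma * p r / rho r by rewrite divr_ge0 ?mulr_ge0 // ltW.
  by rewrite -[ltRHS]sqr_sqrtr // ltr_pXn2r // nnegrE // sqrtr_ge0.
have D r : r0 < r < r1 -> let C := gamma * p r / rho r in
   [/\ is_derive r (1 : R) u (2 * C * u r / (r * (u r ^+ 2 - C))),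
       is_derive r (1 : R) rho (- (2 * rho r * u r ^+ 2 / (r * (u r ^+ 2 - C)))) &
       is_derive r (1 : R) p (- (2 * rho r * C * u r ^+ 2 / (r * (u r ^+ 2 - C))))].
  move=> rr C; have ri : r0 <= r <= r1 by case/andP: rr => h1 h2; rewrite !ltW.
  have [rp pr rr0 ur] := in_r r ri.
  have := ode r; rewrite in_itv /= => /(_ rr).
  rewrite /sound_speed sqr_sqrtr //.
  by rewrite divr_ge0 ?mulr_ge0 // ltW.
have K1 r : r0 <= r <= r1 -> u r ^+ 2 / 2 + gamma / (gamma - 1) * (p r / rho r) = E1.
  move=> rr; transitivity (u r0 ^+ 2 / 2 + gamma / (gamma - 1) * (p r0 / rho r0)); last first.
    rewrite bu q0_sqr bp br -/rho0; have r' := inlet_density_gt0.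
    by field; rewrite !gt_eqF.
  apply: (itv_const (f := fun r => u r ^+ 2 / 2 + gamma / (gamma - 1) * (p r / rho r))) rr.
    apply: wcD; apply: wcM; [exact: (wcM cu cu)|exact: wcC|exact: wcC|].
    by apply: wcF => // t; rewrite /= in_itv => /in_r[_ _ h _]; rewrite gt_eqF.
  move=> r' rr'; have [Du Dr Dp] := D r' rr'.
  have [rp pr rr0 ur] := in_r r' (subset_itv_oo_cc rr').
  apply: (is_derive_eq (derD (derM (derX Du) (derC 2^-1 _ _)) (derM (derC (gamma / (gamma - 1)) _ _)
    (derF (lt0r_neq0 rr0) Dp Dr)))).
  pose C := gamma * p r' / rho r'.
  have pE : p r' = C * rho r' / gamma by rewrite /C; field; rewrite !gt_eqF.
  have CW : 0 < C - u r' ^+ 2 by rewrite subr_gt0.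
  rewrite -/C; clearbody C; rewrite pE.
  have h1 : u r' ^+ 2 - C != 0 by rewrite -opprB oppr_eq0 gt_eqF.
  by field; rewrite h1 !gt_eqF.
have K2 r : r0 <= r <= r1 -> ln (p r) - gamma * ln (rho r) = ln A1.
  move=> rr; transitivity (ln (p r0) - gamma * ln (rho r0)); last first.
    have rg : 0 < rho0 `^ gamma by exact: (powR_gt0 _ inlet_density_gt0).
    by rewrite bp br -/rho0 {1}inlet_stateE lnM ?posrE // ln_powR addrK.
  have c : {within `[r0, r1], continuous (fun r => ln (p r) - gamma * ln (rho r))}.
    apply: wcB; first by apply: (within_ln cp) => t /in_r[].
    by apply: wcM; [exact: wcC|apply: (within_ln cr) => t /in_r[]].
  apply: (itv_const c _ rr) => r' rr'; have [Du Dr Dp] := D r' rr'.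
  have [rp pr rr0 ur] := in_r r' (subset_itv_oo_cc rr').
  have Dlp := @der_comp R R (@ln R) p r' 1 _ _ (is_derive1_ln pr) Dp.
  have Dlr := @der_comp R R (@ln R) rho r' 1 _ _ (is_derive1_ln rr0) Dr.
  apply: (is_derive_eq (derB Dlp (derM (derC gamma _ _) Dlr))).
  pose C := gamma * p r' / rho r'.
  have pE : p r' = C * rho r' / gamma by rewrite /C; field; rewrite !gt_eqF.
  have C0 : 0 < C by rewrite divr_gt0 // mulr_gt0.
  have CW : 0 < C - u r' ^+ 2 by rewrite subr_gt0.
  rewrite -/C; clearbody C; rewrite pE.
  have h1 : u r' ^+ 2 - C != 0 by rewrite -opprB oppr_eq0 gt_eqF.
  by field; rewrite h1 !gt_eqF.
have K3 r : r0 <= r <= r1 -> r * r * (rho r * u r) = r0 * r0 * (rho0 * q0).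
  move=> rr; transitivity (r0 * r0 * (rho r0 * u r0)); last by rewrite br bu.
  apply: (itv_const (f := fun r => r * r * (rho r * u r))) rr.
    apply: wcM; last exact: (wcM cr cu).
    have cid : {within `[r0, r1], continuous (fun r : R => r)}.
      by apply: continuous_subspaceT => t; exact: cvg_id.
    exact: (wcM cid cid).
  move=> r' rr'; have [Du Dr Dp] := D r' rr'.
  have [rp pr rr0 ur] := in_r r' (subset_itv_oo_cc rr').
  have Di := is_derive_id r' (1 : R).
  apply: (is_derive_eq (derM (derM Di Di) (derM Dr Du))).
  pose C := gamma * p r' / rho r'.
  have CW : 0 < C - u r' ^+ 2 by rewrite subr_gt0.
  rewrite -/C; clearbody C.
  have h1 : u r' ^+ 2 - C != 0 by rewrite -opprB oppr_eq0 gt_eqF.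
  by rewrite /=; field; rewrite h1 !gt_eqF.
have [rho0E _] := state_of gamma1 A10 p00 inlet_density_gt0 inlet_stateE.
have key r : r0 <= r <= r1 -> [/\ u r = v r, rho r = rhoP r & p r = pP r].
  move=> rr; have [rp pr rr0 ur] := in_r r rr; have mr : rm < r by case/andP: rr => h _; exact: lt_le_trans h.
  have ur0 : 0 < u r.
    have : 0 < r * r * (rho r * u r).
      rewrite K3 //; apply: mulr_gt0; first exact: mulr_gt0.
      exact: mulr_gt0 inlet_density_gt0 sq0.1.
    by rewrite (pmulr_rgt0 _ (mulr_gt0 rp rp)) (pmulr_rgt0 _ rr0).
  have cE : c2 (u r ^+ 2) = gamma * p r / rho r.
    by rewrite /c2 /sonic2 -(K1 r rr); field; rewrite !gt_eqF.
  have su : subsonic_speed gamma E1 (u r) by split => //; rewrite -/c2 cE.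
  have gasE : p r = A1 * rho r `^ gamma.
    have rg : 0 < rho r `^ gamma by exact: powR_gt0.
    have Ag : 0 < A1 * rho r `^ gamma by exact: mulr_gt0.
    apply: (@ln_inj _); rewrite ?posrE //.
    by rewrite lnM ?posrE // ln_powR -(K2 r rr) subrK.
  have [rhoE pE] := state_of gamma1 A10 pr rr0 gasE; rewrite -cE in rhoE pE.
  suff uv : u r = v r by split; [exact: uv|rewrite /rhoP -uv|rewrite /pP -uv].
  have [sv Hv _] := vP mr; apply: (logflux_inj gamma1 su sv).
  apply: (addIr (2 * ln r)); rewrite Hv !logflux_density // -rhoE inlet_sonic -rho0E.
  have L a b c : 0 < a -> 0 < b -> 0 < c -> ln (a * a * (b * c)) = 2 * ln a + (ln b + ln c).
    by move=> ha hb hc; rewrite !lnM ?posrE ?mulr_gt0 //; ring.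
  have := congr1 (@ln R) (K3 r rr); rewrite !L ?inlet_density_gt0 //; last by case: sq0.
  set k := (gamma - 1)^-1 * _; move=> E.
  transitivity ((2 * ln r + (ln (rho r) + ln (u r))) - k); first by ring.
  by rewrite E; ring.
move=> x; rewrite inE => cx; have [uE rE pE [px rx gE]] := UE x (mem_set cx).
have [E1' E2' E3'] := key (enorm x) cx.
split; first by rewrite uE E1'.
- by rewrite pE E3'.
- by rewrite rE E2'.
- apply: Afun_inj; have mx := cS_gt cx.
  have rn : density U x `^ gamma != 0 by rewrite gt_eqF // powR_gt0.
  by apply: (mulIf rn); rewrite -gE pE rE E3' E2' /pP pressure_ofE // c2_gt0.
Qed.

(** The mass flux of the radial flow is [G(|x|) x]; it is divergence free because
    [r^3 G] is constant. *)
Let G r := rhoP r * (v r / r).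

Lemma der_G r : rm < r -> is_derive r (1 : R) G (- (3 * G r / r)).
Proof.
move=> mr; have [rp v0 c0 cv] := ray_facts mr.
apply: (is_derive_eq (derM (der_rhoP mr) (derF (lt0r_neq0 rp) (der_v mr) (is_derive_id r (1 : R))))).
rewrite /rho' /V' /G /=; move: (rhoP r) (v r) (c2 _) v0 c0 cv => P W C W0 C0 CW.
by field; rewrite !gt_eqF.
Qed.

(** Each flux is the mass flux [G x] times a function [h], with divergence
    [G x . grad h], so the Euler equations reduce to the system of ordinary
    differential equations.  Regularity up to the boundary is free, as the profile
    continues below [r0] and beyond [r1]. *)
Lemma radial_admissible V : flow_eq_on cS V radial_flow ->
  admissible_solution gamma k0 cnu r0 r1 p0 E1 s1 V.
Proof.
move=> VE; have VEx x : cS x -> [/\ velocity V x = (v (enorm x) / enorm x) *: x,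
    pressure V x = pP (enorm x), density V x = rhoP (enorm x) & entropy V x = s1].
  by move=> cx; exact: VE x (mem_set cx).
have oS := @shell_open R r0 r1.
have sc := @shell_sub_closed R r0 r1.
have nE x : cS x -> normal_velocity V x = v (enorm x).
  move=> cx; have [Ev _ _ _] := VEx x cx; have x0 := lt_trans rm0 (cS_gt cx).
  by rewrite /normal_velocity Ev dotZl -enorm_sqr; field; rewrite gt_eqF.
have bE x : cS x -> bernoulli gamma V x = E1.
  move=> cx; have [Ev Ep Er _] := VEx x cx; have mx := cS_gt cx.
  have [rp v0 c0 cv] := ray_facts mx.
  rewrite /bernoulli Ev Ep Er sound_speed_radial // enormZ gtr0_norm ?divr_gt0 //.
  by rewrite divfK ?gt_eqF // /c2 /sonic2; field; rewrite gt_eqF.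
have eul x : S x -> euler gamma V x.
  move=> Sx; have mx := S_gt Sx; have [rp v0 c0 cv] := ray_facts mx.
  (* Divergence of the mass flux times [h]. *)
  have Ldiv (F : 'rV[R]_3 -> 'rV[R]_3) (h : 'rV[R]_3 -> R) (dh : 'I_3 -> R) :
      (forall y, S y -> forall j, F y 0 j = G (enorm y) * y 0 j * h y) ->
      (forall j, is_derive x (basis R j) h (dh j)) ->
      divergence F x = G (enorm x) * \sum_(j < 3) x 0 j * dh j.
    move=> FE Dh.
    have Dj j : partial j (fun y => F y 0 j) x =
        (- (3 * G (enorm x) / enorm x) * (x 0 j / enorm x) * x 0 j + G (enorm x)) * h x
        + G (enorm x) * x 0 j * dh j.
      rewrite (partial_eq_on j oS (fun y Sy => FE y Sy j) Sx); apply: is_derive_partial.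
      have DG := der_radial rm0 (basis R j) der_G mx; rewrite dot_basis in DG.
      apply: (is_derive_eq (derM (derM DG (der_coord x (basis R j) j)) (Dh j))).
      by rewrite basisE eqxx mulr1.
    rewrite /divergence !sum3 !Dj.
    have xx := enorm_sqr x; rewrite dotE in xx.
    move: (G (enorm x)) (h x) (dh 0) (dh 1) (dh 2) => g h' h0 h1 h2.
    transitivity (g * (x 0 0 * h0 + x 0 1 * h1 + x 0 2 * h2)
      + 3 * g * h' * (1 - (x 0 0 * x 0 0 + x 0 1 * x 0 1 + x 0 2 * x 0 2) / enorm x ^+ 2)).
      by field; rewrite gt_eqF.
    by rewrite -xx divff ?subrr ?mulr0 ?addr0 // expf_neq0 // gt_eqF.
  have VjE y j : S y -> density V y * velocity V y 0 j = G (enorm y) * y 0 j.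
    by move=> /sc /VEx[-> _ -> _]; rewrite mxE /G mulrA.
  split.
  - move=> i.
    have Dh j : is_derive x (basis R j) (fun y => v (enorm y) / enorm y * y 0 i)
        ((V' (enorm x) * enorm x - v (enorm x)) / enorm x ^+ 2 * (x 0 j / enorm x) * x 0 i +
         v (enorm x) / enorm x * basis R j 0 i).
      have Dq r : rm < r -> is_derive r (1 : R) (fun r => v r / r) ((V' r * r - v r) / r ^+ 2).
        move=> mr; have [rp' _ _ _] := ray_facts mr.
        apply: (is_derive_eq (derF (lt0r_neq0 rp') (der_v mr) (is_derive_id r (1 : R)))).
        by rewrite /= mulr1.
      have := derM (der_radial rm0 (basis R j) Dq mx) (der_coord x (basis R j) i).
      by rewrite dot_basis.
    rewrite (Ldiv _ (fun y => v (enorm y) / enorm y * y 0 i) _ _ Dh); last first.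
      move=> y Sy j; rewrite mxE -VjE //; have [-> _ _ _] := VEx y (sc _ Sy).
      by rewrite !mxE; ring.
    have -> : partial i (pressure V) x = p' (enorm x) * (x 0 i / enorm x).
      have PE y : S y -> pressure V y = pP (enorm y) by move=> /sc /VEx[].
      rewrite (partial_eq_on i oS PE Sx).
      have Dp := der_radial rm0 (basis R i) der_pP mx; rewrite dot_basis in Dp.
      exact: is_derive_partial Dp.
    have -> : \sum_(j < 3) x 0 j * ((V' (enorm x) * enorm x - v (enorm x)) / enorm x ^+ 2 *
        (x 0 j / enorm x) * x 0 i + v (enorm x) / enorm x * basis R j 0 i) = V' (enorm x) * x 0 i.
      have -> : \sum_(j < 3) x 0 j * ((V' (enorm x) * enorm x - v (enorm x)) / enorm x ^+ 2 *
        (x 0 j / enorm x) * x 0 i + v (enorm x) / enorm x * basis R j 0 i) =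
        (V' (enorm x) * enorm x - v (enorm x)) / enorm x ^+ 2 / enorm x * x 0 i * dot x x
        + v (enorm x) / enorm x * x 0 i.
        rewrite sum3 dotE !basisE; move: (V' _) (v _) => W' W.
        by move: i {Dh}; apply: ord3P; rewrite /= ?eqxx /=; ring.
      rewrite -enorm_sqr; move: (V' _) (v _) => W' W.
      by field; rewrite gt_eqF.
    rewrite /G /V' /p'; move: (rhoP _) (v _) (c2 _) v0 c0 cv => P W C W0 C0 CW.
    by field; rewrite !gt_eqF.
  - rewrite (Ldiv _ (fun=> 1) _ _ (fun j => derC 1 x (basis R j))).
      by rewrite sum3 !mulr0 !addr0 mulr0.
    by move=> y Sy j; rewrite mxE VjE // mulr1.
  - rewrite (Ldiv _ (fun=> E1) _ _ (fun j => derC E1 x (basis R j))).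
      by rewrite sum3 !mulr0 !addr0 mulr0.
    by move=> y Sy j; rewrite mxE (bE y (sc _ Sy)) -VjE //; ring.
have [rhoE0 pE0] := state_of gamma1 A10 p00 inlet_density_gt0 inlet_stateE.
split; first split.
- move=> x; rewrite inE => cx; have [_ Ep Er Es] := VEx x cx; have mx := cS_gt cx.
  rewrite /gas_state Ep Er Es; split; [|exact: density_of_gt0|].
    by apply: pressure_of_gt0 => //; exact: c2_gt0.
  by apply: pressure_ofE => //; exact: c2_gt0.
- by move=> x; rewrite inE; exact: eul.
- move=> x; rewrite inE => sx; have cx : cS x by rewrite /closed_shell /= sx lexx ltW.
  by have [_ -> _ _] := VEx x cx; rewrite sx /pP vr0 inlet_sonic -pE0.
- move=> x; rewrite inE => sx; have cx : cS x by rewrite /closed_shell /= sx lexx ltW.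
  have [Ev _ _ Es] := VEx x cx; split; [exact: bE|exact: Es|].
  by rewrite /tangential_velocity nE // Ev subrr.
- have Cv : C1_ray rm v.
    exists V'; split; first exact: der_v.
    move=> r mr; have [rp v0 c0 cv] := ray_facts mr.
    have ctv : {for r, continuous v}.
      by have D := der_v mr; apply/differentiable_continuous/derivable1_diffP.
    have ctc : {for r, continuous (fun r => c2 (v r ^+ 2))}.
      by have D := der_c2 mr; apply/differentiable_continuous/derivable1_diffP.
    apply: ctF; first by rewrite mulf_neq0 // gt_eqF.
      by apply: ctN; apply: ctM; [apply: ctM; [exact: ctC|exact: ctc]|exact: ctv].
    by apply: ctM; [exact: cvg_id|apply: ctB; [exact: ctc|exact: ctX ctv]].
  have Cv2 : C1_ray rm (fun r => v r ^+ 2) by exact: (C1_rayM Cv Cv).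
  have Cc : C1_ray rm (fun r => c2 (v r ^+ 2)).
    apply: C1_rayM; first exact: C1_rayC.
    by apply: C1_rayD; [exact: C1_rayC|apply: C1_rayN; apply: C1_rayM; [exact: Cv2|exact: C1_rayC]].
  have Cd : C1_ray rm (fun r => (r * (c2 (v r ^+ 2) - v r ^+ 2))^-1).
    apply: C1_rayV.
      by move=> r mr; have [rp v0 c0 cv] := ray_facts mr; rewrite mulf_neq0 // gt_eqF.
    apply: C1_rayM; first exact: C1_ray_id.
    by apply: C1_rayD; [exact: Cc|exact: C1_rayN].
  have CV' : C1_ray rm V'.
    apply: C1_rayM Cd; apply: C1_rayN; apply: C1_rayM Cv.
    by apply: C1_rayM Cc; exact: C1_rayC.
  have C2v := C2_radial rm0 der_v CV'.
  have Cr : C1_ray rm rhoP.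
    exists rho'; split; first exact: der_rhoP.
    move=> r mr; have [rp v0 c0 cv] := ray_facts mr.
    have ctr : {for r, continuous rhoP}.
      by have D := der_rhoP mr; apply/differentiable_continuous/derivable1_diffP.
    apply: ctM (C1_ray_cont Cd mr).
    by apply: ctM; [apply: ctM; [exact: ctC|exact: ctr]|exact: C1_ray_cont Cv2 mr].
  have Cr' : C1_ray rm rho'.
    apply: C1_rayM Cd; apply: C1_rayM Cv2; apply: C1_rayM Cr; exact: C1_rayC.
  have Cp' : C1_ray rm p'.
    apply: C1_rayM Cd; apply: C1_rayM Cv2; apply: C1_rayM Cc; apply: C1_rayM Cr; exact: C1_rayC.
  have Cbeta : C1_ray rm (fun r => (V' r * r - v r) / r ^+ 2).
    apply: C1_rayM.
      by apply: C1_rayD (C1_rayN Cv); apply: C1_rayM CV' (@C1_ray_id R rm).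
    apply: C1_rayV; last exact: (C1_rayM (@C1_ray_id R rm) (@C1_ray_id R rm)).
    by move=> r mr; rewrite expf_neq0 // gt_eqF // (lt_trans rm0).
  have Db r : rm < r -> is_derive r (1 : R) (fun r => v r / r) ((V' r * r - v r) / r ^+ 2).
    move=> mr; have [rp' _ _ _] := ray_facts mr.
    apply: (is_derive_eq (derF (lt0r_neq0 rp') (der_v mr) (is_derive_id r (1 : R)))).
    by rewrite /= mulr1.
  split.
  + move=> i; have C2b := C2_radial rm0 Db Cbeta.
    have C2x := C2_onM (@outside_open R rm) C2b (C2_on_coord i (@outside_open R rm)).
    apply: (@C2_on_regular R rm r0 r1 (fun x => velocity V x 0 i) _ rmr0 C2x) => x cx.
    by have [-> _ _ _] := VEx x cx; rewrite mxE.
  + apply: (@C2_on_regular R rm r0 r1 _ _ rmr0 (C2_radial rm0 der_pP Cp')) => x cx.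
    by have [_ -> _ _] := VEx x cx.
  + apply: (@C2_on_regular R rm r0 r1 _ _ rmr0 (C2_radial rm0 der_rhoP Cr')) => x cx.
    by have [_ _ -> _] := VEx x cx.
  + apply: (@C2_on_regular R rm r0 r1 _ _ rmr0 (C2_onC s1 (@outside_open R rm))) => x cx.
    by have [_ _ _ ->] := VEx x cx.
- move=> x; rewrite inE => cx; have [_ _ Er _] := VEx x cx; have mx := cS_gt cx.
  have [rp v0 c0 cv] := ray_facts mx.
  by rewrite Er nE // mulr_gt0 // density_of_gt0.
Qed.

(** Energy and entropy are constant and the flow is irrotational, so the rigidity
    of potential flows gives the velocity; the state follows from it. *)
Lemma admissible_radial V : admissible_solution gamma k0 cnu r0 r1 p0 E1 s1 V ->
  flow_eq_on cS V radial_flow.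
Proof.
move=> adm.
have cE := adm_energy_const gamma1 r00 r01 adm.
have cs := adm_entropy_const gamma1 k00 cnu0 r00 r01 adm.
have gasV x : cS x -> pressure V x = A1 * density V x `^ gamma.
  by move=> cx; have [_ _ ->] := adm_gas adm cx; rewrite (cs x cx).
have inlet x : sphere r0 x -> dot (velocity V x) (velocity V x) = q0 ^+ 2.
  move=> sx; have cx : cS x by rewrite /closed_shell /= sx lexx ltW.
  have pE : pressure V x = p0 by have [[_ _ H _] _ _] := adm; apply: H; rewrite inE.
  have rx := adm_rho adm cx.
  have rE : density V x = rho0.
    have rn := inlet_density_gt0.
    apply: (@ln_inj _); rewrite ?posrE //; apply: (mulfI (lt0r_neq0 g0)).
    rewrite -!ln_powR; congr (ln _); apply: (mulfI (lt0r_neq0 A10)).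
    by rewrite -gasV // pE; exact: inlet_stateE.
  have := sonic2E gamma1 r00 r01 adm cx; rewrite pE rE -inlet_sonic /c2 /sonic2.
  by move=> /(mulfI (lt0r_neq0 g1)); move: (dot _ _) (q0 ^+ 2) => a b; lra.
have [g [cg gE]] := adm_extension adm.
have [P HP] : exists P : R -> R, forall r : R, (rm + r0) / 2 < r -> is_derive r (1 : R) P (v r).
  apply: (@antiderivative R v rm) => [|r mr]; first by rewrite midf_lt.
  by have [_ _ D] := vP mr; apply/differentiable_continuous/derivable1_diffP.
have m1 : rm < (rm + r0) / 2 by rewrite midf_lt.
have m2 : (rm + r0) / 2 < r0 by rewrite midf_lt.
have velS x : S x -> velocity V x = (v (enorm x) / enorm x) *: x.
  apply: (@velocity_radial_interior R gamma E1 q0 r0 r1 rm v rm0 rmr0 r01 vr0 _ _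
    (velocity V) g _ _ cg gE _ _ _ _ inlet _ P m1 m2 HP).
  - by move=> r /vP[].
  - by move=> r /vP[].
  - by move=> i; have [] := adm_C2u adm i.
  - exact: adm_cu adm.
  - move=> i j y Sy; rewrite -!gE //; exact: (irrotational gamma1 k00 cnu0 r00 r01 adm).
  - move=> y d sy yd; rewrite (adm_parallel adm sy) dotZl yd mulr0. by [].
  - by move=> y /shell_sub_closed; exact: (adm_outgoing r00 adm).
  - by move=> y; exact: (sonic_equation gamma1 k00 cnu0 r00 r01 adm).
have vel x : cS x -> velocity V x = (v (enorm x) / enorm x) *: x.
  move=> cx; apply/rowP => i; rewrite [RHS]mxE.
  have cu : {within cS, continuous (fun x => velocity V x 0 i)} by exact: (adm_cu adm).
  apply: (@eq_closed_shell R r0 r1 (fun x => velocity V x 0 i)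
    (fun x => v (enorm x) / enorm x * x 0 i) r00 r01 cu _ _ x cx).
  - apply/subspace_continuousP => y cy; apply: cvg_within_filter.
    have my := cS_gt cy; have [_ _ D] := vP my.
    have c1 : {for y, continuous (fun x => v (enorm x))}.
      apply: (@ct_comp _ _ _ (@enorm R) v y _ (enorm_continuous (x := y))).
      by apply/differentiable_continuous/derivable1_diffP.
    have c3 : {for y, continuous (fun x => v (enorm x) / enorm x)}.
      by apply: ctF; [rewrite gt_eqF // (lt_trans rm0)|exact: c1|exact: enorm_continuous].
    have c4 : {for y, continuous (fun x : 'rV[R]_3 => x 0 i)} by exact: coord_continuous.
    exact: ctM c3 c4.
  - by move=> y Sy; rewrite velS // mxE.
move=> x; rewrite inE => cx; have mx := cS_gt cx; have x0 := lt_trans rm0 mx.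
have := sonic2E gamma1 r00 r01 adm cx.
have -> : dot (velocity V x) (velocity V x) = v (enorm x) ^+ 2.
  by rewrite vel // dotZl dotC dotZl -enorm_sqr; field; rewrite gt_eqF.
move=> cE2; have [rE pE] := state_of gamma1 A10 (adm_p adm cx) (adm_rho adm cx) (gasV x cx).
split; [exact: vel| | |exact: cs].
- by rewrite pE -cE2.
- by rewrite rE -cE2.
Qed.

End RadialFlow.

(** * The inlet condition *)

(** The critical state [c^2 = |u|^2] on the energy level [E1] has
    [c^2 = 2 (gamma - 1) / (gamma + 1) E1]; the lower bound on [p0] is the pressure
    at that state, and pressure increases with [c^2]. *)
Lemma inlet_subsonic (R : realType) (gamma k0 cnu p0 E1 s1 : R) :
  1 < gamma -> 0 < k0 -> 0 < p0 ->
  (2 / gamma * ((gamma - 1) / (gamma + 1))) `^ (gamma / (gamma - 1))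
    * E1 `^ (gamma / (gamma - 1))
    * Afun k0 cnu s1 `^ (- (gamma - 1)^-1) < p0 ->
  0 < E1 - gamma * p0 / ((gamma - 1) * inlet_density gamma k0 cnu p0 s1) ->
  subsonic_speed gamma E1 (Num.sqrt (2 * (E1 - gamma * p0 / ((gamma - 1) *
    inlet_density gamma k0 cnu p0 s1)))).
Proof.
move=> g1 k00 p00 large gap.
have g0 : 0 < gamma by apply: lt_trans g1.
have gm : 0 < gamma - 1 by rewrite subr_gt0.
have gp : 0 < gamma + 1 by rewrite addr_gt0.
have A10 : 0 < Afun k0 cnu s1 by rewrite mulr_gt0 // expR_gt0.
have r0 : 0 < inlet_density gamma k0 cnu p0 s1 by exact: inlet_density_gt0.
have pE := inlet_stateE cnu s1 g1 k00 p00.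
have [_ pC] := state_of g1 A10 p00 r0 pE.
split; first by rewrite sqrtr_gt0 mulr_gt0.
rewrite inlet_sonic // q0_sqr //.
move: (inlet_density _ _ _ _ _) r0 gap pC {pE} => rho r0 gap.
set C := gamma * p0 / rho => pC.
have C0 : 0 < C by rewrite divr_gt0 // mulr_gt0.
have -> : gamma * p0 / ((gamma - 1) * rho) = C / (gamma - 1).
  by rewrite /C; field; rewrite !gt_eqF.
have E10 : 0 < E1.
  by move: gap; rewrite subr_gt0; apply: lt_trans; rewrite divr_gt0 ?mulr_gt0.
pose b := 2 / gamma * ((gamma - 1) / (gamma + 1)).
have b0 : 0 < b by rewrite mulr_gt0 // divr_gt0.
suff lt : b * E1 < C / gamma.
  rewrite -subr_gt0.
  have -> : C - 2 * (E1 - C / (gamma - 1)) = (gamma * (gamma + 1) / (gamma - 1)) * (C / gamma - b * E1).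
    by rewrite /b; field; rewrite !gt_eqF.
  by rewrite mulr_gt0 ?subr_gt0 // divr_gt0 // mulr_gt0.
have Cg : 0 < C / gamma by rewrite divr_gt0.
have bE : 0 < b * E1 by rewrite mulr_gt0.
rewrite -ltr_ln ?posrE //.
have a0 : 0 < gamma / (gamma - 1) by rewrite divr_gt0.
rewrite -(ltr_pM2l a0) -(ltrD2r (- (gamma - 1)^-1 * ln (Afun k0 cnu s1))).
have pb : 0 < b `^ (gamma / (gamma - 1)) by exact: powR_gt0.
have pEp : 0 < E1 `^ (gamma / (gamma - 1)) by exact: powR_gt0.
have pA : 0 < Afun k0 cnu s1 `^ (- (gamma - 1)^-1) by exact: powR_gt0.
have -> : gamma / (gamma - 1) * ln (b * E1) + - (gamma - 1)^-1 * ln (Afun k0 cnu s1) =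
    ln (b `^ (gamma / (gamma - 1)) * E1 `^ (gamma / (gamma - 1)) * Afun k0 cnu s1 `^ (- (gamma - 1)^-1)).
  have M (x y : R) : 0 < x -> 0 < y -> ln (x * y) = ln x + ln y by move=> hx hy; rewrite lnM ?posrE.
  rewrite (M _ _ (mulr_gt0 pb pEp) pA) (M _ _ pb pEp) (M _ _ b0 E10) !ln_powR.
  by ring.
have -> : gamma / (gamma - 1) * ln (C / gamma) + - (gamma - 1)^-1 * ln (Afun k0 cnu s1) = ln p0.
  have -> : ln p0 = ln (density_of gamma (Afun k0 cnu s1) C) + ln (C / gamma).
    by rewrite {1}pC /pressure_of -mulrA lnM ?posrE ?density_of_gt0.
  rewrite /density_of expRK.
  have -> : C / (gamma * Afun k0 cnu s1) = C / gamma * (Afun k0 cnu s1)^-1.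
    by field; rewrite !gt_eqF.
  have -> : ln (C / gamma * (Afun k0 cnu s1)^-1) = ln (C / gamma) - ln (Afun k0 cnu s1).
    by rewrite -lnV ?posrE // -lnM ?posrE ?invr_gt0.
  by field; rewrite gt_eqF.
by rewrite ltr_ln ?posrE ?mulr_gt0.
Qed.

Theorem theorem3p1 (R : realType) (gamma k0 cnu r0 r1 p0 E1 s1 : R) :
  1 < gamma -> 0 < k0 -> 0 < cnu -> 0 < r0 -> r0 < r1 -> 0 < p0 ->
  (2 / gamma * ((gamma - 1) / (gamma + 1))) `^ (gamma / (gamma - 1))
    * E1 `^ (gamma / (gamma - 1))
    * Afun k0 cnu s1 `^ (- (gamma - 1)^-1) < p0 ->
  0 < E1 - gamma * p0 / ((gamma - 1) * inlet_density gamma k0 cnu p0 s1) ->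
  (exists U : flow R, special_solution gamma k0 cnu r0 r1 p0 E1 s1 U) /\
  (forall U : flow R, special_solution gamma k0 cnu r0 r1 p0 E1 s1 U ->
   forall V : flow R,
     admissible_solution gamma k0 cnu r0 r1 p0 E1 s1 V <->
     flow_eq_on (closed_shell r0 r1) V U).
Proof.
move=> g1 k00 cnu0 r00 r01 p00 large gap.
have sq0 := inlet_subsonic g1 k00 p00 large gap.
have [v [rm [rm0 rmr0 vr0 vP]]] := profile_exists g1 r00 sq0.
split.
  exists (radial_flow gamma k0 cnu E1 s1 v).
  exact: (radial_special r1 g1 k00 p00 gap sq0 rm0 rmr0 vr0 vP).
move=> U /(special_radial g1 k00 cnu0 r00 p00 gap sq0 rmr0 vP) UE V; split=> [adm|VU].
  have VE := admissible_radial g1 k00 cnu0 r00 r01 p00 gap rm0 rmr0 vr0 vP adm.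
  by move=> x cx; have [-> -> -> ->] := UE x cx; exact: VE.
apply: (radial_admissible g1 k00 r01 p00 gap rm0 rmr0 vr0 vP) => x cx.
by have [-> -> -> ->] := VU x cx; exact: UE.
Qed.
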